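(* Let $(\Omega,\mathcal H,\overline{\mathbf E})$ be a sublinear expectation space and let $X_1,X_2,\dots$ be random variables that are i.i.d. with $X_0$ under $\overline{\mathbf E}$, where $X_0,X_0^2\in\mathcal H$ and $0<\underline\sigma\le\overline\sigma<\infty$. Let $n\ge 1$ be an integer. Then for each set $D\subset\mathbb C[0,1]$ (not necessarily measurable) and any $\varepsilon>0$ there exist values $\{(\mu_i,\sigma_i)\}_{i=1}^n\in\mathcal M_n$, which may depend on $D,\varepsilon,n$, such that for $p\in[2,3]$ $$\overline{\mathbf P}(S_n\in D)-\mathbf P(B\in D^{\varepsilon})\le \frac{C_2(p)\,\gamma_p(\varepsilon\sqrt n)}{n^{(p-2)/2}\varepsilon^{p}}\le\frac{C_2(p)\,\gamma_p}{n^{(p-2)/2}\varepsilon^{p}},$$ where $C_2(p):=\min\{184,(4.7)^{p+1}\}$, $S_n$ is the random broken line built from $\{(\mu_i,\sigma_i)\}$, and $B$ is a standard Wiener process on $[0,1]$ (on a classical probability space with probability $\mathbf P$).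
   Context: Sublinear expectation space: $\mathcal H$ is a linear space of real-valued random variables on $\Omega$ containing the constants, and $\overline{\mathbf E}:\mathcal H\to\mathbb R$ satisfies for $X,Y\in\mathcal H$: (i) $\overline{\mathbf E}[X]\le\overline{\mathbf E}[Y]$ if $X\le Y$; (ii) $\overline{\mathbf E}[c]=c$ for constants $c$; (iii) $\overline{\mathbf E}[X+Y]\le\overline{\mathbf E}[X]+\overline{\mathbf E}[Y]$; (iv) $\overline{\mathbf E}[\lambda X]=\lambda\overline{\mathbf E}[X]$ for constants $\lambda\ge0$. Put $\underline{\mathbf E}[X]:=-\overline{\mathbf E}[-X]$. Independence: a random vector $\vec Y\in\mathbb R^l$ is independent to $\vec X\in\mathbb R^m$ if for all bounded continuous $\psi:\mathbb R^{l+m}\to\mathbb R$ one has $\psi(\vec X,\vec Y)\in\mathcal H$ and $\overline{\mathbf E}[\psi(\vec X,\vec Y)]=\overline{\mathbf E}\big[\overline{\mathbf E}[\psi(\vec x,\vec Y)]|_{\vec x=\vec X}\big]$. The sequence $X_1,X_2,\dots$ is i.i.d. with $X_0$ if for each $k\ge2$, $X_k$ is independent to $\vec X_{k-1}=(X_1,\dots,X_{k-1})$, and for every $k\ge1$, $\overline{\mathbf E}[\psi(X_k)]=\overline{\mathbf E}[\psi(X_0)]$ for every bounded continuous $\psi:\mathbb R\to\mathbb R$. In particular $\psi(\vec X_k)\in\mathcal H$ for all bounded continuous $\psi:\mathbb R^k\to\mathbb R$. Parameters: $\underline\mu=\underline{\mathbf E}[X_0]\le\overline\mu=\overline{\mathbf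 E}[X_0]$; for $\mu\in[\underline\mu,\overline\mu]$, $\underline\sigma^2(\mu)=\underline{\mathbf E}[(X_0-\mu)^2]$, $\overline\sigma^2(\mu)=\overline{\mathbf E}[(X_0-\mu)^2]$ (with nonnegative square roots $\underline\sigma(\mu),\overline\sigma(\mu)$); $\underline\sigma=\inf_{\mu\in[\underline\mu,\overline\mu]}\underline\sigma(\mu)$, $\overline\sigma=\sup_{\mu\in[\underline\mu,\overline\mu]}\overline\sigma(\mu)$. Extended expectation: for any $\phi:\mathbb R\to\mathbb R$, $\overline{\mathbf E}[\phi(X_0)]:=\inf\{\overline{\mathbf E}[X]: X\ge\phi(X_0),\ X\in\mathcal H\}\le\infty$, with $\inf\emptyset=\infty$. Moments: $\xi_0(\mu):=(X_0-\mu)/\underline\sigma(\mu)$; for $C>0$, $p\ge2$, $\gamma_p(C):=\sup_{\mu\in[\underline\mu,\overline\mu]}\overline{\mathbf E}\big[\min\{|\xi_0(\mu)|^p,\,C^{p-2}\xi_0^2(\mu)\}\big]$ and $\gamma_p:=\sup_{\mu\in[\underline\mu,\overline\mu]}\overline{\mathbf E}[|\xi_0(\mu)|^p]\le\infty$. Normalizations: $\mathcal M_n$ is the set of all sequences $\{(\mu_i,\sigma_i)\}_{i=1}^n$ such that for each $i$, $\mu_i$ and $\sigma_i$ are continuous functions of $\vec X_{i-1}=(X_1,\dots,X_{i-1})$ (constants for $i=1$) with $\underline\mu\le\mu_i\le\overline\mu$ and $\underline\sigma\le\underline\sigma(\mu_i)\le\sigma_i\le\overline\sigma(\mu_i)\le\overline\sigma$.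 Given such a sequence, $S_n=S_n(\cdot)$ is the random continuous broken line on $[0,1]$, linear on each $[\frac{k-1}n,\frac kn]$, with $S_n(0)=0$ and $S_n(\frac kn)=\frac1{\sqrt n}\sum_{i=1}^k\frac{X_i-\mu_i}{\sigma_i}$, $k=1,\dots,n$. Upper probability: $\overline{\mathbf P}(S_n\in D):=\inf\{\overline{\mathbf E}\psi(\vec X_n):\ \psi(\vec X_n)\ge \mathbf I(S_n\in D),\ \psi(\vec X_n)\in\mathcal H\}$, $\mathbf I$ denoting the indicator. $\mathbb C[0,1]$ is the space of continuous real functions on $[0,1]$ with the uniform norm $\|\cdot\|$, and $D^\varepsilon=\{x\in\mathbb C[0,1]:\exists y\in D,\ \|x-y\|<\varepsilon\}$. *)

(* Defs.v *)
From HB Require Import structures.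
From mathcomp Require Import all_boot all_order all_algebra.
From mathcomp Require Import all_classical all_reals all_analysis.

Set Implicit Arguments.
Unset Strict Implicit.
Unset Printing Implicit Defensive.

Import Order.TTheory GRing.Theory Num.Theory.
Import numFieldNormedType.Exports.

Local Open Scope classical_set_scope.
Local Open Scope ring_scope.

Section sublinear_expectation.
Context {R : realType} {Omega : Type}.

(* [E] is a total function, but its values are meaningful only on [H]. *)
Record sublinear_expectation (H : set (Omega -> R)) (E : (Omega -> R) -> R)
    : Prop := SublinearExpectation {
  sle_cstH : forall c : R, H (fun=> c) ;
  sle_addH : forall X Y, H X -> H Y -> H (fun w => X w + Y w) ;
  sle_scaleH : forall (a : R) X, H X -> H (fun w => a * X w) ;
  sle_mono : forall X Y, H X -> H Y -> (forall w, X w <= Y w) -> E X <= E Y ;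
  sle_cst : forall c : R, E (fun=> c) = c ;
  sle_subadd : forall X Y, H X -> H Y -> E (fun w => X w + Y w) <= E X + E Y ;
  sle_pos_homo : forall (a : R) X, 0 <= a -> H X ->
    E (fun w => a * X w) = a * E X
}.

Variables (H : set (Omega -> R)) (E : (Omega -> R) -> R).

Definition lower_exp (X : Omega -> R) : R := - E (fun w => - X w).

(* The infimum of an empty set is +oo. By monotonicity this agrees with [E]
   on [H]; it never evaluates [E] outside of [H]. *)
Definition ext_exp (Y : Omega -> R) : \bar R :=
  ereal_inf [set (E X)%:E | X in [set X | H X /\ forall w, Y w <= X w]].

(* The sections [psi (x, Y)] are bounded continuous functions of [(X, Y)], so
   the inner [E] is evaluated on [H]. As [x |-> E (psi (x, Y))] need not be
   known in advance to give an element of [H] at [x = X], the outer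
   expectation on the right is the extended one. *)
Definition independent_to (l m : nat) (Y : Omega -> 'rV[R]_l)
    (X : Omega -> 'rV[R]_m) : Prop :=
  forall psi : 'rV[R]_(m + l) -> R, continuous psi -> bounded_fun psi ->
    H (fun w => psi (row_mx (X w) (Y w))) /\
    (E (fun w => psi (row_mx (X w) (Y w))))%:E =
      ext_exp (fun w => E (fun w' => psi (row_mx (X w) (Y w')))).

(* (X 1, ..., X k) for a sequence starting with X 0 *)
Definition first_vars (X : nat -> Omega -> R) (k : nat) (w : Omega) : 'rV[R]_k :=
  \row_(j < k) X j.+1 w.

(* [X 1, X 2, ...] are i.i.d. with [X 0]. As [psi (X 0)] is not assumed to be
   in [H], its expectation is the extended one. *)
Definition iid_with0 (X : nat -> Omega -> R) : Prop :=
  (forall k, (2 <= k)%N ->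
     independent_to (fun w => \row_(_ < 1) X k w) (first_vars X k.-1)) /\
  (forall k, (1 <= k)%N ->
     forall psi : R -> R, continuous psi -> bounded_fun psi ->
       (E (fun w => psi (X k w)))%:E = ext_exp (fun w => psi (X 0%N w))).

Section parameters.
Variable X0 : Omega -> R.

Definition mu_lo : R := lower_exp X0.
Definition mu_hi : R := E X0.

Definition sigma_lo (mu : R) : R :=
  Num.sqrt (lower_exp (fun w => (X0 w - mu) ^+ 2)).
Definition sigma_hi (mu : R) : R :=
  Num.sqrt (E (fun w => (X0 w - mu) ^+ 2)).

Definition sigma_inf : \bar R :=
  ereal_inf [set (sigma_lo mu)%:E | mu in `[mu_lo, mu_hi]].
Definition sigma_sup : \bar R :=
  ereal_sup [set (sigma_hi mu)%:E | mu in `[mu_lo, mu_hi]].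

Definition xi0 (mu : R) (w : Omega) : R := (X0 w - mu) / sigma_lo mu.

Definition gamma_trunc (p C : R) : \bar R :=
  ereal_sup [set ext_exp (fun w =>
      Num.min (`|xi0 mu w| `^ p) (C `^ (p - 2) * xi0 mu w ^+ 2))
    | mu in `[mu_lo, mu_hi]].

Definition gamma (p : R) : \bar R :=
  ereal_sup [set ext_exp (fun w => `|xi0 mu w| `^ p) | mu in `[mu_lo, mu_hi]].

(* [mu i] and [sigma i] are the (i+1)-st pair of values, as functions of the
   first i variables; entries with index [i >= n] are irrelevant. *)
Definition normalization (n : nat) (mu sigma : forall i : nat, 'rV[R]_i -> R)
    : Prop :=
  forall i : nat, (i < n)%N ->
    [/\ continuous (mu i), continuous (sigma i) &
      forall x : 'rV[R]_i,
        mu_lo <= mu i x <= mu_hi /\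
        [/\ (sigma_inf <= (sigma_lo (mu i x))%:E)%E,
            sigma_lo (mu i x) <= sigma i x,
            sigma i x <= sigma_hi (mu i x) &
            ((sigma_hi (mu i x))%:E <= sigma_sup)%E]].

End parameters.
End sublinear_expectation.

Notation unitI R := (set_type (`[0%R, 1%R]%classic : set R)).

Notation C01 R := (continuousType (unitI R) R).

Section continuous_functions.
Context {R : realType}.

Definition unif_dist (x y : C01 R) : R :=
  sup (range (fun t : unitI R => `|x t - y t|)).

Definition enlarge (D : set (C01 R)) (eps : R) : set (C01 R) :=
  [set x | exists2 y, D y & unif_dist x y < eps].

(* The i-th factor increases linearly from 0 to 1 on [i/n, (i+1)/n] and is
   constant elsewhere; see [broken_line_node] and [broken_line_linear]. *)
Definition broken_line_fun (n : nat) (z : nat -> R) (t : R) : R :=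
  (Num.sqrt n%:R)^-1 *
    \sum_(i < n) Num.min 1 (Num.max 0 (n%:R * t - i%:R)) * z i.

Lemma broken_line_node n z (k : nat) : (0 < n)%N -> (k <= n)%N ->
  broken_line_fun n z (k%:R / n%:R) =
    (Num.sqrt n%:R)^-1 * \sum_(i < k) z i.
Proof.
move=> n0 kn; rewrite /broken_line_fun; congr (_ * _).
have nz : (n%:R : R) != 0 by rewrite pnatr_eq0 -lt0n.
rewrite -(big_mkord xpredT z).
rewrite -(big_mkord xpredT (fun i =>
  Num.min 1 (Num.max 0 (n%:R * (k%:R / n%:R) - i%:R)) * z i)).
rewrite (big_cat_nat (n := k)) //=.
rewrite [n%:R * _]mulrC divfK//.
have -> : \sum_(k <= i < n) Num.min 1 (Num.max 0 (k%:R - i%:R)) * z i = 0 :> R.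
  rewrite big_nat_cond big1// => i /andP[/andP[ki _] _].
  by rewrite max_l ?subr_le0 ?ler_nat// min_r// mul0r.
rewrite addr0.
rewrite big_nat_cond [RHS]big_nat_cond; apply: eq_bigr => i /andP[/andP[_ ik] _].
have h : (1 : R) <= k%:R - i%:R by rewrite lerBrDr nat1r ler_nat.
by rewrite max_r ?(le_trans _ h)// min_l// mul1r.
Qed.

Lemma broken_line_linear n z (k : nat) (t : R) : (k < n)%N ->
  k%:R / n%:R <= t <= k.+1%:R / n%:R ->
  broken_line_fun n z t = broken_line_fun n z (k%:R / n%:R) +
    (Num.sqrt n%:R)^-1 * ((n%:R * t - k%:R) * z k).
Proof.
move=> kn; have n0 : (0 < n)%N by exact: leq_ltn_trans kn.
have nz : (0 : R) < n%:R by rewrite ltr0n.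
rewrite ler_pdivrMr// ler_pdivlMr// mulrC => /andP[kt tk].
rewrite (broken_line_node z n0 (ltnW kn)) -mulrDr /broken_line_fun; congr (_ * _).
rewrite -(big_mkord xpredT z).
rewrite -(big_mkord xpredT (fun i => Num.min 1 (Num.max 0 (n%:R * t - i%:R)) * z i)).
rewrite (big_cat_nat (n := k)) ?(ltnW kn)//= (big_ltn kn); congr (_ + _).
  rewrite big_nat_cond [RHS]big_nat_cond.
  apply: eq_bigr => i /andP[/andP[_ ik] _].
  have h : (1 : R) <= n%:R * t - i%:R.
    by rewrite lerBrDr (le_trans _ kt)// nat1r ler_nat.
  by rewrite max_r ?(le_trans _ h)// min_l// mul1r.
rewrite max_r ?subr_ge0// min_r ?lerBlDr ?nat1r//.
rewrite [X in _ + X = _](_ : _ = 0) ?addr0//.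
rewrite big_nat_cond big1// => i /andP[/andP[ki _] _].
rewrite max_l ?min_r ?mul0r// subr_le0 (le_trans tk)//.
by rewrite ler_nat.
Qed.

Lemma continuous_broken_line n z :
  continuous (fun t : unitI R => broken_line_fun n z (set_val t)).
Proof.
have cv : continuous (set_val : unitI R -> R) by exact: initial_continuous.
have ca (i : nat) : continuous (fun t : unitI R => n%:R * set_val t - i%:R).
  by move=> t; exact: (cvgB (cvgM (cvg_cst _) (cv t)) (cvg_cst _)).
have cm (i : nat) : continuous (fun t : unitI R =>
    Num.min 1 (Num.max 0 (n%:R * set_val t - i%:R)) : R^o).
  move=> t; apply: (@continuous_min _ _ (cst 1)
    (cst 0 \max (fun t : unitI R => n%:R * set_val t - i%:R))).
    exact: cst_continuous.
  by apply: continuous_max; [exact: cst_continuous | exact: ca].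
have cs : continuous (fun t : unitI R =>
    \sum_(i < n) Num.min 1 (Num.max 0 (n%:R * set_val t - i%:R)) * z i).
  apply: continuous_big => [|i _ t]; first exact: add_continuous.
  exact: (cvgM (cm i t) (cvg_cst _)).
by move=> t; exact: (cvgM (cvg_cst _) (cs t)).
Qed.

Definition broken_line (n : nat) (z : nat -> R) : C01 R :=
  mkcts (@continuous_broken_line n z).

End continuous_functions.

Section random_broken_line.
Context {R : realType} {Omega : Type}.
Variables (H : set (Omega -> R)) (E : (Omega -> R) -> R) (X : nat -> Omega -> R).

Definition S_line (n : nat) (mu sigma : forall i : nat, 'rV[R]_i -> R)
    (w : Omega) : C01 R :=
  broken_line n (fun i =>
    (X i.+1 w - mu i (first_vars X i w)) / sigma i (first_vars X i w)).

(* [psi] is an arbitrary function, not necessarily continuous. *)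
Definition upper_prob (n : nat) (S : Omega -> C01 R) (D : set (C01 R))
    : \bar R :=
  ereal_inf [set (E (fun w => psi (first_vars X n w)))%:E | psi in
    [set psi : 'rV[R]_n -> R | H (fun w => psi (first_vars X n w)) /\
       forall w, \1_D (S w) <= psi (first_vars X n w)]].

End random_broken_line.

Section wiener_process.
Context {R : realType} {d : measure_display} {T : measurableType d}.

(* In [wiener_indep] some of the [A i] may be the whole line, so the product
   rule for all [m] increments is their mutual independence. *)
Record standard_wiener (P : probability T R) (B : T -> C01 R) : Prop :=
    StandardWiener {
  wiener_measurable : forall t : unitI R,
    measurable_fun [set: T] (fun w => B w t) ;
  wiener_start : forall t : unitI R, set_val t = 0 ->
    {ae P, forall w, B w t = 0} ;
  wiener_gauss : forall s t : unitI R, set_val s < set_val t ->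
    forall A : set R, measurable A ->
      P [set w | A (B w t - B w s)] =
      normal_prob 0 (Num.sqrt (set_val t - set_val s)) A ;
  wiener_indep : forall (m : nat) (t : nat -> unitI R),
    (forall i, (i < m)%N -> set_val (t i) <= set_val (t i.+1)) ->
    forall A : nat -> set R, (forall i, measurable (A i)) ->
      P [set w | forall i, (i < m)%N ->
           A i (B w (t i.+1) - B w (t i))] =
      (\prod_(i < m) P [set w |
           A i (B w (t i.+1) - B w (t i))%R])%E
}.

End wiener_process.

Definition C2 {R : realType} (p : R) : R :=
  Num.min 184 ((47 / 10) `^ (p + 1)).

(* Main.v *)
(** This is Lindeberg's replacement method, played as a game. The indicator of [D] is dominated
    by a Lipschitz function of the nodes of the broken line that tolerates an error [e] at the
    nodes still to be visited. If all steps after the [k]-th one are replaced by independent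
    [N(0, 1/n)] variables, its mean becomes, after averaging it three times over windows of
    half-width [e / 3], a function [F] of the current position whose Taylor remainder of order
    two is explicitly bounded. Exchanging one Gaussian step for [(X - mu) / (sigma sqrt n)]
    therefore costs [O(gamma_p / (eps sqrt n)^p)], provided that the Taylor terms of orders one
    and two do not contribute. They do not if [mu] is the end of [[mu_lo, mu_hi]] selected by
    the sign of [F'], so that [E[F' (X - mu)] = 0], and if [sigma] is [sigma_lo mu] or
    [sigma_hi mu] according to the sign of [F''], so that [E[F'' ((X - mu) / sigma)^2] = F''];
    a continuous transition between these choices costs arbitrarily little. Finally the Wiener
    process stays close to its broken line through the nodes [i / n]: by exponential martingales
    for line crossings, each of the [n] bridges exceeds [eps / 3] with probability at most
    [4 exp(- n eps^2 / 9)]. *)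

Require Import Defs.
From mathcomp Require Import all_boot all_order all_algebra.
From mathcomp Require Import all_classical all_reals all_analysis.
From mathcomp Require Import measurable_realfun.
From mathcomp Require Import ring lra.
Set Implicit Arguments.
Unset Strict Implicit.
Unset Printing Implicit Defensive.
Import Order.TTheory GRing.Theory Num.Theory.
Import numFieldNormedType.Exports.
Local Open Scope classical_set_scope.
Local Open Scope ring_scope.

(** * Elementary inequalities *)

(** Averaging displaces the position by up to [3 * a] at every step, and these errors must not add
    up over [n] steps. The node just visited is therefore kept in the recorded path while the walk
    continues from the displaced point, and the target opens its tolerance at that one node: each
    node pays for one displacement only. The distance budget consists of [6 * a] (tolerance at the
    nodes and displaced start), [eps / 3] for the bridges and two slacks of [eps / 400], whence
    [a = 11 / 100 * eps]. The Taylor remainder is a minimum of a cubic and a quadratic term; a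
    weighted geometric mean of the two serves every [p] in [[2, 3]] and produces the truncated
    moment. The strategy is fixed before [p] and the Wiener process are given, so the transition
    cost has to be small uniformly in [p]. Gaussian expectations are iterated one-dimensional
    integrals of Lipschitz functions of paths: no product measure occurs, and the resulting
    continuity keeps the functionals of the sample in [H]. The bound is trivial unless
    [C = eps * Num.sqrt n%:R] is at least [142 / 25]; from there on the Wiener error fits below
    [C2 p]. *)

Ltac derive_field := apply: is_derive_eq; rewrite ?scaler0 ?addr0 ?add0r /GRing.scale/=; field.

Lemma norm_unit_le1 {R : realType} (x : R) : 0 <= x <= 1 -> `|x| <= 1.
Proof. by move=> /andP[x0 x1]; rewrite ger0_norm. Qed.

Section elementary_inequalities.
Context {R : realType}.
Implicit Types (f df : R -> R) (x y a b r t q C : R).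

(** The mean value theorem for [g - f]. Iterated from [cos <= 1] or from [1 + x <= expR x], it
    yields the Taylor bounds below without any series. *)
Lemma le_of_derive f g df dg :
  (forall x, is_derive x (1:R) f (df x)) -> (forall x, is_derive x (1:R) g (dg x)) ->
  f 0 <= g 0 -> (forall x, 0 <= x -> df x <= dg x) ->
  forall x, 0 <= x -> f x <= g x.
Proof.
move=> hf hg fg0 dfg x x0.
have hd y : is_derive y (1:R) (g - f) (dg y - df y) by exact: is_deriveB.
have [|c] := @MVT_segment R (g - f) (fun y => dg y - df y) 0 x x0 (fun y _ => hd y).
  apply/continuous_subspaceT => r.
  exact/differentiable_continuous/derivable1_diffP.
rewrite in_itv/= subr0 => /andP[c0 _] E.
have : 0 <= (dg c - df c) * x by rewrite mulr_ge0// subr_ge0 dfg.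
by rewrite -E !fctE; lra.
Qed.

Lemma cos_ge_taylor6 x : 0 <= x ->
  1 - x ^+ 2 / 2 + x ^+ 4 / 24 - x ^+ 6 / 6 / 120 <= cos x.
Proof.
have s1 : forall x, 0 <= x -> sin x <= x.
  apply: (@le_of_derive sin id cos (fun=> 1)) => [|y _]; last exact: cos_le1.
  by rewrite sin0.
have c2 : forall x, 0 <= x -> 1 - x ^+ 2 / 2 <= cos x.
  apply: (@le_of_derive (fun y => 1 - y ^+ 2 / 2) cos (fun y => - y) (fun y => - sin y)) => [y||y y0].
  - by derive_field.
  - by rewrite cos0; lra.
  - by rewrite lerN2 s1.
have s3 : forall x, 0 <= x -> x - x ^+ 3 / 6 <= sin x.
  apply: (@le_of_derive (fun y => y - y ^+ 3 / 6) sin (fun y => 1 - y ^+ 2 / 2) cos) => [y||y y0].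
  - by derive_field.
  - by rewrite sin0; lra.
  - exact: c2.
have c4 : forall x, 0 <= x -> cos x <= 1 - x ^+ 2 / 2 + x ^+ 4 / 24.
  apply: (@le_of_derive cos (fun y => 1 - y ^+ 2 / 2 + y ^+ 4 / 24) (fun y => - sin y)
     (fun y => - (y - y ^+ 3 / 6))) => [y||y y0].
  - by derive_field.
  - by rewrite cos0; lra.
  - by rewrite lerN2 s3.
have s5 : forall x, 0 <= x -> sin x <= x - x ^+ 3 / 6 + x ^+ 5 / 120.
  apply: (@le_of_derive sin (fun y => y - y ^+ 3 / 6 + y ^+ 5 / 120) cos
     (fun y => 1 - y ^+ 2 / 2 + y ^+ 4 / 24)) => [y||y y0].
  - by derive_field.
  - by rewrite sin0; lra.
  - exact: c4.
move: x; apply: (@le_of_derive (fun x => 1 - x ^+ 2 / 2 + x ^+ 4 / 24 - x ^+ 6 / 6 / 120) cos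
   (fun y => - (y - y ^+ 3 / 6 + y ^+ 5 / 120)) (fun y => - sin y)) => [y||y y0].
- by derive_field.
- by rewrite cos0; lra.
- by rewrite lerN2 s5.
Qed.

(** The Taylor polynomial of degree six is positive at [14 / 9], so this point lies below the first
    zero [pi / 2] of [cos]. The precision is what the bound on the third absolute Gaussian moment
    needs. *)
Lemma pi_ge28_9 : 28 / 9 <= pi :> R.
Proof.
have [x hx] : exists x : R, x = 14 / 9 by eexists.
have x0 : 0 <= x by rewrite hx divr_ge0.
have c0 : 0 < cos x.
  apply: lt_le_trans (cos_ge_taylor6 x0).
  have -> : x ^+ 4 = (x ^+ 2) ^+ 2 by ring.
  have -> : x ^+ 6 = (x ^+ 2) ^+ 3 by ring.
  have : 12 / 5 <= x ^+ 2 <= 121 / 50 by rewrite hx; lra.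
  move: (x ^+ 2) => y /andP[y1 y2].
  have y0 : 0 <= y by lra.
  have yy : 576 / 100 <= y ^+ 2.
    have := ler_wpM2l y0 y1; rewrite -expr2; lra.
  have y2' : y ^+ 2 <= 586 / 100.
    have := ler_wpM2l y0 y2; rewrite -expr2; lra.
  have yyy : y ^+ 3 <= 142 / 10.
    have := ler_wpM2l y0 y2'; rewrite -exprS; lra.
  lra.
suff : x <= pi / 2 by rewrite hx; lra.
rewrite leNgt; apply/negP => piub.
have p2 := @pi_ge2 R.
have x2 : x <= 2 by rewrite hx; lra.
have : cos x < cos (pi / 2).
  by rewrite ltr_cos// in_itv/=; lra.
by rewrite cos_pihalf => /(lt_trans c0); rewrite ltxx.
Qed.

Lemma expR_ge_taylor4 x : 0 <= x ->
  1 + x + x ^+ 2 / 2 + x ^+ 3 / 6 + x ^+ 4 / 24 <= expR x.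
Proof.
have e2 : forall x, 0 <= x -> 1 + x + x ^+ 2 / 2 <= expR x.
  apply: (@le_of_derive (fun x => 1 + x + x ^+ 2 / 2) expR (fun x => 1 + x) expR) => [y||y y0].
  - by derive_field.
  - by rewrite expR0; lra.
  - exact: expR_ge1Dx.
have e3 : forall x, 0 <= x -> 1 + x + x ^+ 2 / 2 + x ^+ 3 / 6 <= expR x.
  apply: (@le_of_derive (fun x => 1 + x + x ^+ 2 / 2 + x ^+ 3 / 6) expR
    (fun x => 1 + x + x ^+ 2 / 2) expR) => [y||y y0].
  - by derive_field.
  - by rewrite expR0; lra.
  - exact: e2.
move: x; apply: (@le_of_derive (fun x => 1 + x + x ^+ 2 / 2 + x ^+ 3 / 6 + x ^+ 4 / 24) expR
    (fun x => 1 + x + x ^+ 2 / 2 + x ^+ 3 / 6) expR) => [y||y y0].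
- by derive_field.
- by rewrite expR0; lra.
- exact: e3.
Qed.

(** Concavity of [ln]: its tangent at the weighted mean [m] of [x] and [1] bounds both [ln x] and
    [ln 1], and in the convex combination of the two bounds the linear terms cancel. *)
Lemma powR_le1D x r : 0 < x -> 0 <= r <= 1 -> x `^ r <= 1 + r * (x - 1).
Proof.
move=> x0 /andP[r0 r1].
have [->|rn1] := eqVneq r 1; first by rewrite powRr1 ?(ltW x0)//; lra.
pose m := 1 + r * (x - 1).
have m0 : 0 < m.
  have : 0 <= r * x by rewrite mulr_ge0// ltW.
  have : r < 1 by rewrite lt_neqAle rn1.
  by rewrite /m; lra.
have h y : 0 < y -> ln y <= ln m + (y / m - 1).
  move=> y0; have := @le_ln1Dx R (y / m - 1).
  rewrite ltrBrDl addrN divr_gt0// => /(_ isT).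
  rewrite addrC subrK ln_div ?posrE//; lra.
rewrite -[leRHS](@lnK _ m)// /powR gt_eqF// ler_expR.
have hx := ler_wpM2l r0 (h _ x0).
have h1 := @ler_wpM2l _ (1 - r) _ _ _ (h 1 ltr01).
rewrite ln1 mulr0 in h1.
have {h1} : 0 <= (1 - r) * (ln m + (1 / m - 1)) by apply: h1; lra.
have e : r * (ln m + (x / m - 1)) + (1 - r) * (ln m + (1 / m - 1)) = ln m.
  have : (1 + r * (x - 1)) / m = 1 by rewrite divff// gt_eqF.
  rewrite mulrDl => mm; lra.
lra.
Qed.

(** The previous inequality for the [r]-th power of [t], with exponent [r^-1]. *)
Lemma powR_ge1D t r : 0 <= t -> 1 <= r -> 1 + r * (t - 1) <= t `^ r.
Proof.
rewrite le_eqVlt => /predU1P[<-|t0] r1.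
  by rewrite powR0 ?gt_eqF//; lra.
have r0 : 0 < r by lra.
have := @powR_le1D (t `^ r) r^-1 (powR_gt0 r t0).
rewrite invr_ge0 ltW//= invf_le1// r1 => /(_ isT).
rewrite -powRrM divff ?gt_eqF// powRr1 ?(ltW t0)// => h.
have := ler_wpM2l (ltW r0) h.
rewrite mulrDr mulrA divff ?gt_eqF// mul1r; lra.
Qed.

(** The minimum is at most the geometric mean [(a t)^q b^(1 - q)], and
    [a^q b^(1 - q) <= q a + (1 - q) b]. In each branch Bernoulli's inequality for a ratio of [a] and
    [b] takes the place of the second step. *)
Lemma min_le_interpolate a b t q : 0 < a -> 0 < b -> 0 < t -> 0 <= q <= 1 ->
  Num.min (a * t) b <= (q * a + (1 - q) * b) * t `^ q.
Proof.
move=> a0 b0 t0 /andP[q0 q1].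
have tq : 0 < t `^ q by exact: powR_gt0.
have [atb|bat] := leP (a * t) b.
- rewrite -[leLHS](divfK (lt0r_neq0 tq)) ler_pM2r//.
  have -> : a * t / t `^ q = a * t `^ (1 - q).
    by rewrite -mulrA powRB ?powRr1 ?ltW//; apply/implyP; rewrite (gt_eqF t0).
  have : a * t `^ (1 - q) <= a * (b / a) `^ (1 - q).
    rewrite ler_pM2l// ge0_ler_powR ?nnegrE//; rewrite ?divr_ge0 ?(ltW t0) ?(ltW a0) ?(ltW b0)//; first lra.
    by rewrite ler_pdivlMr// mulrC.
  move/le_trans; apply.
  have := @powR_le1D (b / a) (1 - q) (divr_gt0 b0 a0).
  have -> : 0 <= 1 - q <= 1 by lra.
  move=> /(_ isT) /(ler_wpM2l (ltW a0)) /le_trans; apply.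
  rewrite le_eqVlt; apply/orP; left; apply/eqP; field; lra.
- rewrite -[leLHS](divfK (lt0r_neq0 tq)) ler_pM2r//.
  have : b / t `^ q <= b * (a / b) `^ q.
    rewrite ler_pM2l// -powRN.
    have ab0 : 0 < a / b by rewrite divr_gt0.
    have -> : a / b = (b / a)^-1 by rewrite invf_div.
    rewrite -(powR_inv1 (ltW (divr_gt0 b0 a0))) -powRrM mulN1r !powRN lef_pV2 ?posrE ?powR_gt0 ?divr_gt0//.
    rewrite ge0_ler_powR ?nnegrE//; rewrite ?divr_ge0 ?(ltW t0) ?(ltW a0) ?(ltW b0)//.
    by rewrite ler_pdivrMr// mulrC ltW.
  move/le_trans; apply.
  have := @powR_le1D (a / b) q (divr_gt0 a0 b0).
  rewrite q0 q1 => /(_ isT) /(ler_wpM2l (ltW b0)) /le_trans; apply.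
  rewrite le_eqVlt; apply/orP; left; apply/eqP; field; lra.
Qed.

(** With [C = (142 / 25) x] the exponent is at least [3.58 + 3 (x - 1)], so the exponential
    dominates [35.4 x^3]. This is the Wiener error at the threshold of the non-trivial range. *)
Lemma cube_gauss_tail_le C : 142 / 25 <= C ->
  4 * expR (- (C ^+ 2 / 9)) * C ^+ 3 <= 208 / 10.
Proof.
move=> hC; have [x Cx] : exists x, C = 142 / 25 * x by exists (C / (142 / 25)); field.
have x1 : 1 <= x by rewrite Cx in hC; lra.
have x3 : 1 <= x ^+ 3 by rewrite exprn_ege1.
have e1 : 354 / 10 * x ^+ 3 <= expR (C ^+ 2 / 9).
  have : expR ((179 / 200) * 4%:R + (x - 1) * 3%:R) <= expR (C ^+ 2 / 9).
    rewrite ler_expR Cx.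
    have : 0 <= (x - 1) ^+ 2 by exact: sqr_ge0.
    lra.
  apply: le_trans; rewrite expRD !expRM_natr.
  apply: ler_pM; [lra|lra| |].
    (* [exp 3.58] is the fourth power of [exp 0.895], which its Taylor polynomial bounds below by
       [2.44]. *)
    have := @expR_ge_taylor4 (179 / 200) _; set e := expR _ => h.
    have {}h : 244 / 100 <= e by apply: le_trans (h _); lra.
    have e2 : 595 / 100 <= e ^+ 2 by rewrite expr2; apply: le_trans (ler_pM _ _ h h); lra.
    have -> : e ^+ 4 = e ^+ 2 * e ^+ 2 by ring.
    by apply: le_trans (ler_pM _ _ e2 e2); lra.
  have := expR_ge1Dx (x - 1); rewrite addrC subrK => h.
  by rewrite lerXn2r// nnegrE; [lra|exact: expR_ge0].
have e0 : 0 < expR (C ^+ 2 / 9) by exact: expR_gt0.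
rewrite expRN mulrAC ler_pdivrMr//.
have -> : C ^+ 3 = (142 / 25) ^+ 3 * x ^+ 3 by rewrite Cx exprMn.
move: (expR _) (x ^+ 3) e1 x3 => e y e1 y1; lra.
Qed.

End elementary_inequalities.

(** * Moments of the normal distribution *)

Section integrable_real.
Context {d : measure_display} {T : measurableType d} {R : realType}.
Variable mu : {measure set T -> \bar R}.
Implicit Types f g : T -> R.

Lemma integrable_addr f g : mu.-integrable setT (EFin \o f) ->
  mu.-integrable setT (EFin \o g) ->
  mu.-integrable setT (EFin \o (fun x => f x + g x)).
Proof. by move=> hf hg; exact: (integrableD measurableT hf hg). Qed.

Lemma integrable_mulr (c : R) f : mu.-integrable setT (EFin \o f) ->
  mu.-integrable setT (EFin \o (fun x => c * f x)).
Proof. by move=> hf; exact: (integrableZl measurableT c hf). Qed.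

End integrable_real.

Section gaussian.
Context {R : realType}.
Variable s : R.
Hypothesis s0 : 0 < s.
Notation leb := (@lebesgue_measure R).
Notation N := (normal_prob 0 s).
Notation pdf := (normal_pdf 0 s).

Let sn0 : s != 0. Proof. by rewrite gt_eqF. Qed.

Let mpdf : measurable_fun setT pdf. Proof. exact: measurable_normal_pdf. Qed.

Let integral_normal_indic A : measurable A ->
  (\int[N]_x (\1_A x)%:E = \int[leb]_x ((\1_A x)%:E * (pdf x)%:E))%E.
Proof.
move=> mA; rewrite integral_indic//= setIT /normal_prob integral_mkcond.
apply: eq_integral => x _; rewrite patchE indicE; case: ifPn => xA.
  by rewrite mul1e.
by rewrite mul0e.
Qed.

Import HBNNSimple.

Let integral_normal_nnsfun (f : {nnsfun measurableTypeR R >-> R}) :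
  (\int[N]_x (f x)%:E = \int[leb]_x ((f x)%:E * (pdf x)%:E))%E.
Proof.
under [LHS]eq_integral do rewrite fimfunE -fsumEFin//.
rewrite [LHS]ge0_integral_fsum//; last 2 first.
  - by move=> r; exact/measurable_EFinP/measurableT_comp.
  - by move=> n x _; rewrite EFinM nnfun_muleindic_ge0.
under [RHS]eq_integral.
  move=> x xD; rewrite fimfunE -fsumEFin// muleC ge0_mule_fsumr; last first.
    by move=> r; rewrite EFinM nnfun_muleindic_ge0.
  over.
rewrite [RHS]ge0_integral_fsum//; last 2 first.
  - move=> r; apply: emeasurable_funM; first exact/measurable_EFinP.
    by apply/measurable_EFinP; do 2 apply/measurableT_comp => //.
  - by move=> n x _; rewrite mule_ge0 ?lee_fin ?normal_pdf_ge0// -lee_fin EFinM nnfun_muleindic_ge0.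
apply: eq_fsbigr => r _.
under [RHS]eq_integral do rewrite EFinM muleCA.
have [r0|r0] := ltP r 0.
  have -> : f @^-1` [set r] = set0.
    by apply/seteqP; split => x //= fx; have : 0 <= f x by []; rewrite fx leNgt r0.
  under eq_integral do rewrite indic0 mulr0.
  rewrite integral0.
  by under eq_integral do rewrite indic0 mule0 mule0; rewrite integral0.
under eq_integral do rewrite EFinM.
have mE : measurable (f @^-1` [set r]) by exact: measurable_funPTI.
rewrite ge0_integralZl//; last first.
  exact/measurable_EFinP/measurable_indic.
rewrite ge0_integralZl//; last 2 first.
  - by apply: emeasurable_funM; apply/measurable_EFinP => //; exact: measurable_indic.
  - by move=> x _; rewrite mule_ge0// lee_fin ?normal_pdf_ge0.
by rewrite integral_normal_indic//; congr (_ * _)%E; apply: eq_integral => x _; rewrite muleC.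
Qed.

(** [normal_prob] is given on sets by its density; the formula passes from indicators to simple
    functions and then to monotone limits. *)
Lemma ge0_integral_normal_prob (f : measurableTypeR R -> \bar R) :
  measurable_fun setT f -> (forall x, 0 <= f x)%E ->
  (\int[N]_x f x = \int[leb]_x (f x * (pdf x)%:E))%E.
Proof.
move=> mf f0.
pose f_ := nnsfun_approx measurableT mf.
transitivity (lim (\int[N]_x (f_ n x)%:E @[n --> \oo])%E).
  rewrite -monotone_convergence//=.
  - apply: eq_integral => ? /[!inE] xD; apply/esym/cvg_lim => //=.
    exact: cvg_nnsfun_approx.
  - by move=> n; exact/measurable_EFinP/measurable_funTS.
  - by move=> n ? _; rewrite lee_fin.
  - by move=> ? _ ? ? mn; rewrite lee_fin; exact/lefP/nd_nnsfun_approx.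
rewrite [RHS](_ : _ = lim
    (\int[leb]_x ((f_ n x)%:E * (pdf x)%:E) @[n --> \oo])%E); last first.
  rewrite -monotone_convergence//=.
  - apply: eq_integral => x /[!inE] xD; apply/esym/cvg_lim => //.
    apply: cvgeZr => //; exact: cvg_nnsfun_approx.
  - move=> n; apply: emeasurable_funM; apply/measurable_EFinP => //.
  - by move=> n x _; rewrite mule_ge0// lee_fin ?normal_pdf_ge0.
  - move=> x _ m n mn; rewrite lee_wpmul2r ?lee_fin ?normal_pdf_ge0//.
    exact/lefP/nd_nnsfun_approx.
by apply: congr_lim; apply/funext => n /=; exact: integral_normal_nnsfun.
Qed.

(** Completing the square leaves a constant times the normal density with mean [l * s ^+ 2]. *)
Lemma integral_normal_expR (l : R) :
  (\int[N]_x (expR (l * x))%:E = (expR (l ^+ 2 * s ^+ 2 / 2))%:E)%E.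
Proof.
rewrite ge0_integral_normal_prob; last 2 first.
  - by apply/measurable_EFinP; apply: measurableT_comp => //.
  - by move=> x; rewrite lee_fin expR_ge0.
transitivity (\int[leb]_x ((expR (l ^+ 2 * s ^+ 2 / 2))%:E *
    (normal_pdf (l * s ^+ 2) s x)%:E))%E.
  apply: eq_integral => x _; rewrite -!EFinM; congr EFin.
  rewrite !normal_pdfE// mulrCA [RHS]mulrCA; congr (_ * _).
  rewrite /normal_fun -!expRD; congr expR.
  by field.
have mp : measurable_fun setT (normal_pdf (l * s ^+ 2) s) by exact: measurable_normal_pdf.
rewrite ge0_integralZl//; last 2 first.
- exact/measurable_EFinP.
- by move=> x _; rewrite lee_fin normal_pdf_ge0.
by rewrite integral_normal_pdf mule1.
Qed.

Lemma integrable_normal_expR (l : R) : N.-integrable setT (fun x => (expR (l * x))%:E).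
Proof.
apply/integrableP; split.
  by apply/measurable_EFinP; apply: measurableT_comp => //; exact: measurable_funM.
under eq_integral do rewrite /= ger0_norm ?expR_ge0//.
by rewrite integral_normal_expR ltry.
Qed.

Lemma integrable_normal_normX k : N.-integrable setT (fun x => (`|x| ^+ k)%:E).
Proof.
apply: (@le_integrable _ _ _ N setT measurableT _
  (EFin \o (fun x => k`!%:R * expR (1 * x) + k`!%:R * expR (-1 * x)))) => //.
- apply/measurable_EFinP; apply: measurable_funX => //; exact: measurableT_comp.
- move=> x _ /=; rewrite lee_fin !mul1r mulN1r -mulrDr normrX normr_id.
  have e1 : 0 <= expR x by exact: expR_ge0.
  have e2 : 0 <= expR (- x) by exact: expR_ge0.
  have kf : 0 < k`!%:R :> R by rewrite ltr0n fact_gt0.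
  rewrite [leRHS]ger0_norm; last by rewrite mulr_ge0 ?addr_ge0// ltW.
  have h (y : R) : 0 <= y -> y ^+ k <= k`!%:R * expR y.
    move=> y0; case: (k) kf => [|j] kf.
      by rewrite expr0 fact0 mul1r -expR0 ler_expR.
    by rewrite mulrC -ler_pdivrMr//; have := @expR_ge1Dxn R y j y0; lra.
  apply: le_trans (h _ (normr_ge0 x)) _; rewrite ler_pM2l//.
  by case: (ger0P x) => _; lra.
- by apply: integrable_addr; apply: integrable_mulr; exact: integrable_normal_expR.
Qed.

Lemma integrable_normal_id : N.-integrable setT (fun x => x%:E).
Proof.
apply: le_integrable (integrable_normal_normX 1) => //.
  exact/measurable_EFinP.
by move=> x _ /=; rewrite expr1 normr_id.
Qed.

Lemma integrable_normal_sqr : N.-integrable setT (fun x => (x ^+ 2)%:E).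
Proof.
by have := integrable_normal_normX 2; under eq_fun do rewrite real_normK ?num_real//.
Qed.

(* The mean [m] vanishes because [1 + l m <= exp (l^2 s^2 / 2)] for all [l]. *)
Lemma Rintegral_normal_id : \int[N]_x x = 0.
Proof.
set m := Rintegral _ _ _.
have h l : 1 + l * m <= expR (l ^+ 2 * s ^+ 2 / 2).
  have : \int[N]_x (1 + l * x) <= \int[N]_x (expR (l * x)).
    apply: le_Rintegral => //.
    - apply: integrable_addr; first exact: finite_measure_integrable_cst.
      apply: integrable_mulr; exact: integrable_normal_id.
    - exact: integrable_normal_expR.
    - by move=> x _; exact: expR_ge1Dx.
  rewrite RintegralD//; last 2 first.
  - exact: finite_measure_integrable_cst.
  - apply: integrable_mulr; exact: integrable_normal_id.
  rewrite RintegralZl//; last exact: integrable_normal_id.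
  rewrite Rintegral_cst// [X in fine X]probability_setT mulr1 -/m => /le_trans; apply.
  by rewrite /Rintegral integral_normal_expR.
have hu (u : R) : 0 <= u <= 1 / 2 -> expR u <= 1 + 2 * u.
  move=> hu; have := expR_ge1Dx (- u); rewrite expRN => e.
  have e0 := expR_gt0 u.
  have := ler_wpM2r (ltW e0) e; rewrite mulVf ?gt_eqF// => {}e.
  nra.
have s2 : 0 < s ^+ 2 by rewrite exprn_gt0.
have hl l : l ^+ 2 * s ^+ 2 <= 1 -> l * m <= l ^+ 2 * s ^+ 2.
  move=> l1; have := h l; have := hu (l ^+ 2 * s ^+ 2 / 2).
  have : 0 <= l ^+ 2 * s ^+ 2 by rewrite mulr_ge0 ?sqr_ge0.
  move: (l ^+ 2 * s ^+ 2) l1 => y y1 y0 /(_ _) h1 h2.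
  by have := h1 ltac:(lra); lra.
(* The choice [l = c m] satisfies [l^2 s^2 <= 1] and gives [c m^2 (1 - c s^2) <= 0]; as
   [1 - c s^2 = c (1 + m^2)] is positive, [m = 0]. *)
pose c := (1 + s ^+ 2 + m ^+ 2)^-1.
have D0 : 0 < 1 + s ^+ 2 + m ^+ 2 by have := sqr_ge0 m; lra.
have c0 : 0 < c by rewrite invr_gt0.
have cD : c * (1 + s ^+ 2 + m ^+ 2) = 1 by rewrite mulVf// gt_eqF.
have cm1 : c ^+ 2 * m ^+ 2 * s ^+ 2 <= 1.
  have m2 := sqr_ge0 m.
  have h1 : c * m ^+ 2 <= 1 by nra.
  have h2 : c * s ^+ 2 <= 1 by nra.
  have -> : c ^+ 2 * m ^+ 2 * s ^+ 2 = (c * m ^+ 2) * (c * s ^+ 2) by ring.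
  apply: mulr_ile1 => //; rewrite mulr_ge0//; lra.
have := hl (c * m); rewrite exprMn => /(_ cm1) hcm.
have {hcm} : c * (m ^+ 2) * (1 - c * s ^+ 2) <= 0 by move: hcm; set u := s ^+ 2; nra.
have -> : 1 - c * s ^+ 2 = c * (1 + m ^+ 2) by rewrite -[X in X - _]cD; ring.
rewrite mulrACA -expr2 pmulr_rle0 ?exprn_gt0// => hm.
apply/eqP; rewrite -sqrf_eq0 eq_le sqr_ge0 andbT.
have m2 := sqr_ge0 m; nra.
Qed.

Let pdf_decay x : 1 <= x -> pdf x <= normal_peak s * (8 * s ^+ 4) / x ^+ 4.
Proof.
move=> x1; rewrite normal_pdfE// -mulrA ler_pM2l ?normal_peak_gt0// /normal_fun subr0.
have x4 : 0 < x ^+ 4 by rewrite exprn_gt0; lra.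
have s2 : 0 < s ^+ 2 by rewrite exprn_gt0.
have s4 : 0 < 8 * s ^+ 4 by rewrite mulr_gt0 ?exprn_gt0.
have u0 : 0 <= x ^+ 2 / (s ^+ 2 *+ 2) by rewrite divr_ge0 ?sqr_ge0// mulrn_wge0// ltW.
have := @expR_ge1Dxn R _ 1 u0; rewrite -[(2)`!%:R]/(2) => h.
rewrite mulNr expRN -[leRHS]invf_div lef_pV2 ?posrE ?expR_gt0 ?divr_gt0//.
apply: le_trans h; apply: (@le_trans _ _ ((x ^+ 2 / (s ^+ 2 *+ 2)) ^+ 2 / 2)); last by lra.
rewrite le_eqVlt; apply/orP; left; apply/eqP; rewrite -mulr_natl; field; rewrite gt_eqF//.
Qed.

Let is_derive_pdf x : is_derive x (1 : R) pdf (- (x / s ^+ 2) * pdf x).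
Proof.
rewrite normal_pdfE// /normal_fun.
under eq_fun do rewrite subr0.
apply: is_derive_eq.
rewrite subr0 !scaler0 ?addr0 ?add0r /GRing.scale/=.
by rewrite -mulr_natl; field; rewrite gt_eqF//.
Qed.

Let cvg_gauss_y (k : R) : (k * x^-1) @[x --> +oo] --> (0 : R).
Proof.
rewrite -[X in _ --> X](mulr0 k); apply: cvgMr; apply/gtr0_cvgV0; last exact: cvg_id.
by near=> x; near: x; exact: nbhs_pinfty_gt.
Unshelve. all: by end_near. Qed.

(** By symmetry this is twice a half-line integral, where [- (s^2 x^2 + 2 s^4) pdf] is an
    antiderivative vanishing at infinity; only its value at [0] remains. *)
Lemma Rintegral_normal_normX3 : \int[N]_x (`|x| ^+ 3) = 4 * s ^+ 4 * normal_peak s.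
Proof.
rewrite /Rintegral ge0_integral_normal_prob; last 2 first.
- by apply/measurable_EFinP; apply: measurable_funX => //; exact: measurableT_comp.
- by move=> x; rewrite lee_fin exprn_ge0.
under eq_integral do rewrite -EFinM.
rewrite ge0_symfun_integralT; last 3 first.
- by move=> x; rewrite mulr_ge0 ?normal_pdf_ge0.
- move=> x; apply: cvgM; last exact: continuous_normal_pdf.
  apply: (@continuous_comp _ _ _ (fun y : R => `|y|) (fun y => y ^+ 3)).
    exact: norm_continuous.
  exact: exprn_continuous.
- by move=> x /=; rewrite normrN !normal_pdfE// /normal_fun !subr0 sqrrN.
pose F x := - (s ^+ 2 * x ^+ 2 + 2 * s ^+ 4) * pdf x.
have dF x : is_derive x (1 : R) F (x ^+ 3 * pdf x).
  have dp := is_derive_pdf x.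
  rewrite /F; apply: is_derive_eq.
  by rewrite /GRing.scale/=; field; rewrite gt_eqF//.
have -> : [set x : R | 0 <= x] = [set` `[0, +oo[] by rewrite set_itvcy.
rewrite (_ : (\int[leb]_(x in `[0%R, +oo[) _)%E = (0%:E - (F 0)%:E)%E).
  rewrite /F expr0n/= mulr0 add0r normal_pdfE// /normal_fun subr0 expr0n/= oppr0 mul0r expR0 mulr1/=.
  ring.
rewrite -(@ge0_continuous_FTC2y R (fun x => x ^+ 3 * pdf x) F 0 0)//.
- by apply: eq_integral => x; rewrite inE/= in_itv/= andbT => x0; rewrite ger0_norm.
- by move=> x x0; rewrite mulr_ge0 ?normal_pdf_ge0 ?exprn_ge0.
- apply: continuous_subspaceT => x; apply: cvgM; last exact: continuous_normal_pdf.
  exact: exprn_continuous.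
- apply: (@squeeze_cvgr _ _ _ _ (fun x => - ((s ^+ 2 + 2 * s ^+ 4) * (normal_peak s * (8 * s ^+ 4))) * x^-1) (fun=> 0)).
  + near=> x; have x1 : 1 <= x by near: x; apply: nbhs_pinfty_ge; rewrite num_real.
    have x0 : 0 < x by lra.
    have p0 := normal_pdf_ge0 0 s x.
    have s2 : 0 < s ^+ 2 by rewrite exprn_gt0.
    have s4 : 0 < s ^+ 4 by rewrite exprn_gt0.
    have x2 : 1 <= x ^+ 2 by rewrite exprn_ege1.
    rewrite /F !mulNr lerN2 oppr_le0 mulr_ge0 ?andbT//; last by apply: addr_ge0; rewrite mulr_ge0 ?ltW//; lra.
    apply: (@le_trans _ _ (((s ^+ 2 + 2 * s ^+ 4) * x ^+ 2) * (normal_peak s * (8 * s ^+ 4) / x ^+ 4))).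
      apply: ler_pM => //; last exact: pdf_decay.
        by apply: addr_ge0; rewrite mulr_ge0 ?ltW//; lra.
      by nra.
    have -> : (s ^+ 2 + 2 * s ^+ 4) * x ^+ 2 * (normal_peak s * (8 * s ^+ 4) / x ^+ 4) =
       (s ^+ 2 + 2 * s ^+ 4) * (normal_peak s * (8 * s ^+ 4)) * (x ^+ 2)^-1.
      by field; rewrite gt_eqF//.
    rewrite ler_wpM2l//.
      have pk := normal_peak_ge0 s.
      have h1 : 0 <= s ^+ 2 + 2 * s ^+ 4 by lra.
      have h2 : 0 <= normal_peak s * (8 * s ^+ 4) by rewrite mulr_ge0//; lra.
      by rewrite mulr_ge0.
    by rewrite lef_pV2 ?posrE//; nra.
  + exact: cvg_gauss_y.
  + exact: cvg_cst.
- apply: cvg_at_right_filter; apply: differentiable_continuous; apply/derivable1_diffP.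
  by have [] := dF 0.
- by move=> x _; rewrite derive1E; have [] := dF x.
Unshelve. all: by end_near. Qed.

(** [- s^2 x pdf] is an antiderivative of [(x^2 - s^2) pdf] that vanishes at [0] and at infinity.
    The integrand changes sign at [s], so the half-line is split there to have a non-negative
    function on the unbounded part. *)
Lemma Rintegral_normal_sqr : \int[N]_x (x ^+ 2) = s ^+ 2.
Proof.
have s2 : 0 < s ^+ 2 by rewrite exprn_gt0.
have s4 : 0 < s ^+ 4 by rewrite exprn_gt0.
pose G x := - (s ^+ 2 * x) * pdf x.
pose g x := (x ^+ 2 - s ^+ 2) * pdf x.
have dG x : is_derive x (1 : R) G (g x).
  have dp := is_derive_pdf x.
  rewrite /G /g; apply: is_derive_eq.
  by rewrite /GRing.scale/=; field; rewrite gt_eqF//.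
have cpdf := continuous_normal_pdf (m := 0) sn0.
have cg : continuous g.
  move=> x; apply: cvgM; last exact: cpdf.
  by apply: (@cvgB _ R^o); [exact: exprn_continuous|exact: cvg_cst].
have cG : continuous G.
  by move=> x; apply: differentiable_continuous; apply/derivable1_diffP; have [] := dG x.
have I0 : \int[leb]_(x in `[0, s]) g x = G s.
  rewrite /Rintegral (@continuous_FTC2 R g G 0 s)//.
  - by rewrite {2}/G mulr0 oppr0 mul0r sube0.
  - exact: continuous_subspaceT.
  - split.
    + by move=> x _; have [] := dG x.
    + by apply: cvg_at_right_filter; exact: cG.
    + by apply: cvg_at_left_filter; exact: cG.
  - by move=> x _; rewrite derive1E; have [] := dG x.
have I1 : \int[leb]_(x in `[s, +oo[) g x = - G s.
  rewrite (@Rintegral_ge0_continuous_FTC2y R g G s 0) ?sub0r//.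
  - by move=> x sx; rewrite mulr_ge0 ?normal_pdf_ge0// subr_ge0 lerXn2r ?nnegrE ?(ltW s0)// (le_trans (ltW s0)).
  - exact: continuous_subspaceT.
  - apply: (@squeeze_cvgr _ _ _ _ (fun x => - (s ^+ 2 * (normal_peak s * (8 * s ^+ 4))) * x^-1) (fun=> 0)).
    + near=> x; have x1 : 1 <= x by near: x; apply: nbhs_pinfty_ge; rewrite num_real.
      have x0 : 0 < x by lra.
      have p0 := normal_pdf_ge0 0 s x.
      have x3 : 1 <= x ^+ 3 by rewrite exprn_ege1.
      have pk := normal_peak_ge0 s.
      have sx : 0 <= s ^+ 2 * x by rewrite mulr_ge0// ltW.
      have sxp : 0 <= s ^+ 2 * x * pdf x by rewrite mulr_ge0.
      rewrite /G !mulNr lerN2 oppr_le0 sxp andbT.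
      apply: (@le_trans _ _ ((s ^+ 2 * x) * (normal_peak s * (8 * s ^+ 4) / x ^+ 4))).
        by apply: ler_pM => //; exact: pdf_decay.
      have -> : (s ^+ 2 * x) * (normal_peak s * (8 * s ^+ 4) / x ^+ 4) =
         (s ^+ 2) * (normal_peak s * (8 * s ^+ 4)) * (x ^+ 3)^-1.
        by field; rewrite gt_eqF.
      rewrite ler_wpM2l//.
        by rewrite mulr_ge0 ?(ltW s2)// mulr_ge0//; lra.
      by rewrite lef_pV2 ?posrE//; nra.
    + exact: cvg_gauss_y.
    + exact: cvg_cst.
  - by apply: cvg_at_right_filter; exact: cG.
  - by move=> x _; rewrite derive1E; have [] := dG x.
have m2 : measurable_fun setT (fun x : measurableTypeR R => (x ^+ 2)%:E).
  by apply/measurable_EFinP; exact: measurable_funX.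
have i2 : leb.-integrable setT (EFin \o (fun x => x ^+ 2 * pdf x)).
  apply/integrableP; split.
    by apply/measurable_EFinP; apply: measurable_funM => //; exact: measurable_funX.
  rewrite (eq_integral (fun x : measurableTypeR R => (x ^+ 2)%:E * (pdf x)%:E)%E); last first.
    by move=> x _; rewrite /= ger0_norm ?EFinM// mulr_ge0 ?normal_pdf_ge0 ?sqr_ge0.
  rewrite -(@ge0_integral_normal_prob (fun x => (x ^+ 2)%:E))//; last first.
    by move=> x; rewrite lee_fin sqr_ge0.
  have /integrableP[_] := integrable_normal_sqr.
  rewrite (eq_integral (fun x : measurableTypeR R => (x ^+ 2)%:E)%E)// => x _.
  by rewrite /= ger0_norm ?sqr_ge0.
have ip : leb.-integrable setT (EFin \o (fun x => s ^+ 2 * pdf x)).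
  by apply: integrable_mulr; exact: integrable_normal_pdf.
have my : measurable [set` `[0:R, +oo[] by exact: measurable_itv.
have ig : leb.-integrable setT (EFin \o g).
  rewrite (_ : g = (fun x => x ^+ 2 * pdf x + -1 * (s ^+ 2 * pdf x))).
    by apply: integrable_addr => //; exact: integrable_mulr.
  by apply/funext => x; rewrite /g; ring.
have I : \int[leb]_(x in [set` `[0, +oo[]) g x = 0.
  have igs : leb.-integrable [set` Interval (BRight s) +oo%O] (EFin \o g).
    by apply: integrableS ig => //; exact: measurable_itv.
  have ig0 : leb.-integrable [set` Interval (BLeft 0) +oo%O] (EFin \o g).
    by apply: integrableS ig => //; exact: measurable_itv.
  have h := @Rintegral_itvB R g (BLeft 0) +oo%O s ig0.
  rewrite !bnd_simp in h; have {}h := h (ltW s0) isT.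
  have e := Rintegral_itv_obnd_cbnd igs.
  rewrite e I1 I0 in h; lra.
have J : \int[leb]_(x in [set` `[0, +oo[]) (x ^+ 2 * pdf x) =
    s ^+ 2 * \int[leb]_(x in [set` `[0, +oo[]) (pdf x).
  apply/eqP; rewrite -subr_eq0 -RintegralZl//; last first.
    by apply: (integrableS measurableT) => //; exact: integrable_normal_pdf.
  rewrite -RintegralB//; [|exact: integrableS i2|exact: integrableS ip].
  apply/eqP; rewrite -[RHS]I; apply: eq_Rintegral => x _.
  by rewrite /g mulrBl.
have setE : [set x : R | 0 <= x] = [set` `[0, +oo[] by rewrite set_itvcy.
have pdfN x : pdf (- x) = pdf x.
  by rewrite !normal_pdfE// /normal_fun !subr0 sqrrN.
have K : \int[leb]_(x in [set` `[0, +oo[]) (pdf x) = 1 / 2.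
  have := @ge0_symfun_integralT R pdf (normal_pdf_ge0 0 s) cpdf.
  rewrite integral_normal_pdf setE => /(_ _) h.
  have {}h := congr1 fine (h (fun x => esym (pdfN x))).
  move: h; rewrite fineM//=; last first.
    apply: integrable_fin_num => //.
    by apply: (integrableS measurableT) => //; exact: integrable_normal_pdf.
  rewrite -/(Rintegral _ _ _) => h.
  apply: (mulfI (_ : (2 : R) != 0)); first by rewrite pnatr_eq0.
  by rewrite -h; field.
rewrite /Rintegral ge0_integral_normal_prob//; last by move=> x; rewrite lee_fin sqr_ge0.
under eq_integral do rewrite -EFinM.
rewrite ge0_symfun_integralT; last 3 first.
- by move=> x; rewrite mulr_ge0 ?normal_pdf_ge0 ?sqr_ge0.
- by move=> x; apply: cvgM; [exact: exprn_continuous|exact: cpdf].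
- by move=> x /=; rewrite sqrrN pdfN.
rewrite setE fineM//=; last first.
  by apply: integrable_fin_num => //; exact: integrableS i2.
by rewrite -/(Rintegral _ _ _) J K; field.
Unshelve. all: by end_near. Qed.

(** The exact factor [4 / sqrt (2 pi)] is about [1.596]; the rational [321 / 200] still fits into
    the final constants. *)
Lemma Rintegral_normal_normX3_le : \int[N]_x (`|x| ^+ 3) <= 321 / 200 * s ^+ 3.
Proof.
rewrite Rintegral_normal_normX3.
have p0 := @pi_gt0 R; have p1 := @pi_ge28_9 R.
have -> : normal_peak s = (s * Num.sqrt (pi *+ 2))^-1.
  by rewrite /normal_peak -mulrnAr sqrtrM ?sqr_ge0// sqrtr_sqr gtr0_norm.
have r0 : 0 < Num.sqrt (pi *+ 2 : R) by rewrite sqrtr_gt0 pmulrn_lgt0.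
have r1 : 172 / 69 <= Num.sqrt (pi *+ 2 : R).
  have r2 : Num.sqrt (pi *+ 2 : R) ^+ 2 = 2 * pi.
    rewrite sqr_sqrtr; first by ring.
    by rewrite mulrn_wge0 ?pi_ge0.
  rewrite leNgt; apply/negP => r3.
  have := ltr_pM (ltW r0) (ltW r0) r3 r3; rewrite -expr2 r2; lra.
have -> : 4 * s ^+ 4 * (s * Num.sqrt (pi *+ 2))^-1 = s ^+ 3 * (4 / Num.sqrt (pi *+ 2)).
  by field; rewrite !gt_eqF.
have s3 : 0 < s ^+ 3 by rewrite exprn_gt0.
rewrite mulrC ler_pM2r// ler_pdivrMr//.
by lra.
Qed.

End gaussian.

(** * Window averages *)

Section averaging.
Context {R : realType}.
Implicit Types (h f : R -> R) (a x y u v t : R).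
Notation leb := (@lebesgue_measure R).

Let integrable_cont h x y : continuous h -> leb.-integrable `[x, y] (EFin \o h).
Proof.
move=> ch; apply: continuous_compact_integrable; first exact: segment_compact.
exact: continuous_subspaceT.
Qed.

(** The Lebesgue integral over an interval is not oriented, so the sign for negative [x] is put in
    by hand. *)
Definition primitive h x : R :=
  if 0 <= x then \int[leb]_(t in `]0, x]) h t else - \int[leb]_(t in `]x, 0]) h t.

Let primitiveE h b x : continuous h -> b <= x -> b <= 0 ->
  primitive h x = \int[leb]_(t in `[b, x]) h t - \int[leb]_(t in `[b, 0]) h t.
Proof.
move=> ch bx b0; rewrite /primitive; case: ifPn => x0.
- by rewrite Rintegral_itvB//; exact: integrable_cont.
- rewrite -opprB Rintegral_itvB//; [exact: integrable_cont|].
  by rewrite bnd_simp ltW// ltNge.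
Qed.

(** Near [x], moving the base point to some [b] below both [x] and [0] changes the primitive by a
    constant only, and the fundamental theorem applies on [[b, x + 1]]. *)
Lemma is_derive_primitive h x : continuous h -> is_derive x (1 : R) (primitive h) (h x).
Proof.
move=> ch; pose b := Num.min x 0 - 1.
have bx : b < x by rewrite /b; case: (leP x 0); lra.
have b0 : b < 0 by rewrite /b; case: (leP x 0); lra.
pose Phi y := \int[leb]_(t in `[b, y]) h t.
have [d1 d2] : derivable Phi x 1 /\ Phi^`()%classic x = h x.
  apply: (@continuous_FTC1_closed R h b x (x + 1)) => //; first by lra.
  - exact: integrable_cont.
  - exact: ch.
apply: (@near_eq_is_derive _ _ _ (fun y => Phi y - \int[leb]_(t in `[b, 0]) h t)) => //.
- near=> y; rewrite (@primitiveE h b y) ?(ltW b0)//.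
  by rewrite ltW//; near: y; exact: lt_nbhsr.
- rewrite -[h x]subr0; apply: is_deriveB.
  by apply: DeriveDef; [exact: d1|rewrite -d2 derive1E].
Unshelve. all: by end_near. Qed.

Lemma continuous_primitive h : continuous h -> continuous (primitive h).
Proof.
move=> ch x; apply: differentiable_continuous; apply/derivable1_diffP.
by have [] := is_derive_primitive x ch.
Qed.

Definition window_avg a h x : R := (primitive h (x + a) - primitive h (x - a)) / (2 * a).

Let is_derive_shift (f df : R -> R) c x : (forall x, is_derive x (1 : R) f (df x)) ->
  is_derive x (1 : R) (fun t => f (c + t)) (df (c + x)).
Proof.
move=> hf; rewrite -[df _]mulr1.
apply: (@is_derive1_comp _ f (fun t => c + t)).
by rewrite -[X in is_derive _ _ _ X]add0r; apply: is_deriveD.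
Qed.

Lemma MVT_global (f df : R -> R) a b : a <= b -> (forall x, is_derive x (1 : R) f (df x)) ->
  exists2 c, a <= c <= b & f b - f a = df c * (b - a).
Proof.
move=> ab hf; have [|c] := @MVT_segment R f df a b ab => //.
- apply/continuous_subspaceT => r.
  exact/differentiable_continuous/derivable1_diffP.
- by rewrite in_itv/= => cab ?; exists c.
Qed.

(** The mean value theorem for the difference of the two primitives gives one shift [t] common to
    both functions. Lipschitz bounds and comparisons up to a displacement are thereby reduced to
    pointwise values. *)
Lemma window_avg_sub a h1 h2 x y : 0 < a -> continuous h1 -> continuous h2 ->
  exists2 t, `|t| <= a & window_avg a h1 x - window_avg a h2 y = h1 (x + t) - h2 (y + t).
Proof.
move=> a0 c1 c2.
have [||c] := @MVT_global (fun t => primitive h1 (x + t) - primitive h2 (y + t))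
  (fun t => h1 (x + t) - h2 (y + t)) (- a) a.
- by lra.
- move=> t; apply: is_deriveB.
    by apply: (@is_derive_shift _ h1) => z; exact: is_derive_primitive.
  by apply: (@is_derive_shift _ h2) => z; exact: is_derive_primitive.
- rewrite -ler_norml => ca e; exists c => //.
  rewrite /window_avg -mulrBl.
  apply: (mulIf (_ : 2 * a != 0)); first by rewrite mulf_neq0 ?pnatr_eq0// gt_eqF.
  rewrite divfK; last by rewrite mulf_neq0 ?pnatr_eq0// gt_eqF.
  have -> : 2 * a = a - - a by ring.
  by rewrite -e; ring.
Qed.

Lemma window_avg_mean a h x : 0 < a -> continuous h ->
  exists2 t, `|t| <= a & window_avg a h x = h (x + t).
Proof.
move=> a0 c1.
have [||c] := @MVT_global (fun t => primitive h (x + t)) (fun t => h (x + t)) (- a) a.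
- by lra.
- by move=> t; apply: (@is_derive_shift _ h) => z; exact: is_derive_primitive.
- rewrite -ler_norml => ca e; exists c => //.
  rewrite /window_avg e; field; rewrite gt_eqF//.
Qed.

Lemma is_derive_window_avg a h x : 0 < a -> continuous h ->
  is_derive x (1 : R) (window_avg a h) ((h (x + a) - h (x - a)) / (2 * a)).
Proof.
move=> a0 ch.
have e : window_avg a h = (2 * a)^-1 *: ((fun x => primitive h (a + x)) - (fun x => primitive h (- a + x))).
  by apply/funext => y; rewrite /window_avg !fctE /GRing.scale/= mulrC [a + y]addrC [- a + y]addrC.
have p1 : is_derive x (1 : R) (fun x => primitive h (a + x)) (h (a + x)).
  by apply: (@is_derive_shift _ h) => z; exact: is_derive_primitive.
have p2 : is_derive x (1 : R) (fun x => primitive h (- a + x)) (h (- a + x)).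
  by apply: (@is_derive_shift _ h) => z; exact: is_derive_primitive.
by rewrite e; apply: is_derive_eq; rewrite /GRing.scale/= mulrC [a + x]addrC [- a + x]addrC.
Qed.

Lemma continuous_window_avg a h : 0 < a -> continuous h -> continuous (window_avg a h).
Proof.
move=> a0 ch x; apply: differentiable_continuous; apply/derivable1_diffP.
by have [] := is_derive_window_avg x a0 ch.
Qed.

Lemma window_avgE a h (H : R -> R) x : 0 < a -> continuous h ->
  (forall x, is_derive x (1 : R) H (h x)) ->
  window_avg a h x = (H (x + a) - H (x - a)) / (2 * a).
Proof.
move=> a0 ch dH; rewrite /window_avg; congr (_ / _).
have [||c _] := @MVT_global (H - primitive h) (fun t => h t - h t) (x - a) (x + a).
- by lra.
- by move=> t; apply: is_deriveB; exact: is_derive_primitive.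
- by rewrite subrr mul0r !fctE => e; lra.
Qed.

Let taylor_ge0 (f f1 f2 : R -> R) (K M : R) x :
  (forall x, is_derive x (1 : R) f (f1 x)) ->
  (forall x, is_derive x (1 : R) f1 (f2 x)) ->
  (forall u, 0 <= u -> f2 (x + u) - f2 x <= K * u) ->
  (forall u, 0 <= u -> f2 (x + u) - f2 x <= M) ->
  forall u, 0 <= u ->
  f (x + u) - f x - f1 x * u - f2 x * (u ^+ 2 / 2) <= Num.min (K * u ^+ 3 / 6) (M * u ^+ 2 / 2).
Proof.
move=> d1 d2 hK hM.
have e1 v : is_derive v (1 : R) (fun u => f1 (x + u)) (f2 (x + v)) by exact: is_derive_shift.
have e0 v : is_derive v (1 : R) (fun u => f (x + u)) (f1 (x + v)) by exact: is_derive_shift.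
have r1 v : is_derive v (1 : R) (fun u => f1 (x + u) - f1 x - f2 x * u) (f2 (x + v) - f2 x).
  by have e1v := e1 v; apply: is_derive_eq; rewrite /GRing.scale/=; ring.
have r0 v : is_derive v (1 : R) (fun u => f (x + u) - f x - f1 x * u - f2 x * (u ^+ 2 / 2))
    (f1 (x + v) - f1 x - f2 x * v).
  by have e0v := e0 v; apply: is_derive_eq; rewrite /GRing.scale/=; field.
move=> u u0; rewrite le_min; apply/andP; split.
- apply: (@le_of_derive _ _ (fun u => K * u ^+ 3 / 6) _ (fun u => K * u ^+ 2 / 2) r0) => //.
  + by move=> v; apply: is_derive_eq; rewrite /GRing.scale/=; field.
  + rewrite addr0; lra.
  + apply: (@le_of_derive _ _ (fun u => K * u ^+ 2 / 2) _ (fun u => K * u) r1) => //.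
    * by move=> v; apply: is_derive_eq; rewrite /GRing.scale/=; field.
    * rewrite addr0; lra.
- apply: (@le_of_derive _ _ (fun u => M * u ^+ 2 / 2) _ (fun u => M * u) r0) => //.
  + by move=> v; apply: is_derive_eq; rewrite /GRing.scale/=; field.
  + rewrite addr0; lra.
  + apply: (@le_of_derive _ _ (fun u => M * u) _ (fun u => M) r1) => //.
    * by move=> v; apply: is_derive_eq; rewrite /GRing.scale/=; ring.
    * rewrite addr0; lra.
Qed.

Let is_deriveNx (f df : R -> R) : (forall x, is_derive x (1 : R) f (df x)) ->
  forall x, is_derive x (1 : R) (fun x => f (- x)) (- df (- x)).
Proof.
move=> hf x; rewrite -mulrN1.
apply: (@is_derive1_comp _ f (fun t => - t)).
Qed.

(** The cubic bound comes from the Lipschitz constant [K] of the second derivative, the quadratic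
    one from its oscillation [M]. Upper bounds for [u >= 0] suffice, by passing to [- f] and to the
    reflected function. *)
Lemma taylor2_remainder (f f1 f2 : R -> R) (K M : R) x :
  (forall x, is_derive x (1 : R) f (f1 x)) ->
  (forall x, is_derive x (1 : R) f1 (f2 x)) ->
  (forall x y, `|f2 x - f2 y| <= K * `|x - y|) ->
  (forall x y, `|f2 x - f2 y| <= M) ->
  forall u,
  `|f (x + u) - f x - f1 x * u - f2 x * (u ^+ 2 / 2)| <=
    Num.min (K * `|u| ^+ 3 / 6) (M * u ^+ 2 / 2).
Proof.
move=> d1 d2 hK hM.
have side (g g1 g2 : R -> R) y : (forall x, is_derive x (1 : R) g (g1 x)) ->
    (forall x, is_derive x (1 : R) g1 (g2 x)) ->
    (forall x y, `|g2 x - g2 y| <= K * `|x - y|) ->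
    (forall x y, `|g2 x - g2 y| <= M) -> forall u, 0 <= u ->
    `|g (y + u) - g y - g1 y * u - g2 y * (u ^+ 2 / 2)| <=
      Num.min (K * u ^+ 3 / 6) (M * u ^+ 2 / 2).
  move=> e1 e2 gK gM u u0; rewrite ler_norml; apply/andP; split.
  - rewrite lerNl.
    have n1 x0 : is_derive x0 (1 : R) (- g) (- g1 x0) by exact: is_deriveN.
    have n2 x0 : is_derive x0 (1 : R) (fun x => - g1 x) (- g2 x0) by exact: is_deriveN.
    have := @taylor_ge0 _ _ _ K M y n1 n2 _ _ u u0; rewrite !fctE.
    have -> : - g (y + u) - - g y - - g1 y * u - - g2 y * (u ^+ 2 / 2) =
      - (g (y + u) - g y - g1 y * u - g2 y * (u ^+ 2 / 2)) by ring.
    apply => v v0.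
    + have := gK (y + v) y; rewrite [y + v - y]addrC addKr (ger0_norm v0) ler_norml; lra.
    + have := gM (y + v) y; rewrite ler_norml; lra.
  - apply: (@taylor_ge0 _ _ _ K M y e1 e2 _ _ u u0) => v v0.
    + have := gK (y + v) y; rewrite [y + v - y]addrC addKr (ger0_norm v0) ler_norml; lra.
    + have := gM (y + v) y; rewrite ler_norml; lra.
move=> u; have [u0|u0] := lerP 0 u.
  by rewrite (ger0_norm u0); exact: side.
have n2 y : is_derive y (1 : R) (fun z => - f1 (- z)) (f2 (- y)).
  rewrite -[f2 _]opprK; apply: is_deriveN; exact: (is_deriveNx d2).
have hKn y z : `|f2 (- y) - f2 (- z)| <= K * `|y - z|.
  by apply: le_trans (hK _ _) _; rewrite -opprD normrN.
have un : 0 <= - u by rewrite oppr_ge0 ltW.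
have := @side (fun z => f (- z)) (fun z => - f1 (- z)) (fun z => f2 (- z)) (- x)
  (is_deriveNx d1) n2 hKn (fun y z => hM _ _) (- u) un.
by rewrite -opprD !opprK sqrrN mulrNN (ltr0_norm u0).
Qed.

End averaging.

Notation gauss_integrable s f := ((normal_prob 0 s).-integrable setT (EFin \o f)).

(** * Gaussian means of bounded Lipschitz functions *)

Section gaussian_mean.
Context {R : realType}.
Implicit Types (f g h : R -> R) (s a x y z c : R).

Definition gmean s f : R := \int[normal_prob 0 s]_z f z.

Lemma lipschitz_continuous (L : R) f : (forall x y, `|f x - f y| <= L * `|x - y|) -> continuous f.
Proof.
move=> hf x; apply/cvgrPdist_le => /= e e0; near=> y.
apply: le_trans (hf _ _) _.
have L1 : 0 < `|L| + 1 by have := normr_ge0 L; lra.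
apply: (@le_trans _ _ ((`|L| + 1) * `|x - y|)).
  by rewrite ler_wpM2r//; have := ler_norm L; lra.
rewrite mulrC -ler_pdivlMr//.
by near: y; apply: cvgr_dist_le; [exact: cvg_id|exact: divr_gt0].
Unshelve. all: by end_near. Qed.

Lemma integrable_gauss_bounded s f (B : R) : continuous f -> (forall x, `|f x| <= B) ->
  gauss_integrable s f.
Proof.
move=> cf hB; apply: measurable_bounded_integrable => //.
- by rewrite [X in (X < _)%E]probability_setT ltry.
- exact: continuous_measurable_fun.
- by exists B; split; rewrite ?num_real// => M BM x _ /=; apply: le_trans (hB x) (ltW BM).
Qed.

Lemma integrable_gauss_shift s f (L : R) x : (forall x y, `|f x - f y| <= L * `|x - y|) ->
  (forall x, 0 <= f x <= 1) -> gauss_integrable s (fun z => f (x + z)).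
Proof.
move=> fL f01; apply: (@integrable_gauss_bounded _ _ 1) => [|z]; last exact: norm_unit_le1.
apply: (@lipschitz_continuous L) => y z.
by apply: le_trans (fL _ _) _; rewrite opprD addrACA subrr add0r.
Qed.

Lemma gmean_cst s c : gmean s (fun=> c) = c.
Proof. by rewrite /gmean Rintegral_cst// [X in fine X]probability_setT mulr1. Qed.

Lemma gmean_le_add s f g c :
  gauss_integrable s f ->
  gauss_integrable s g ->
  (forall x, f x <= g x + c) -> gmean s f <= gmean s g + c.
Proof.
move=> hf hg fg; rewrite -[X in _ + X](gmean_cst s).
have hc : gauss_integrable s (fun=> c).
  exact: finite_measure_integrable_cst.
rewrite /gmean -RintegralD//; apply: le_Rintegral => //.
exact: integrable_addr.
Qed.

Lemma gmean_dist s f g c :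
  gauss_integrable s f ->
  gauss_integrable s g ->
  (forall x, `|f x - g x| <= c) -> `|gmean s f - gmean s g| <= c.
Proof.
move=> hf hg fg.
have h1 : gmean s f <= gmean s g + c.
  by apply: gmean_le_add => // x; have := fg x; rewrite ler_norml; lra.
have h2 : gmean s g <= gmean s f + c.
  by apply: gmean_le_add => // x; have := fg x; rewrite ler_norml; lra.
rewrite ler_norml; lra.
Qed.

Lemma gmean_unit s f : continuous f -> (forall x, 0 <= f x <= 1) -> 0 <= gmean s f <= 1.
Proof.
move=> cf f01.
have hf : gauss_integrable s f.
  by apply: (@integrable_gauss_bounded _ _ 1) => // x; exact: norm_unit_le1.
have h1 : gmean s f <= gmean s (fun=> 0) + 1.
  apply: gmean_le_add => //; first exact: finite_measure_integrable_cst.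
  by move=> x; have := f01 x; lra.
have h0 : gmean s (fun=> 0) <= gmean s f + 0.
  apply: gmean_le_add => //; first exact: finite_measure_integrable_cst.
  by move=> x; have := f01 x; lra.
rewrite gmean_cst in h1 h0; lra.
Qed.

(** The first-order term has mean zero. The two remainder bounds are integrated separately, so the
    minimum may be taken after integration. *)
Lemma gmean_taylor s F (B A0 A1 A2 K M : R) : 0 < s -> continuous F -> (forall x, `|F x| <= B) ->
  0 <= K ->
  (forall u, `|F u - A0 - A1 * u - A2 * (u ^+ 2 / 2)| <= Num.min (K * `|u| ^+ 3 / 6) (M * u ^+ 2 / 2)) ->
  A0 + A2 * s ^+ 2 / 2 - Num.min (K * (321 / 200 * s ^+ 3) / 6) (M * s ^+ 2 / 2) <= gmean s F.
Proof.
move=> s0 cF FB K0 hF.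
have i0 c : gauss_integrable s (fun=> c).
  exact: finite_measure_integrable_cst.
have i1 := integrable_normal_id s0.
have i2 := integrable_normal_sqr s0.
have i3 := integrable_normal_normX s0 3.
have iF := integrable_gauss_bounded s cF FB.
have q c : gauss_integrable s (fun x => A0 + (A1 * x + c * x ^+ 2)).
  by apply: integrable_addr => //; apply: integrable_addr; exact: integrable_mulr.
have gq c : gmean s (fun x => A0 + (A1 * x + c * x ^+ 2)) = A0 + c * s ^+ 2.
  rewrite /gmean RintegralD//; last by apply: integrable_addr; exact: integrable_mulr.
  rewrite RintegralD//; [|exact: integrable_mulr|exact: integrable_mulr].
  rewrite !RintegralZl// Rintegral_normal_id// Rintegral_normal_sqr// -/(gmean s (fun=> A0)) gmean_cst.
  by rewrite mulr0 add0r.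
have h2 : A0 + (A2 / 2 - M / 2) * s ^+ 2 <= gmean s F.
  rewrite -gq -[leRHS]addr0; apply: gmean_le_add => // u.
  have := hF u; rewrite le_min ler_norml => /andP[_]; rewrite ler_norml; lra.
have h3 : A0 + A2 / 2 * s ^+ 2 - K / 6 * (321 / 200 * s ^+ 3) <= gmean s F.
  have iq : gauss_integrable s (fun x => (A0 + (A1 * x + (A2 / 2) * x ^+ 2)) + - (K / 6) * `|x| ^+ 3).
    by apply: integrable_addr => //; exact: integrable_mulr.
  have : gmean s (fun x => (A0 + (A1 * x + (A2 / 2) * x ^+ 2)) + - (K / 6) * `|x| ^+ 3) <= gmean s F + 0.
    apply: gmean_le_add => // u.
    have := hF u; rewrite le_min => /andP[+ _]; rewrite ler_norml; lra.
  rewrite {1}/gmean RintegralD//; last exact: integrable_mulr.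
  rewrite -/(gmean s (fun x => A0 + (A1 * x + A2 / 2 * x ^+ 2))) gq addr0 RintegralZl//.
  apply: le_trans; rewrite lerD2l mulNr lerN2 ler_wpM2l//; last exact: Rintegral_normal_normX3_le.
  by lra.
rewrite /Num.min; case: ifP => _; lra.
Qed.

Lemma is_derive_of_quadratic f x l (K : R) :
  (forall d, `|f (x + d) - f x - d * l| <= K * d ^+ 2) -> is_derive x (1 : R) f l.
Proof.
move=> hf.
have c : (fun h : R => h^-1 *: ((f \o shift x) (h *: (1 : R)) - f x)) @ 0^' --> l.
  apply/cvgrPdist_le => /= e e0; near=> h.
  have h0 : h != 0 by near: h; exact: nbhs_dnbhs_neq.
  have K1 : 0 < `|K| + 1 by have := normr_ge0 K; lra.
  have hs : `|h| <= e / (`|K| + 1).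
    near: h; apply: dnbhs0_le; exact: divr_gt0.
  rewrite /GRing.scale/= mulr1 [h + x]addrC.
  have -> : l - h^-1 * (f (x + h) - f x) = - (h^-1 * (f (x + h) - f x - h * l)).
    by field.
  rewrite normrN normrM normfV ler_pdivrMl ?normr_gt0//.
  apply: le_trans (hf h) _.
  rewrite -real_normK ?num_real// expr2 mulrA mulrC ler_wpM2l//.
  apply: (@le_trans _ _ ((`|K| + 1) * `|h|)).
    by rewrite ler_wpM2r//; have := ler_norm K; lra.
  by rewrite mulrC -ler_pdivlMr.
apply: DeriveDef; first by apply: cvgP; exact: c.
by apply: cvg_lim => //; exact: c.
Unshelve. all: by end_near. Qed.

(** An exchange of integrals without Fubini's theorem: the Gaussian mean of the primitive is shown
    to be a primitive of the Gaussian mean, so both sides are the same difference quotient. *)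
Lemma window_avg_gmean s a h (L : R) v : 0 < a -> (forall x y, `|h x - h y| <= L * `|x - y|) ->
  (forall x, 0 <= h x <= 1) ->
  window_avg a (fun v => gmean s (fun z => h (v + z))) v =
  gmean s (fun z => window_avg a h (v + z)).
Proof.
move=> a0 hL h01; have ch := lipschitz_continuous hL.
have csh (g : R -> R) w : continuous g -> continuous (fun z => g (w + z)).
  move=> cg z; apply: continuous_comp; last exact: cg.
  exact: (cvgD (cvg_cst _) cvg_id).
have ih w := integrable_gauss_shift s w hL h01.
have dP := fun x => is_derive_primitive x ch.
have cP : continuous (primitive h) by exact: continuous_primitive.
have Plip x d : exists2 t, `|t| <= `|d| & primitive h (x + d) - primitive h x = d * h (x + t).
  have [d0|d0] := lerP 0 d.
  - have [|c] := @MVT_global R _ _ x (x + d) _ dP; first by lra.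
    move=> xc ->; exists (c - x); first by rewrite ler_norml (ger0_norm d0); lra.
    by rewrite mulrC; congr (_ * h _); ring.
  - have [|c] := @MVT_global R _ _ (x + d) x _ dP; first by lra.
    move=> xc e; exists (c - x); first by rewrite ler_norml (ltr0_norm d0); lra.
    by rewrite -opprB e -mulrN mulrC; congr (_ * h _); ring.
have iP w w' : gauss_integrable s (fun z => primitive h (w + z) - primitive h (w' + z)).
  apply: (@integrable_gauss_bounded _ _ (`|w - w'|)).
    by move=> z; exact: (cvgB (csh _ w cP z) (csh _ w' cP z)).
  move=> z; have [t _] := Plip (w' + z) (w - w').
  have -> : w' + z + (w - w') = w + z by ring.
  move=> ->; rewrite normrM ler_piMr//.
  exact: norm_unit_le1.
(* Subtracting the primitive at [0 + z] makes the integrand bounded and changes the function of [v]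
   by a constant only. *)
pose J v := gmean s (fun z => primitive h (v + z) - primitive h (0 + z)).
have JB w w' : J w - J w' = gmean s (fun z => primitive h (w + z) - primitive h (w' + z)).
  rewrite /J /gmean -RintegralB//; apply: eq_Rintegral => z _; ring.
pose H v := gmean s (fun z => h (v + z)).
have HL x y : `|H x - H y| <= L * `|x - y|.
  apply: gmean_dist => // z; apply: le_trans (hL _ _) _.
  by rewrite opprD addrACA subrr addr0.
have cH : continuous H by exact: lipschitz_continuous HL.
have dJ x : is_derive x (1 : R) J (H x).
  (* The primitive has the [L]-Lipschitz derivative [h], so its linearisation error is at most
     [L d^2] uniformly in [z], and this bound survives integration. *)
  apply: (@is_derive_of_quadratic _ _ _ L) => d.
  rewrite JB /H -RintegralZl//.
  apply: gmean_dist => //; first exact: integrable_mulr.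
  move=> z; have [t td] := Plip (x + z) d.
  have -> : x + z + d = x + d + z by ring.
  move=> ->; rewrite -mulrBr normrM -real_normK ?num_real// expr2 mulrCA mulrA.
  rewrite -[leRHS]mulrA ler_wpM2l//.
  apply: le_trans (hL _ _) _; rewrite [x + z + t]addrC addrK.
  have [L0|L0] := lerP 0 L; first by rewrite ler_wpM2l.
  have := hL 0 1; rewrite sub0r normrN normr1 mulr1 => hh.
  have := normr_ge0 (h 0 - h 1); lra.
rewrite (window_avgE v a0 cH dJ) JB.
rewrite /window_avg mulrC -RintegralZl//; apply: eq_Rintegral => z _.
rewrite mulrC; congr ((primitive h _ - primitive h _) / _); ring.
Qed.

End gaussian_mean.

Lemma norm_add3_le {R : realType} (t1 t2 t3 a : R) :
  `|t1| <= a -> `|t2| <= a -> `|t3| <= a -> `|t1 + t2 + t3| <= 3 * a.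
Proof. rewrite !ler_norml; lra. Qed.

(** * Triple averages and their Taylor expansion *)

Section smoothing.
Context {R : realType}.
Variables (a L : R) (h : R -> R).
Hypotheses (a0 : 0 < a) (hL : forall x y, `|h x - h y| <= L * `|x - y|)
  (h01 : forall x, 0 <= h x <= 1).

Definition smooth3 (a : R) (h : R -> R) : R -> R := window_avg a (window_avg a (window_avg a h)).

(** Differentiating a window average replaces it by a central difference of step [2 * a]; two
    averages remain here and one in [smooth3_d2]. *)
Definition smooth3_d1 (a : R) (h : R -> R) x : R :=
  (window_avg a (window_avg a h) (x + a) - window_avg a (window_avg a h) (x - a)) / (2 * a).

Definition smooth3_d2 (a : R) (h : R -> R) x : R :=
  (window_avg a h (x + 2 * a) - 2 * window_avg a h x + window_avg a h (x - 2 * a)) / (2 * a) ^+ 2.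

Let L0 : 0 <= L.
Proof.
have := hL 0 1; rewrite sub0r normrN normr1 mulr1 => hh.
by have := normr_ge0 (h 0 - h 1); lra.
Qed.

Let ch : continuous h. Proof. exact: lipschitz_continuous hL. Qed.
Let c1 : continuous (window_avg a h). Proof. exact: continuous_window_avg. Qed.
Let c2 : continuous (window_avg a (window_avg a h)). Proof. exact: continuous_window_avg. Qed.

Lemma window_avg_lipschitz x y : `|window_avg a h x - window_avg a h y| <= L * `|x - y|.
Proof.
have [t _ ->] := window_avg_sub x y a0 ch ch.
by apply: le_trans (hL _ _) _; rewrite opprD addrACA subrr addr0.
Qed.

Lemma window_avg_unit x : 0 <= window_avg a h x <= 1.
Proof. by have [t _ ->] := window_avg_mean x a0 ch. Qed.

End smoothing.

Section smoothing_taylor.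
Context {R : realType}.
Variables (a L : R) (h : R -> R).
Hypotheses (a0 : 0 < a) (hL : forall x y, `|h x - h y| <= L * `|x - y|)
  (h01 : forall x, 0 <= h x <= 1).

Let ch : continuous h. Proof. exact: lipschitz_continuous hL. Qed.
Let c1 : continuous (window_avg a h). Proof. exact: continuous_window_avg. Qed.
Let c2 : continuous (window_avg a (window_avg a h)). Proof. exact: continuous_window_avg. Qed.
Let h1L := window_avg_lipschitz a0 hL.
Let h1u := window_avg_unit a0 hL h01.
Let h2L := window_avg_lipschitz a0 h1L.
Let h2u := window_avg_unit a0 h1L h1u.

Lemma smooth3_lipschitz x y : `|smooth3 a h x - smooth3 a h y| <= L * `|x - y|.
Proof. exact: (window_avg_lipschitz a0 h2L). Qed.

Lemma smooth3_unit x : 0 <= smooth3 a h x <= 1.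
Proof. exact: (window_avg_unit a0 h2L h2u). Qed.

(** The third derivative is a third difference of [h], with coefficients [1, -3, 3, -1], over
    [(2 a)^3]; as [h] has values in [[0, 1]] it is at most [4 / (2 a)^3]. The second derivative is
    at most [2 / (2 a)^2] in absolute value, so its oscillation is at most [a^-2]. *)
Lemma smooth3_taylor x u :
  `|smooth3 a h (x + u) - smooth3 a h x - smooth3_d1 a h x * u - smooth3_d2 a h x * (u ^+ 2 / 2)| <=
  Num.min ((2 * a ^+ 3)^-1 * `|u| ^+ 3 / 6) ((a ^+ 2)^-1 * u ^+ 2 / 2).
Proof.
have a2 : 2 * a != 0 by rewrite mulf_neq0 ?pnatr_eq0// gt_eqF.
have shift (f df : R -> R) c y : (forall x, is_derive x (1 : R) f (df x)) ->
    is_derive y (1 : R) (fun t => f (t + c)) (df (y + c)).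
  move=> hf; rewrite -[df _]mulr1; apply: (@is_derive1_comp _ f (fun t => t + c)).
  by rewrite -[X in is_derive _ _ _ X]addr0; apply: is_deriveD.
have d1 y : is_derive y (1 : R) (smooth3 a h) (smooth3_d1 a h y).
  exact: is_derive_window_avg.
have d2 y : is_derive y (1 : R) (smooth3_d1 a h) (smooth3_d2 a h y).
  have w1 := @shift _ _ a y (fun z => is_derive_window_avg z a0 c1).
  have w2 := @shift _ _ (- a) y (fun z => is_derive_window_avg z a0 c1).
  rewrite /smooth3_d1 /smooth3_d2; apply: is_derive_eq; rewrite /GRing.scale/=.
  have -> : y + a + a = y + 2 * a by ring.
  have -> : y - a - a = y - 2 * a by ring.
  by rewrite addrK subrK; field; rewrite gt_eqF.
have d3 y : is_derive y (1 : R) (smooth3_d2 a h)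
    ((h (y + 3 * a) - 3 * h (y + a) + 3 * h (y - a) - h (y - 3 * a)) / (2 * a) ^+ 3).
  have w0 := is_derive_window_avg y a0 ch.
  have w1 := @shift _ _ (2 * a) y (fun z => is_derive_window_avg z a0 ch).
  have w2 := @shift _ _ (- (2 * a)) y (fun z => is_derive_window_avg z a0 ch).
  rewrite /smooth3_d2; apply: is_derive_eq; rewrite /GRing.scale/=.
  have -> : y + 2 * a + a = y + 3 * a by ring.
  have -> : y + 2 * a - a = y + a by ring.
  have -> : y - 2 * a + a = y - a by ring.
  have -> : y - 2 * a - a = y - 3 * a by ring.
  by field; rewrite gt_eqF.
apply: (@taylor2_remainder R _ _ _ (2 * a ^+ 3)^-1 (a ^+ 2)^-1 x d1 d2).
- move=> y z.
  suff key v w : w <= v -> `|smooth3_d2 a h v - smooth3_d2 a h w| <= (2 * a ^+ 3)^-1 * `|v - w|.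
    have [/key//|/ltW/key] := leP z y.
    by rewrite distrC [`|z - _|]distrC.
  move=> zy.
  have [c _ ->] := MVT_global zy d3.
  rewrite normrM ler_wpM2r//.
  rewrite normrM normfV [`|(2 * a) ^+ 3|]ger0_norm ?exprn_ge0 ?mulr_ge0 ?(ltW a0)//.
  rewrite ler_pdivrMr ?exprn_gt0 ?mulr_gt0//.
  have -> : (2 * a ^+ 3)^-1 * (2 * a) ^+ 3 = 4 by field; rewrite gt_eqF//.
  have := (h01 (c + 3 * a), h01 (c + a), h01 (c - a), h01 (c - 3 * a)).
  move=> [[[]]]; rewrite ler_norml; lra.
- have bd y : `|smooth3_d2 a h y| <= (2 * a ^+ 2)^-1.
    rewrite /smooth3_d2 normrM normfV [`|(2 * a) ^+ 2|]ger0_norm ?sqr_ge0//.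
    rewrite ler_pdivrMr ?exprn_gt0 ?mulr_gt0//.
    have -> : (2 * a ^+ 2)^-1 * (2 * a) ^+ 2 = 2 by field; rewrite gt_eqF//.
    have := (h1u (y + 2 * a), h1u y, h1u (y - 2 * a)).
    move=> [[]]; rewrite ler_norml; lra.
  move=> y z; apply: le_trans (ler_normB _ _) _.
  apply: le_trans (lerD (bd y) (bd z)) _.
  rewrite le_eqVlt; apply/orP; left; apply/eqP; field; rewrite gt_eqF//.
Qed.

Lemma smooth3_between x : exists2 t, `|t| <= 3 * a & smooth3 a h x = h (x + t).
Proof.
have [t1 l1 e1] := window_avg_mean x a0 c2.
have [t2 l2 e2] := window_avg_mean (x + t1) a0 c1.
have [t3 l3 e3] := window_avg_mean (x + t1 + t2) a0 ch.
exists (t1 + t2 + t3); last by rewrite /smooth3 e1 e2 e3; congr h; ring.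
exact: norm_add3_le.
Qed.

(** Smoothing the Gaussian mean is thus the same as replacing the target by a smooth function, to
    which the Taylor expansion applies. *)
Lemma smooth3_gmean s v :
  smooth3 a (fun v => gmean s (fun z => h (v + z))) v = gmean s (fun z => smooth3 a h (v + z)).
Proof.
rewrite /smooth3.
have -> : window_avg a (fun v => gmean s (fun z => h (v + z))) =
    fun v => gmean s (fun z => window_avg a h (v + z)).
  by apply/funext => w; exact: window_avg_gmean.
have -> : window_avg a (fun v => gmean s (fun z => window_avg a h (v + z))) =
    fun v => gmean s (fun z => window_avg a (window_avg a h) (v + z)).
  by apply/funext => w; exact: (window_avg_gmean s w a0 h1L).
exact: (window_avg_gmean s v a0 h2L).
Qed.

End smoothing_taylor.

Section smooth3_compare.
Context {R : realType}.
Variables (a : R) (h1 h2 : R -> R).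
Hypotheses (a0 : 0 < a) (c1 : continuous h1) (c2 : continuous h2).

Lemma smooth3_sub x y :
  exists2 t, `|t| <= 3 * a & smooth3 a h1 x - smooth3 a h2 y = h1 (x + t) - h2 (y + t).
Proof.
have d1 : continuous (window_avg a h1) by exact: continuous_window_avg.
have d2 : continuous (window_avg a h2) by exact: continuous_window_avg.
have e1 : continuous (window_avg a (window_avg a h1)) by exact: continuous_window_avg.
have e2 : continuous (window_avg a (window_avg a h2)) by exact: continuous_window_avg.
have [t1 l1 E1] := window_avg_sub x y a0 e1 e2.
have [t2 l2 E2] := window_avg_sub (x + t1) (y + t1) a0 d1 d2.
have [t3 l3 E3] := window_avg_sub (x + t1 + t2) (y + t1 + t2) a0 c1 c2.
exists (t1 + t2 + t3).
  exact: norm_add3_le.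
by rewrite /smooth3 E1 E2 E3 !addrA.
Qed.

End smooth3_compare.

(** * Iterated Gaussian steps *)

Section paths.
Context {R : realType}.

Let ratio_cancel (L N e : R) : 0 < L + 1 -> 0 < N -> L * (N * (e / ((L + 1) * N))) = L / (L + 1) * e.
Proof. by move=> L1 N0; field; rewrite !gt_eqF. Qed.

Implicit Types (c : nat -> R) (Phi : (nat -> R) -> R).

Definition upd c (j : nat) (v : R) : nat -> R := fun i => if i == j then v else c i.

Lemma upd_same c j v : upd c j v j = v. Proof. by rewrite /upd eqxx. Qed.

Lemma upd_other c j v i : i != j -> upd c j v i = c i.
Proof. by rewrite /upd => /negbTE ->. Qed.

Lemma updC c j v j' v' : j != j' -> upd (upd c j v) j' v' = upd (upd c j' v') j v.
Proof.
move=> jj'; apply/funext => i; rewrite /upd.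
by have [->|//] := eqVneq i j'; rewrite eq_sym (negbTE jj').
Qed.

(** Positions beyond [n] are ignored, so a Lipschitz function for this distance depends on the
    positions [0, ..., n] only. *)
Definition pathdist (n : nat) c c' : R := \sum_(j < n.+1) `|c j - c' j|.

Definition pathlip (n : nat) (L : R) Phi := forall c c', `|Phi c - Phi c'| <= L * pathdist n c c'.

Lemma pathdist_ge0 n c c' : 0 <= pathdist n c c'.
Proof. by apply: sumr_ge0. Qed.

Lemma pathdist_coord n c c' j : (j <= n)%N -> `|c j - c' j| <= pathdist n c c'.
Proof.
move=> jn; rewrite /pathdist (bigD1 (Ordinal (jn : (j < n.+1)%N)))//= lerDl.
exact: sumr_ge0.
Qed.

Lemma pathdist_upd n c c' j x y : pathdist n (upd c j x) (upd c' j y) <= pathdist n c c' + `|x - y|.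
Proof.
have [jn|nj] := leqP j n; last first.
  rewrite /pathdist (eq_bigr (fun i : 'I_n.+1 => `|c i - c' i|)) ?lerDl// => i _.
  by rewrite !upd_other//; apply: contraTneq nj => <-; rewrite -leqNgt -ltnS.
rewrite /pathdist (bigD1 (Ordinal (jn : (j < n.+1)%N)))//= !upd_same addrC lerD2r.
rewrite [leRHS](bigD1 (Ordinal (jn : (j < n.+1)%N)))//= ler_wpDl//.
apply: ler_sum => i ij.
by rewrite !upd_other//; apply: contra ij => /eqP ij; apply/eqP/val_inj.
Qed.

Lemma pathlip_ge0 n L Phi : pathlip n L Phi -> 0 <= L.
Proof.
move=> /(_ (fun=> 0) (fun j => (j == 0)%:R)).
have -> : pathdist n (fun=> 0) (fun j => (j == 0)%:R) = 1.
  rewrite /pathdist big_ord_recl/= sub0r normrN normr1 big1 ?addr0// => i _.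
  by rewrite subrr normr0.
rewrite mulr1; exact: le_trans.
Qed.

Lemma pathlip_upd n L Phi c j x y : pathlip n L Phi ->
  `|Phi (upd c j x) - Phi (upd c j y)| <= L * `|x - y|.
Proof.
move=> hP; have L0 := pathlip_ge0 hP; apply: le_trans (hP _ _) _; rewrite ler_wpM2l//.
apply: le_trans (pathdist_upd _ _ _ _ _ _) _.
by rewrite /pathdist big1 ?add0r// => i _; rewrite subrr normr0.
Qed.

Lemma integrable_step s n L Phi c j x : pathlip n L Phi -> (forall c, 0 <= Phi c <= 1) ->
  gauss_integrable s (fun z => Phi (upd c j (x + z))).
Proof.
move=> hP P01; apply: (@integrable_gauss_shift _ s (fun v => Phi (upd c j v)) L x) => // y z.
exact: pathlip_upd.
Qed.

Lemma pathlip_continuous (T : topologicalType) n L Phi (p : T -> nat -> R) : pathlip n L Phi ->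
  (forall j, (j <= n)%N -> continuous (fun x => p x j)) -> continuous (fun x => Phi (p x)).
Proof.
move=> hP cp x; apply/cvgrPdist_le => /= e e0.
have L0 := pathlip_ge0 hP.
have n0 : 0 < (n.+1)%:R :> R by rewrite ltr0n.
pose d := e / ((L + 1) * n.+1%:R).
have d0 : 0 < d by rewrite divr_gt0// mulr_gt0//; lra.
have : \forall t \near x, forall j : 'I_n.+1, `|p x j - p t j| <= d.
  apply: filter_forall => j.
  by apply: cvgr_dist_le => //; apply: cp; rewrite -ltnS.
apply: filterS => t ht; apply: le_trans (hP _ _) _.
apply: (@le_trans _ _ (L * (n.+1%:R * d))).
  rewrite ler_wpM2l// /pathdist; apply: (@le_trans _ _ (\sum_(j < n.+1) d)).
    by apply: ler_sum => j _; exact: ht.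
  by rewrite sumr_const card_ord mulr_natl.
have -> : L * (n.+1%:R * d) = L / (L + 1) * e.
  by rewrite /d ratio_cancel//; lra.
by rewrite ler_piMl ?(ltW e0)// ler_pdivrMr; lra.
Qed.

(* A Lipschitz function is the infimum of the cones with rational vertices. *)
Lemma pathlip_measurable d (T : measurableType d) n L Phi (p : T -> nat -> R) : pathlip n L Phi ->
  (forall j, (j <= n)%N -> measurable_fun setT (fun x => p x j)) ->
  measurable_fun setT (fun x => Phi (p x)).
Proof.
move=> hP mp.
have L0 := pathlip_ge0 hP.
have mb (b : R) : measurable [set x | Phi (p x) < b].
  pose q (f : {ffun 'I_n.+1 -> rat}) (j : nat) : R :=
    if insub j is Some i then ratr (f i) else 0.
  pose g f x := Phi (q f) + L * pathdist n (p x) (q f).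
  have mg f : measurable_fun setT (g f).
    apply: measurable_funD => //; apply: measurable_funM => //.
    apply: measurable_sum => j; apply: measurableT_comp => //.
    by apply: measurable_funB => //; apply: mp; rewrite -ltnS.
  rewrite (_ : [set x | _] = \bigcup_k [set x | exists2 f, unpickle k = Some f & g f x < b]).
    apply: bigcupT_measurable => k; case E : (unpickle k) => [f|]; last first.
      by rewrite (_ : [set x | _] = set0)//; apply/seteqP; split => // x [].
    rewrite (_ : [set x | _] = g f @^-1` `]-oo, b[).
      by rewrite -[X in measurable X]setTI; apply: mg => //; exact: measurable_itv.
    apply/seteqP; split => x /=; rewrite in_itv/=; first by move=> [f' [<-]].
    by exists f.
  apply/seteqP; split => x /=.
  (* The choice gives [2 L (n + 1) dl < b - Phi (p x)]: the Lipschitz bound is spent once on the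
     value of [Phi] at the vertex and once on the cone. *)
  - move=> xb; pose dl := (b - Phi (p x)) / (2 * (L + 1) * n.+1%:R).
    have n0 : 0 < (n.+1)%:R :> R by rewrite ltr0n.
    have dl0 : 0 < dl by rewrite divr_gt0 ?subr_gt0// !mulr_gt0//; lra.
    have hf j : exists r : rat, `|p x j - ratr r| < dl.
      have lt : p x j - dl < p x j + dl by rewrite ltrD2l; lra.
      have [r /=] := rat_in_itvoo lt.
      by rewrite in_itv/= => rh; exists r; rewrite ltr_distlC.
    have /choice[f hf'] : forall j : 'I_n.+1, exists r : rat, `|p x j - ratr r| < dl.
      by move=> j; exact: hf.
    pose F := [ffun j => f j].
    exists (pickle F) => //; exists F; first by rewrite pickleK.
    have dF : pathdist n (p x) (q F) <= n.+1%:R * dl.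
      rewrite mulr_natl -[n.+1 in leRHS]card_ord -sumr_const; apply: ler_sum => j _.
      by rewrite /q valK ffunE ltW.
    have := hP (q F) (p x); rewrite ler_norml => /andP[_].
    have -> : pathdist n (q F) (p x) = pathdist n (p x) (q F).
      by apply: eq_bigr => j _; rewrite distrC.
    have h2 : L * pathdist n (p x) (q F) <= L * (n.+1%:R * dl) by rewrite ler_wpM2l.
    have h3 : 2 * (L * (n.+1%:R * dl)) < b - Phi (p x).
      have -> : 2 * (L * (n.+1%:R * dl)) = L / (L + 1) * (b - Phi (p x)).
        rewrite -(@ratio_cancel L n.+1%:R)//; last by lra.
        have n1 : n.+1%:R != 0 :> R by rewrite gt_eqF.
        rewrite /dl; move: (n.+1%:R : R) n1 => N n1.
        have L1 : L + 1 != 0 by rewrite gt_eqF//; lra.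
        by field; rewrite n1 L1.
      by rewrite gtr_pMl ?subr_gt0// ltr_pdivrMr; lra.
    rewrite /g; lra.
  - move=> [k _ [f _]]; apply: le_lt_trans.
    have := hP (p x) (q f); rewrite ler_norml /g; lra.
have h := @measurability _ _ _ _ setT (fun x => Phi (p x)) (@RGenInftyO.G R).
apply: (@measurability _ _ _ _ _ _ (@RGenInftyO.G R)); first exact: RGenInftyO.measurableE.
move=> _ [_ [b ->] <-]; rewrite setTI.
by rewrite (_ : _ @^-1` _ = [set x | Phi (p x) < b])//; apply/seteqP; split => x /=; rewrite in_itv.
Qed.

End paths.

Section iterated_gaussian.
Context {R : realType}.
Variables (s : R) (n : nat).
Implicit Types (c : nat -> R) (Phi : (nat -> R) -> R).

(* The expectation of [Phi] over the last [r] of the [n] Gaussian steps of a walk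
   whose positions [c 0, ..., c (n - r)] are given. *)
Fixpoint wexp Phi (r : nat) c : R :=
  if r is r'.+1
  then gmean s (fun z => wexp Phi r' (upd c (n - r'.+1).+1 (c (n - r'.+1)%N + z)))
  else Phi c.

Lemma wexpS Phi r c :
  wexp Phi r.+1 c = gmean s (fun z => wexp Phi r (upd c (n - r.+1).+1 (c (n - r.+1)%N + z))).
Proof. by []. Qed.

(** The factor [2] per step arises because a change of the current position is copied to the next
    one. *)
Lemma wexp_pathlip_unit Phi L r : pathlip n L Phi -> (forall c, 0 <= Phi c <= 1) -> (r <= n)%N ->
  pathlip n (2 ^+ r * L) (wexp Phi r) /\ forall c, 0 <= wexp Phi r c <= 1.
Proof.
move=> hP P01; elim: r => [_|r IH rn]; first by rewrite expr0 mul1r.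
have {}IH := IH (ltnW rn); case: IH => hL h01.
have jn : ((n - r.+1).+1 <= n)%N by rewrite -subSn// subSS leq_subr.
have L0 := pathlip_ge0 hL.
have lip c x y : `|wexp Phi r (upd c (n - r.+1).+1 (c (n - r.+1)%N + x)) -
    wexp Phi r (upd c (n - r.+1).+1 (c (n - r.+1)%N + y))| <= 2 ^+ r * L * `|x - y|.
  by apply: le_trans (pathlip_upd _ _ _ _ hL) _; rewrite opprD addrACA subrr add0r.
have cont c : continuous (fun z => wexp Phi r (upd c (n - r.+1).+1 (c (n - r.+1)%N + z))).
  exact: lipschitz_continuous (lip c).
have int c := integrable_step s c (n - r.+1).+1 (c (n - r.+1)%N) hL h01.
split=> [c c'|c]; last by rewrite wexpS; apply: gmean_unit => //.
rewrite !wexpS; apply: gmean_dist => // z.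
apply: le_trans (hL _ _) _.
have -> : 2 ^+ r.+1 * L * pathdist n c c' = 2 ^+ r * L * (2 * pathdist n c c').
  by rewrite exprS; ring.
rewrite ler_wpM2l//.
apply: le_trans (pathdist_upd _ _ _ _ _ _) _.
rewrite opprD addrACA subrr addr0.
have := @pathdist_coord R n c c' (n - r.+1) (leq_subr _ _); lra.
Qed.

(** Both walks make the same Gaussian steps. As node [j] lies before the current position, moving it
    changes no later position. *)
Lemma wexp_le_upd Phi1 Phi2 L1 L2 j e r : pathlip n L1 Phi1 -> pathlip n L2 Phi2 ->
  (forall c, 0 <= Phi1 c <= 1) -> (forall c, 0 <= Phi2 c <= 1) ->
  (forall c v, `|v - c j| <= e -> Phi1 c <= Phi2 (upd c j v)) ->
  (r <= n)%N -> (j < n - r)%N -> forall c v, `|v - c j| <= e -> wexp Phi1 r c <= wexp Phi2 r (upd c j v).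
Proof.
move=> l1 l2 u1 u2 h; elim: r => [_ _|r IH rn jr] c v vj; first exact: h.
rewrite !wexpS -[leRHS]addr0.
have [p1 q1] := wexp_pathlip_unit l1 u1 (ltnW rn).
have [p2 q2] := wexp_pathlip_unit l2 u2 (ltnW rn).
apply: gmean_le_add; [exact: integrable_step p1 q1|exact: integrable_step p2 q2|move=> z].
rewrite addr0 (@upd_other _ c j v (n - r.+1)%N); last by rewrite gtn_eqF.
have jn : j != (n - r.+1).+1 by rewrite ltn_eqF// ltnS ltnW.
rewrite updC//; apply: IH; [exact: ltnW| |].
  by apply: leq_trans jr _; exact: leq_sub2l.
by rewrite upd_other.
Qed.

End iterated_gaussian.

(** * Integrating out an independent Gaussian step *)

Section decoupling.
Context {R : realType} {d : measure_display} {T : measurableType d}.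
Variables (P : probability T R) (B : set T) (Y : T -> R) (s K : R).
Variables (G : R -> T -> R) (g : R -> R).
Hypotheses (mB : measurable B) (mY : measurable_fun setT Y) (K0 : 0 <= K).
Hypotheses (GK : forall x y w, `|G x w - G y w| <= K * `|x - y|)
  (gK : forall x y, `|g x - g y| <= K * `|x - y|)
  (G0 : forall x w, 0 <= G x w) (g0 : forall x, 0 <= g x)
  (mG : forall x, measurable_fun setT (G x)) (mGY : measurable_fun setT (fun w => G (Y w) w)).
Hypothesis indep : forall x A, measurable A ->
  (\int[P]_(w in B `&` Y @^-1` A) (G x w)%:E = P B * normal_prob 0 s A * (g x)%:E)%E.
Hypothesis indep1 : forall A, measurable A -> (P (B `&` Y @^-1` A) = P B * normal_prob 0 s A)%E.

(** The integer grid is enumerated through [pickle], so that the cells form a sequence and countable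
    additivity applies. *)
Let cell (e : R) (k : nat) : set R := [set z | pickle (Num.floor (z / e)) = k].

Let rep (e : R) (k : nat) : R := if unpickle k is Some i then e * (i : int)%:~R else 0.

Let cell_near (e : R) k (z : R) : 0 < e -> cell e k z -> `|z - rep e k| <= e.
Proof.
move=> e0; rewrite /cell /rep/= => <-; rewrite pickleK.
have /andP[h1 h2] := floor_itv (z / e).
move: h1 h2; rewrite ler_pdivlMr// ltr_pdivrMr// intrD mulrDl mul1r => h1 h2.
rewrite mulrC ler_norml; lra.
Qed.

Let mcell e k : measurable (cell e k).
Proof.
rewrite /cell; case E : (@unpickle int k) => [i|]; last first.
  rewrite (_ : [set z | _] = set0)//; apply/seteqP; split => // z /= zk.
  by move: E; rewrite -zk pickleK.
rewrite (_ : [set z | _] = if pickle i == k then (fun z => z / e) @^-1` `[i%:~R, (i + 1)%:~R[ else set0).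
  case: ifP => _ //; rewrite -[X in measurable X]setTI.
  have mf : measurable_fun setT (fun z : R => z / e) by exact: measurable_funM.
  by apply: mf => //; exact: measurable_itv.
apply/seteqP; split => z /=.
- move=> zk; have zi : Num.floor (z / e) = i by move: E; rewrite -zk pickleK => -[].
  by rewrite -zi zk eqxx/= in_itv/= floor_le_tmp floorD1_gt.
- case: ifP => // /eqP <-; rewrite /= in_itv/= => h; congr pickle.
  exact/floor_def.
Qed.

Let cellU e : \bigcup_k (cell e k) = setT.
Proof. by apply/seteqP; split => // z _; exists (pickle (Num.floor (z / e))). Qed.

Let cell_triv e : trivIset setT (cell e).
Proof. by apply/trivIsetP => i j _ _ ij; apply/seteqP; split => // z /= []; rewrite /cell/= => -> /eqP; rewrite (negbTE ij). Qed.

Let preU e : B = \bigcup_k (B `&` Y @^-1` (cell e k)).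
Proof. by rewrite -setI_bigcupr -preimage_bigcup cellU preimage_setT setIT. Qed.

Let pre_triv e : trivIset setT (fun k => B `&` Y @^-1` (cell e k)).
Proof.
apply/trivIsetP => i j _ _ ij; apply/seteqP; split => // w /= [[_ h1] [_ h2]].
have /trivIsetP h := @cell_triv e.
by have /seteqP[+ _] := h i j I I ij; move=> /(_ (Y w)); exact.
Qed.

Let mpre A : measurable A -> measurable (B `&` Y @^-1` A).
Proof. by move=> mA; apply: measurableI => //; rewrite -[X in measurable X]setTI; exact: mY. Qed.

Let mg : measurable_fun setT g.
Proof. by apply: continuous_measurable_fun; exact: lipschitz_continuous gK. Qed.

Let split_P (f : T -> \bar R) e : measurable_fun setT f -> (forall w, 0 <= f w)%E ->
  (\int[P]_(w in B) f w = \sum_(k <oo) \int[P]_(w in B `&` Y @^-1` (cell e k)) f w)%E.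
Proof.
move=> mf f0; rewrite {1}(preU e) ge0_integral_bigcup//.
- by move=> k; exact: mpre (mcell e k).
- exact: measurable_funTS.
Qed.

Let split_N (f : R -> \bar R) e : measurable_fun setT f -> (forall w, 0 <= f w)%E ->
  (\int[normal_prob 0 s]_w f w = \sum_(k <oo) \int[normal_prob 0 s]_(w in cell e k) f w)%E.
Proof.
move=> mf f0; rewrite -(cellU e) ge0_integral_bigcup//.
- by move=> k; exact: mcell.
- by rewrite cellU.
Qed.

Let PB_sum (f : nat -> \bar R) : (forall k, 0 <= f k)%E ->
  (P B * \sum_(k <oo) f k = \sum_(k <oo) (P B * f k))%E.
Proof.
have PBfin : P B \is a fin_num by exact: fin_num_measure.
by move=> f0; rewrite -[P B]fineK//; apply/esym/nneseriesZl.
Qed.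

Let intP c (A : set R) : measurable A ->
  (\int[P]_(w in B `&` Y @^-1` A) c%:E = P B * normal_prob 0 s A * c%:E)%E.
Proof.
move=> mA; rewrite integral_cst; last exact: mpre.
by rewrite muleC; congr (_ * _)%E; exact: indep1.
Qed.

Let mid (e : R) k (c : R) : 0 <= c ->
  (\int[P]_(w in B `&` Y @^-1` (cell e k)) ((G (rep e k) w)%:E + c%:E) =
   P B * \int[normal_prob 0 s]_(z in cell e k) (g (rep e k) + c)%:E)%E.
Proof.
move=> c0; have mc := mcell e k; have mp := mpre mc.
rewrite ge0_integralD//; last 2 first.
- by move=> w _; rewrite lee_fin.
- by apply/measurable_funTS/measurable_EFinP.
rewrite indep// intP// integral_cst//.
rewrite -ge0_muleDr ?lee_fin// -EFinD.
by rewrite -muleA; congr (_ * _)%E; rewrite muleC.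
Qed.

Let near_G (e : R) k w : 0 < e -> cell e k (Y w) -> `|G (Y w) w - G (rep e k) w| <= K * e.
Proof.
move=> e0 yc; apply: le_trans (GK _ _ _) _.
by rewrite ler_wpM2l// cell_near.
Qed.

Let near_g (e : R) k (z : R) : 0 < e -> cell e k z -> `|g z - g (rep e k)| <= K * e.
Proof.
move=> e0 yc; apply: le_trans (gK _ _) _.
by rewrite ler_wpM2l// cell_near.
Qed.

Let mgc (A : set R) c : measurable_fun A (fun z => (g z + c)%:E).
Proof. by apply/measurable_funTS/measurable_EFinP; apply: measurable_funD. Qed.

Let mGYc (A : set T) c : measurable_fun A (fun w => (G (Y w) w + c)%:E).
Proof. by apply/measurable_funTS/measurable_EFinP; apply: measurable_funD. Qed.

Let bound1 (e : R) : 0 < e -> (\int[P]_(w in B) (G (Y w) w)%:E <=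
    P B * \int[normal_prob 0 s]_z (g z + 2 * K * e)%:E)%E.
Proof.
move=> e0; have Ke : 0 <= K * e by rewrite mulr_ge0// ltW.
have Ke2 : 0 <= 2 * K * e by rewrite -mulrA mulr_ge0.
rewrite (@split_P _ e); [|exact/measurable_EFinP|by move=> w; rewrite lee_fin].
rewrite (@split_N _ e); [|exact: mgc|by move=> z; rewrite lee_fin addr_ge0].
rewrite PB_sum; last first.
  by move=> k; apply: integral_ge0 => z _; rewrite lee_fin addr_ge0.
apply: lee_nneseries => [k _ _|k _].
  by apply: integral_ge0 => w _; rewrite lee_fin.
have mc := mcell e k.
apply: (@le_trans _ _ (\int[P]_(w in B `&` Y @^-1` (cell e k)) ((G (rep e k) w)%:E + (K * e)%:E))%E).
  apply: ge0_le_integral => //.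
  - exact: mpre.
  - by move=> w _; rewrite lee_fin.
  - by apply/measurable_funTS/measurable_EFinP.
  - by apply/emeasurable_funD => //; apply/measurable_funTS/measurable_EFinP.
  - move=> w [_ /= yc]; rewrite -EFinD lee_fin.
    have := near_G e0 yc; rewrite ler_norml; lra.
rewrite mid//; apply: lee_wpmul2l => //; apply: ge0_le_integral => //.
- by move=> z _; rewrite lee_fin addr_ge0.
- exact: mgc.
- by move=> z /= zc; rewrite lee_fin; have := near_g e0 zc; rewrite ler_norml; lra.
Qed.

Let bound2 (e : R) : 0 < e -> (P B * \int[normal_prob 0 s]_z (g z)%:E <=
    \int[P]_(w in B) (G (Y w) w + 2 * K * e)%:E)%E.
Proof.
move=> e0; have Ke : 0 <= K * e by rewrite mulr_ge0// ltW.
have Ke2 : 0 <= 2 * K * e by rewrite -mulrA mulr_ge0.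
rewrite (@split_P _ e); [|exact: mGYc|by move=> w; rewrite lee_fin addr_ge0].
rewrite (@split_N _ e); [|exact/measurable_EFinP|by move=> z; rewrite lee_fin].
rewrite PB_sum; last first.
  by move=> k; apply: integral_ge0 => z _; rewrite lee_fin.
apply: lee_nneseries => [k _|k _].
  by rewrite mule_ge0//; apply: integral_ge0 => w _; rewrite lee_fin.
have mc := mcell e k.
apply: (@le_trans _ _ (P B * \int[normal_prob 0 s]_(z in cell e k) (g (rep e k) + K * e)%:E)%E).
  apply: lee_wpmul2l => //; apply: ge0_le_integral => //.
  - by move=> z _; rewrite lee_fin.
  - by apply/measurable_funTS/measurable_EFinP.
  - by move=> z /= zc; rewrite lee_fin; have := near_g e0 zc; rewrite ler_norml; lra.
rewrite -mid//; apply: ge0_le_integral => //.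
- exact: mpre.
- by move=> w _; rewrite -EFinD lee_fin addr_ge0.
- by apply/emeasurable_funD => //; apply/measurable_funTS/measurable_EFinP.
- move=> w [_ /= yc]; rewrite -EFinD lee_fin.
  by have := near_G e0 yc; rewrite ler_norml; lra.
Qed.

(** A substitute for conditioning on [Y]: on each cell of a grid of mesh [e] the hypothesis is used
    at one fixed point, the two Lipschitz bounds cost at most [2 K e] together, and [e] is
    arbitrary. *)
Lemma integral_decouple :
  (\int[P]_(w in B) (G (Y w) w)%:E = P B * \int[normal_prob 0 s]_z (g z)%:E)%E.
Proof.
have PB1 : (P B <= 1)%E by exact: probability_le1.
have PB0 : (0 <= P B)%E by [].
have K1 : 0 < 2 * K + 1 by rewrite ltr_wpDl// mulr_ge0.
have small e : 0 < e -> exists e', [/\ 0 < e', 0 <= 2 * K * e' & 2 * K * e' <= e].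
  move=> e0; have e'0 : 0 < e / (2 * K + 1) by exact: divr_gt0.
  exists (e / (2 * K + 1)); split => //; first by rewrite mulr_ge0 ?(ltW e'0)// mulr_ge0.
  by rewrite mulrA ler_pdivrMr// mulrC ler_pM2l//; lra.
apply/eqP; rewrite eq_le; apply/andP; split; apply/lee_addgt0Pr => e e0;
  have [e' [e'0 Ke2 Kee]] := small _ e0.
- apply: le_trans (bound1 e'0) _.
  under eq_integral do rewrite EFinD.
  rewrite ge0_integralD//; last 2 first.
  + by move=> z _; rewrite lee_fin.
  + exact/measurable_EFinP.
  rewrite integral_cst// [X in (_ + _ * X)%E](@probability_setT _ _ _ (normal_prob 0 s)) mule1.
  rewrite ge0_muleDr//; last by apply: integral_ge0 => z _; rewrite lee_fin.
  rewrite leeD2l//; apply: le_trans (_ : 1 * e%:E <= _)%E; last by rewrite mul1e.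
  by apply: lee_pmul; rewrite ?lee_fin.
- apply: le_trans (bound2 e'0) _.
  under eq_integral do rewrite EFinD.
  rewrite ge0_integralD//; last 2 first.
  + by move=> z _; rewrite lee_fin.
  + by apply/measurable_funTS/measurable_EFinP.
  rewrite integral_cst// leeD2l//; apply: le_trans (_ : e%:E * 1 <= _)%E; last by rewrite mule1.
  by apply: lee_pmul; rewrite ?lee_fin.
Qed.

End decoupling.

Section link.
Context {R : realType} {d : measure_display} {T : measurableType d}.
Variables (P : probability T R) (s : R) (n : nat) (Y : nat -> T -> R).
Variables (Phi : (nat -> R) -> R) (L : R).
Hypotheses (mY : forall i, measurable_fun setT (Y i)) (PhiL : pathlip n L Phi)
  (Phi01 : forall c, 0 <= Phi c <= 1).

Fixpoint walk_from (r : nat) (c : nat -> R) (w : T) : nat -> R :=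
  if r is r'.+1
  then walk_from r' (upd c (n - r'.+1).+1 (c (n - r'.+1)%N + Y (n - r'.+1) w)) w
  else c.

Let pd_walk r c c' w : (r <= n)%N ->
  pathdist n (walk_from r c w) (walk_from r c' w) <= 2 ^+ r * pathdist n c c'.
Proof.
elim: r c c' => [|r IH] c c' rn; first by rewrite expr0 mul1r.
apply: le_trans (IH _ _ (ltnW rn)) _; rewrite exprSr -mulrA ler_wpM2l ?exprn_ge0//.
apply: le_trans (pathdist_upd _ _ _ _ _ _) _.
rewrite opprD addrACA subrr addr0.
have := @pathdist_coord R n c c' (n - r.+1) (leq_subr _ _); lra.
Qed.

Let walk_lip r c j x y w : (r <= n)%N ->
  `|Phi (walk_from r (upd c j x) w) - Phi (walk_from r (upd c j y) w)| <= L * 2 ^+ r * `|x - y|.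
Proof.
move=> rn; have L0 := pathlip_ge0 PhiL; apply: le_trans (PhiL _ _) _.
rewrite -mulrA ler_wpM2l//; apply: le_trans (pd_walk _ _ _ rn) _.
rewrite ler_wpM2l ?exprn_ge0//; apply: le_trans (pathdist_upd _ _ _ _ _ _) _.
by rewrite /pathdist big1 ?add0r// => i _; rewrite subrr normr0.
Qed.

Let measurable_walk r (c : T -> nat -> R) j : (forall j, measurable_fun setT (fun w => c w j)) ->
  measurable_fun setT (fun w => walk_from r (c w) w j).
Proof.
elim: r c => [|r IH] c mc; first exact: mc.
apply: IH => i; rewrite /upd; case: eqP => _; last exact: mc.
by apply: measurable_funD; [exact: mc|exact: mY].
Qed.

Lemma measurable_Phi_walk r (c : T -> nat -> R) : (forall j, measurable_fun setT (fun w => c w j)) ->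
  measurable_fun setT (fun w => Phi (walk_from r (c w) w)).
Proof. by move=> mc; apply: (pathlip_measurable PhiL) => j _; exact: measurable_walk. Qed.

(** Induction on the remaining steps. The event [B] is general so that the induction hypothesis also
    covers its intersections with events of the next step [Y j], which is what decoupling asks
    for. *)
Lemma integral_walk_from r B : (r <= n)%N -> measurable B ->
  (forall A : nat -> set R, (forall i, measurable (A i)) ->
    P (B `&` [set w | forall i, (n - r <= i < n)%N -> A i (Y i w)]) =
    (P B * \prod_(n - r <= i < n) normal_prob 0 s (A i))%E) ->
  forall c, (\int[P]_(w in B) (Phi (walk_from r c w))%:E = P B * (wexp s n Phi r c)%:E)%E.
Proof.
elim: r B => [|r IH] B rn mB hB c; first by rewrite /= integral_cst// muleC.
set j := (n - r.+1)%N.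
have jE : (n - r)%N = j.+1 by rewrite /j subnSK.
have jn : (j < n)%N by rewrite /j ltn_subrL (leq_ltn_trans _ rn).
have mYA (A : set R) : measurable A -> measurable (Y j @^-1` A).
  by move=> mA; rewrite -[X in measurable X]setTI; exact: mY.
have hA (A : set R) (A' : nat -> set R) : measurable A -> (forall i, measurable (A' i)) ->
    P (B `&` Y j @^-1` A `&` [set w | forall i, (n - r <= i < n)%N -> A' i (Y i w)]) =
    (P B * normal_prob 0 s A * \prod_(n - r <= i < n) normal_prob 0 s (A' i))%E.
  move=> mA mA'.
  pose A2 i := if i == j then A else A' i.
  have mA2 i : measurable (A2 i) by rewrite /A2; case: ifP.
  have := hB _ mA2; rewrite -/j big_ltn// {2}/A2 eqxx muleA => hh.
  transitivity (P B * normal_prob 0 s A * \prod_(j.+1 <= i < n) normal_prob 0 s (A2 i))%E; last first.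
    rewrite jE; congr (_ * _)%E; apply: eq_big_nat => i /andP[ji _].
    by rewrite /A2 gtn_eqF.
  rewrite -hh -setIA; congr (P (B `&` _)); apply/seteqP; split => w /=.
  - move=> [h1 h2] i; rewrite leq_eqVlt => /andP[/orP[/eqP <-|ji] in_]; first by rewrite /A2 eqxx.
    by rewrite /A2 gtn_eqF//; apply: h2; rewrite jE ji.
  - move=> h; split; first by have := h j; rewrite /A2 eqxx leqnn jn; exact.
    by move=> i; rewrite jE => /andP[ji in_]; have := h i; rewrite /A2 gtn_eqF// (ltnW ji) in_; exact.
have hA1 (A : set R) : measurable A -> P (B `&` Y j @^-1` A) = (P B * normal_prob 0 s A)%E.
  move=> mA; have := hA A (fun=> setT) mA (fun=> measurableT).
  rewrite big1 ?mule1; last by move=> i _; exact: probability_setT.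
  rewrite (_ : [set w | _] = setT) ?setIT//.
  by apply/seteqP; split.
have L0 := pathlip_ge0 PhiL.
have [wL w01] := wexp_pathlip_unit s PhiL Phi01 (ltnW rn).
have int1 c' : (\int[P]_(w in B) (Phi (walk_from r.+1 c' w))%:E =
    P B * \int[normal_prob 0 s]_z (wexp s n Phi r (upd c' j.+1 (c' j + z)))%:E)%E.
  apply: (@integral_decouple _ _ _ P B (Y j) s (2 ^+ r * L)
    (fun z w => Phi (walk_from r (upd c' j.+1 (c' j + z)) w))
    (fun z => wexp s n Phi r (upd c' j.+1 (c' j + z)))) => //.
  - by rewrite mulr_ge0// exprn_ge0.
  - move=> x y w; apply: le_trans (walk_lip _ _ _ _ _ (ltnW rn)) _.
    by rewrite opprD addrACA subrr add0r [L * _]mulrC.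
  - move=> x y; apply: le_trans (pathlip_upd _ _ _ _ wL) _.
    by rewrite opprD addrACA subrr add0r.
  - by move=> x w; have /andP[] := Phi01 (walk_from r (upd c' j.+1 (c' j + x)) w).
  - by move=> x; have /andP[] := w01 (upd c' j.+1 (c' j + x)).
  - by move=> x; apply: (@measurable_Phi_walk r (fun=> _)).
  - apply: (@measurable_Phi_walk r (fun w => upd c' j.+1 (c' j + Y j w))) => i.
    by rewrite /upd; case: eqP => _ //; exact: measurable_funD.
  - move=> x A mA; rewrite IH ?(ltnW rn)//.
    + by rewrite hA1.
    + by apply: measurableI => //; exact: mYA.
    + by move=> A' mA'; rewrite hA// hA1.
rewrite int1; congr (_ * _)%E.
rewrite wexpS /gmean -/j fineK//; apply: integrable_fin_num => //.
exact: integrable_step wL w01.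
Qed.

End link.

(** * Relaxed targets and crossing probabilities *)

Section relaxed_target.
Context {R : realType}.
Variables (D : set (nat -> R)) (e dl : R) (n : nat).
Hypotheses (e0 : 0 <= e) (dl0 : 0 < dl).
Implicit Types (c y : nat -> R).

(** The index [j] refers to node [j + 1]: the tolerance is open at the nodes [k + 1, ..., n], and
    node [0] is never tested. *)
Definition excess (k : nat) c y (j : nat) : R :=
  Num.max 0 (`|c j.+1 - y j.+1| - (if (k <= j)%N then e else 0)).

Definition closeness k c y : R := Num.max 0 (1 - (\sum_(j < n) excess k c y j) / dl).

(* The positions [c 1, ..., c k] have to be near a path of [D], and the later
   positions only near its [e]-neighbourhood. *)
Definition relaxed_indic k c : R :=
  sup [set x | x = 0 \/ exists2 y, D y & x = closeness k c y].

Let excess_ge0 k c y j : 0 <= excess k c y j.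
Proof. by rewrite /excess le_max lexx. Qed.

Let closeness_unit k c y : 0 <= closeness k c y <= 1.
Proof.
rewrite /closeness le_max lexx/= ge_max ler01 lerBlDr lerDl.
by rewrite divr_ge0 ?(ltW dl0)// sumr_ge0.
Qed.

(** The element [0] keeps the set non-empty when [D] is empty. *)
Let has_sup_closeness k c : has_sup [set x | x = 0 \/ exists2 y, D y & x = closeness k c y].
Proof.
split; first by exists 0; left.
by exists 1 => x [->//|[y _ ->]]; have /andP[] := closeness_unit k c y.
Qed.

Let closeness_le k c y : D y -> closeness k c y <= relaxed_indic k c.
Proof. by move=> Dy; apply: ub_le_sup; [exact: (has_sup_closeness k c).2|right; exists y]. Qed.

Let relaxed_ge0 k c : 0 <= relaxed_indic k c.
Proof. by apply: ub_le_sup; [exact: (has_sup_closeness k c).2|left]. Qed.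

Let relaxed_le k c M : 0 <= M -> (forall y, D y -> closeness k c y <= M) -> relaxed_indic k c <= M.
Proof.
move=> M0 h; apply: ge_sup; first exact: (has_sup_closeness k c).1.
by move=> x [->//|[y Dy ->]]; exact: h.
Qed.

Lemma relaxed_indic_unit k c : 0 <= relaxed_indic k c <= 1.
Proof.
rewrite relaxed_ge0; apply: relaxed_le => // y _.
by have /andP[] := closeness_unit k c y.
Qed.

Lemma relaxed_indic_pathlip k : pathlip n dl^-1 (relaxed_indic k).
Proof.
suff h c c' : relaxed_indic k c <= relaxed_indic k c' + dl^-1 * pathdist n c c'.
  move=> c c'; have h1 := h c c'; have := h c' c.
  have -> : pathdist n c' c = pathdist n c c' by apply: eq_bigr => j _; rewrite distrC.
  rewrite ler_norml; lra.
have d0 : 0 <= dl^-1 * pathdist n c c' by rewrite mulr_ge0 ?pathdist_ge0// invr_ge0 ltW.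
apply: relaxed_le => [|y Dy]; first by rewrite addr_ge0.
apply: le_trans (_ : closeness k c' y + dl^-1 * pathdist n c c' <= _); last first.
  by rewrite lerD2r; exact: closeness_le.
have hs : \sum_(j < n) excess k c' y j <= \sum_(j < n) excess k c y j + pathdist n c c'.
  rewrite /pathdist big_ord_recl/= addrCA ler_wpDl// -big_split/=; apply: ler_sum => j _.
  rewrite /excess; set a := if _ then _ else _.
  have := ler_distD (c j.+1) (c' j.+1) (y j.+1); rewrite [`|c' _ - c _|]distrC.
  have := normr_ge0 (c j.+1 - c' j.+1).
  set mx := Num.max 0 (`|c j.+1 - _| - a) => n0 tri.
  have m0 : 0 <= mx by rewrite le_max lexx.
  have m1 : `|c j.+1 - y j.+1| - a <= mx by rewrite le_max lexx orbT.
  by rewrite ge_max /bump/= add1n; apply/andP; split; lra.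
rewrite /closeness ge_max; apply/andP; split.
  by rewrite addr_ge0// le_max lexx.
apply: le_trans (_ : (1 - (\sum_(j < n) excess k c' y j) / dl) + dl^-1 * pathdist n c c' <= _); last first.
  by rewrite lerD2r le_max lexx orbT.
rewrite -subr_ge0; set a := \sum_(j < n) _ in hs *; set b := \sum_(j < n) _ in hs *.
have -> : 1 - a / dl + dl^-1 * pathdist n c c' - (1 - b / dl) = (b + pathdist n c c' - a) / dl by field; rewrite gt_eqF.
by rewrite divr_ge0 ?(ltW dl0)// subr_ge0.
Qed.

Lemma relaxed_indic_ge1 k c y : D y -> (forall j, (j < n)%N -> c j.+1 = y j.+1) ->
  1 <= relaxed_indic k c.
Proof.
move=> Dy h; apply: le_trans (closeness_le k c Dy).
rewrite /closeness big1 ?mul0r ?subr0 ?le_max ?lexx ?orbT// => j _.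
rewrite /excess h// subrr normr0 sub0r max_l// oppr_le0; case: ifP => // _.
Qed.

Lemma relaxed_indic_gt0 c : 0 < relaxed_indic 0 c ->
  exists2 y, D y & forall j, (j < n)%N -> `|c j.+1 - y j.+1| < e + dl.
Proof.
move=> h; have [x xS xp] := sup_gt (has_sup_closeness 0 c).1 h.
case: xS xp => [->|[y Dy ->]]; first by rewrite ltxx.
rewrite /closeness lt_max ltxx/= subr_gt0 ltr_pdivrMr// mul1r => hs.
exists y => // j jn.
have : excess 0 c y j < dl.
  apply: le_lt_trans hs; rewrite (bigD1 (Ordinal jn))//= lerDl; exact: sumr_ge0.
by rewrite /excess leq0n gt_max => /andP[_]; lra.
Qed.

(** Passing from [k + 1] to [k] opens the tolerance at node [k + 1] only, and this pays for moving
    that node by at most [e]. *)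
Lemma relaxed_indic_upd k c v : `|v - c k.+1| <= e ->
  relaxed_indic k.+1 c <= relaxed_indic k (upd c k.+1 v).
Proof.
move=> vc; apply: relaxed_le => [|y Dy]; first exact: relaxed_ge0.
apply: le_trans (closeness_le k (upd c k.+1 v) Dy).
rewrite /closeness ge_max le_max lexx/= le_max; apply/orP; right.
rewrite lerD2l lerN2 ler_pM2r ?invr_gt0//; apply: ler_sum => j _.
rewrite /excess /upd eqSS; have [->|jk] := eqVneq (j : nat) k.
  rewrite ltnn leqnn ge_max le_max lexx/= le_max; apply/orP; right.
  by have := ler_distD (c k.+1) v (y k.+1); lra.
by rewrite [(k <= j)%N]leq_eqVlt eq_sym (negbTE jk).
Qed.

End relaxed_target.

(** * Line crossings of a Gaussian walk *)

Section line_crossing.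
Context {R : realType}.
Variables (s : R) (m : nat) (a b dl sg : R).
Hypotheses (s0 : 0 < s) (dl0 : 0 < dl) (b0 : 0 <= b) (sg1 : sg ^+ 2 = 1).
Implicit Types (c : nat -> R).

Definition ramp (x : R) : R := Num.min 1 (Num.max 0 (1 + x / dl)).

Lemma ramp_unit x : 0 <= ramp x <= 1.
Proof. by rewrite /ramp le_min ler01 le_max lexx/= ge_min lexx. Qed.

Lemma ramp_lip x y : `|ramp x - ramp y| <= dl^-1 * `|x - y|.
Proof.
have d1 : 0 < dl^-1 by rewrite invr_gt0.
have h u v : ramp u <= ramp v + dl^-1 * `|u - v|.
  have n0 : 0 <= dl^-1 * `|u - v| by rewrite mulr_ge0// ltW.
  have : dl^-1 * (u - v) <= dl^-1 * `|u - v| by rewrite ler_pM2l// ler_norm.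
  rewrite /ramp; move: n0; set w := dl^-1 * `|u - v| => n0 hw.
  have {}hw : u / dl <= v / dl + w by rewrite mulrC [v / dl]mulrC; lra.
  case: (leP 0 (1 + u / dl)) => h1; case: (leP 0 (1 + v / dl)) => h2; rewrite ?(min_r ler01).
  - by case: (leP 1 (1 + u / dl)) => h3; case: (leP 1 (1 + v / dl)) => h4; lra.
  - by case: (leP 1 (1 + u / dl)) => h3; lra.
  - by case: (leP 1 (1 + v / dl)) => h4; lra.
  - by lra.
have h1 := h x y; have := h y x; rewrite distrC; rewrite ler_norml; lra.
Qed.

Definition crossing c (j : nat) : R := ramp (sg * c j - a - b * (j%:R * s ^+ 2)).

(** A Lipschitz majorant of the event that some node crosses the line, so that the iterated Gaussian
    means apply to it. *)
Definition crossing_indic c : R := 1 - \prod_(j < m) (1 - crossing c j.+1).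

Let norm_sg : `|sg| = 1.
Proof.
have : `|sg| ^+ 2 = 1 by rewrite real_normK ?num_real.
by move=> /eqP; rewrite sqrf_eq1 => /orP[/eqP//|/eqP h]; have := normr_ge0 sg; rewrite h; lra.
Qed.

Let prod_unit k c : 0 <= \prod_(j < k) (1 - crossing c j.+1) <= 1.
Proof.
apply/andP; split.
  by apply: prodr_ge0 => j _; rewrite subr_ge0; have /andP[] := ramp_unit (sg * c j.+1 - a - b * (j.+1%:R * s ^+ 2)).
apply: prodr_ile1 => j _.
by have /andP[h1 h2] := ramp_unit (sg * c j.+1 - a - b * (j.+1%:R * s ^+ 2)); rewrite /crossing; lra.
Qed.

Lemma crossing_indic_unit c : 0 <= crossing_indic c <= 1.
Proof. by rewrite /crossing_indic; have := prod_unit m c; lra. Qed.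

Let prod_lip k c c' : `|\prod_(j < k) (1 - crossing c j.+1) - \prod_(j < k) (1 - crossing c' j.+1)|
  <= dl^-1 * \sum_(j < k) `|c j.+1 - c' j.+1|.
Proof.
elim: k => [|k IH]; first by rewrite !big_ord0 subrr normr0 mulr0.
rewrite !big_ord_recr/= [in leRHS]mulrDr.
set p := \prod_(j < k) _ in IH *; set q := \prod_(j < k) _ in IH *.
have -> : p * (1 - crossing c k.+1) - q * (1 - crossing c' k.+1) =
  (p - q) * (1 - crossing c k.+1) + q * (crossing c' k.+1 - crossing c k.+1) by ring.
apply: le_trans (ler_normD _ _) _; rewrite !normrM; apply: lerD.
- apply: le_trans IH; rewrite ler_piMr//.
  have /andP[h1 h2] := ramp_unit (sg * c k.+1 - a - b * (k.+1%:R * s ^+ 2)).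
  by rewrite /crossing ler_norml; lra.
- have /andP[q0 q1] := prod_unit k c'; apply: (@le_trans _ _ `|crossing c' k.+1 - crossing c k.+1|).
    by rewrite ler_piMl// ger0_norm.
  apply: le_trans (ramp_lip _ _) _; rewrite ler_pM2l ?invr_gt0//.
  have -> : sg * c' k.+1 - a - b * (k.+1%:R * s ^+ 2) - (sg * c k.+1 - a - b * (k.+1%:R * s ^+ 2)) =
    sg * (c' k.+1 - c k.+1) by ring.
  by rewrite normrM norm_sg mul1r distrC.
Qed.

Lemma crossing_indic_pathlip : pathlip m dl^-1 crossing_indic.
Proof.
move=> c c'; rewrite /crossing_indic.
set p := \prod_(j < m) _; set q := \prod_(j < m) _.
have -> : 1 - p - (1 - q) = - (p - q) by ring.
rewrite normrN; apply: le_trans (prod_lip _ _ _) _; rewrite ler_pM2l ?invr_gt0//.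
by rewrite /pathdist big_ord_recl/= lerDr.
Qed.

Lemma crossing_indic_ge1 c j : (0 < j <= m)%N -> a + b * (j%:R * s ^+ 2) <= sg * c j ->
  1 <= crossing_indic c.
Proof.
case: j => // j /= jm h; rewrite /crossing_indic (bigD1 (Ordinal jm))//= /crossing.
rewrite {1}/ramp min_l; first by rewrite subrr mul0r subr0.
rewrite le_max lerDl divr_ge0 ?orbT ?(ltW dl0)//; lra.
Qed.

(** The martingale [exp (l x - l^2 t / 2)] with [l = 2 b], scaled to equal [1] on the line
    [a - dl + b t], where the ramp starts. *)
Let expmart c (k : nat) : R := expR (2 * b * (sg * c k) - 2 * b ^+ 2 * (k%:R * s ^+ 2) - 2 * b * (a - dl)).

Let crossing_mart c k : 0 < crossing c k -> 1 <= expmart c k.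
Proof.
rewrite /crossing /ramp lt_min ltr01/= lt_max ltxx/= => h.
have {}h : - dl < sg * c k - a - b * (k%:R * s ^+ 2).
  have := mulr_gt0 h dl0; rewrite mulrDl mul1r divfK ?gt_eqF//; lra.
rewrite -expR0 ler_expR.
have := ler_wpM2l b0 (ltW h); set t := k%:R * s ^+ 2; set x := sg * c k.
rewrite expr2; lra.
Qed.

(* The exponential martingale of the line [a - dl + b t] dominates the crossing probability. *)
Lemma wexp_crossing_le r c : (r <= m)%N ->
  let q := \prod_(j < m - r) (1 - crossing c j.+1) in
  wexp s m crossing_indic r c <= (1 - q) + q * expmart c (m - r).
Proof.
elim: r c => [|r IH] c rm /=.
  rewrite subn0 /crossing_indic lerDl mulr_ge0 ?expR_ge0//.
  by have /andP[] := prod_unit m c.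
set j := (m - r.+1)%N; have jE : (m - r)%N = j.+1 by rewrite /j subnSK.
set q := \prod_(i < j) _; have /andP[q0 q1] : 0 <= q <= 1 by exact: prod_unit.
have [wL w01] := wexp_pathlip_unit s crossing_indic_pathlip crossing_indic_unit (ltnW rm).
pose E := expmart c j * expR (- (2 * b ^+ 2 * s ^+ 2)).
have step z : wexp s m crossing_indic r (upd c j.+1 (c j + z)) <=
    ((1 - q) + (q * E) * expR ((2 * b * sg) * z)) + 0.
  apply: le_trans (IH _ (ltnW rm)) _; rewrite jE big_ord_recr/=.
  rewrite (eq_bigr (fun i : 'I_j => 1 - crossing c i.+1)); last first.
    by move=> i _; rewrite /crossing upd_other// eqSS ltn_eqF.
  rewrite -/q; set x := crossing _ _.
  have -> : expmart (upd c j.+1 (c j + z)) j.+1 = E * expR ((2 * b * sg) * z).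
    rewrite /E /expmart -!expRD upd_same; congr expR; rewrite -[j.+1]addn1 natrD.
    ring.
  have x01 : 0 <= x <= 1 by exact: ramp_unit.
  have Ez : 0 < x -> 1 <= E * expR ((2 * b * sg) * z).
    move=> /crossing_mart; rewrite /expmart /E -!expRD upd_same; congr (_ <= expR _).
    rewrite -[j.+1]addn1 natrD; ring.
  have E0 : 0 <= E * expR ((2 * b * sg) * z) by rewrite !mulr_ge0// expR_ge0.
  rewrite addr0 -[q * E * _]mulrA; move: (E * expR _) Ez E0 => y Ez y0.
  (* The crossing weight [x] may be replaced by [x * y], since [x > 0] only where the martingale
     value [y] is at least [1]; then the factor [1 - x] disappears from the bound. *)
  have xy : 0 <= x * (y - 1).
    move: x01 => /andP[]; rewrite le_eqVlt => /predU1P[<-|x0] _; first by rewrite mul0r.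
    by rewrite mulr_ge0 ?(ltW x0)// subr_ge0 Ez.
  have := mulr_ge0 q0 xy; lra.
have iw := integrable_step s c j.+1 (c j) wL w01.
have i1 : gauss_integrable s (fun=> 1 - q).
  exact: finite_measure_integrable_cst.
have i2 := integrable_mulr (q * E) (integrable_normal_expR s0 (2 * b * sg)).
have := gmean_le_add iw (integrable_addr i1 i2) step.
rewrite addr0 => /le_trans; apply.
rewrite /gmean RintegralD// RintegralZl//; last exact: integrable_normal_expR.
rewrite -/(gmean s (fun=> 1 - q)) gmean_cst lerD2l.
rewrite /Rintegral integral_normal_expR//= -mulrA ler_wpM2l// /E -mulrA -expRD exprMn sg1.
by rewrite (_ : _ + _ = 0) ?expR0 ?mulr1//; field.
Qed.

Lemma wexp_crossing : wexp s m crossing_indic m (fun=> 0) <= expR (- (2 * b * (a - dl))).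
Proof.
have := wexp_crossing_le (fun=> 0) (leqnn m).
rewrite /= subnn big_ord0 => /le_trans; apply.
rewrite subrr add0r mul1r /expmart le_eqVlt; apply/orP; left; apply/eqP; congr expR; ring.
Qed.

End line_crossing.

Section crossing_probability.
Context {R : realType} {d : measure_display} {T : measurableType d}.
Variables (P : probability T R).

Lemma walk_fromE n (Y : nat -> T -> R) r c w j : (r <= n)%N -> (j <= n)%N ->
  walk_from n Y r c w j =
  if (j <= n - r)%N then c j else c (n - r)%N + \sum_(n - r <= i < j) Y i w.
Proof.
elim: r c => [|r IH] c rn jn; first by rewrite subn0 jn.
rewrite /= IH ?(ltnW rn)//; set J := (n - r.+1)%N.
have -> : (n - r)%N = J.+1 by rewrite /J subnSK.
have [jJ|Jj|->] := ltngtP j J.+1.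
- by rewrite -ltnS jJ upd_other// ltn_eqF.
- by rewrite leqNgt (ltnW Jj)/= upd_same -addrA -big_ltn// ltnW.
- by rewrite ltnn upd_same big_nat1.
Qed.

Lemma measurable_exists_nat (Q : nat -> T -> Prop) : (forall j, measurable [set w | Q j w]) ->
  measurable [set w | exists j, Q j w].
Proof.
move=> mQ; rewrite (_ : [set w | _] = \bigcup_j [set w | Q j w]); first exact: bigcupT_measurable.
by apply/seteqP; split => w [j]; [exists j|move=> _; exists j].
Qed.

Lemma measurable_le_fun (f g : T -> R) : measurable_fun setT f -> measurable_fun setT g ->
  measurable [set w | f w <= g w].
Proof.
move=> mf mg; rewrite (_ : [set w | _] = (fun w => g w - f w) @^-1` `[0, +oo[).
  rewrite -[X in measurable X]setTI.
  have mh : measurable_fun setT (fun w => g w - f w) by exact: measurable_funB.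
  by apply: mh => //; exact: measurable_itv.
by apply/seteqP; split => w /=; rewrite in_itv/= andbT subr_ge0.
Qed.

Lemma measurable_and_cond (b : bool) (Q : T -> Prop) : measurable [set w | Q w] ->
  measurable [set w | b /\ Q w].
Proof.
move=> mQ; case: b; first by rewrite (_ : [set w | _] = [set w | Q w])//; apply/seteqP; split => w //= [].
by rewrite (_ : [set w | _] = set0)//; apply/seteqP; split => w //= [].
Qed.

Variables (m : nat) (s : R) (Y : nat -> T -> R).
Hypotheses (s0 : 0 < s) (mY : forall i, measurable_fun setT (Y i)).

Definition gauss_steps (Y : nat -> T -> R) := forall A : nat -> set R, (forall i, measurable (A i)) ->
  P [set w | forall i, (i < m)%N -> A i (Y i w)] = (\prod_(i < m) normal_prob 0 s (A i))%E.

Lemma expectation_walk (Phi : (nat -> R) -> R) (L : R) c : gauss_steps Y ->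
  pathlip m L Phi -> (forall c, 0 <= Phi c <= 1) ->
  (\int[P]_w (Phi (walk_from m Y m c w))%:E = (wexp s m Phi m c)%:E)%E.
Proof.
move=> gY PhiL Phi01.
have := @integral_walk_from R d T P s m Y Phi L mY PhiL Phi01 m setT (leqnn m) measurableT.
rewrite probability_setT => h; rewrite h ?mul1e// => A mA.
by rewrite setTI subnn mul1e big_mkord; exact: gY.
Qed.

Lemma cross_prob (a b dl sg : R) : gauss_steps Y -> 0 < dl -> 0 <= b -> sg ^+ 2 = 1 ->
  (P [set w | exists j, (0 < j <= m)%N /\ (a + b * (j%:R * s ^+ 2) <= sg * \sum_(i < j) Y i w)%R]
   <= (expR (- (2 * b * (a - dl))))%:E)%E.
Proof.
move=> gY dl0 b0 sg1.
have mS j : measurable_fun setT (fun w => \sum_(i < j) Y i w) by exact: measurable_sum.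
set A := [set w | _].
have mA : measurable A.
  apply: measurable_exists_nat => j; apply: measurable_and_cond.
  by apply: measurable_le_fun => //; exact: measurable_funM.
apply: le_trans (_ : (wexp s m (crossing_indic s m a b dl sg) m (fun=> 0))%:E <= _)%E; last first.
  by rewrite lee_fin wexp_crossing.
have PL := @crossing_indic_pathlip R s m a b dl sg dl0 sg1.
have PU := @crossing_indic_unit R s m a b dl sg.
rewrite -(expectation_walk _ gY PL PU).
have -> : P A = (\int[P]_w (\1_A w)%:E)%E by rewrite integral_indic// setIT.
apply: ge0_le_integral => //.
- by apply/measurable_EFinP; exact: measurable_indic.
- apply/measurable_EFinP.
  by apply: (measurable_Phi_walk mY PL).
- move=> w _; rewrite lee_fin indicE; case: (boolP (w \in A)) => [|_]; last first.
    by have /andP[] := PU (walk_from m Y m (fun=> 0) w).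
  rewrite inE => -[j [jm h]]; apply: (crossing_indic_ge1 dl0 jm).
  have /andP[j0 jm'] := jm.
  by rewrite walk_fromE// subnn leqn0 gtn_eqF// add0r big_mkord.
Qed.

End crossing_probability.

Section bridge.
Context {R : realType} {d : measure_display} {T : measurableType d}.
Variables (P : probability T R) (m : nat) (s : R) (Y : nat -> T -> R).
Hypotheses (s0 : 0 < s) (m0 : (0 < m)%N) (mY : forall i, measurable_fun setT (Y i)).

Let S j w : R := \sum_(i < j) Y i w.

Let rev_sum k w : (k <= m)%N -> \sum_(i < k) Y (m - i.+1) w = S m w - S (m - k) w.
Proof.
elim: k => [|k IH] km; first by rewrite big_ord0 subn0 subrr.
rewrite big_ord_recr/= IH ?(ltnW km)// /S.
have -> : (m - k)%N = (m - k.+1).+1 by rewrite subnSK.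
rewrite big_ord_recr/=; ring.
Qed.

Let gauss_rev : gauss_steps P m s Y -> gauss_steps P m s (fun i => Y (m - i.+1)%N).
Proof.
move=> gY A mA.
have h i : (i < m)%N -> (m - (m - i.+1).+1)%N = i by move=> im; rewrite subnSK// subKn// ltnW.
have := gY (fun i => A (m - i.+1)%N) (fun i => mA _).
rewrite [X in _ = X -> _](reindex_inj rev_ord_inj)/=.
rewrite [X in _ = X -> _](eq_bigr (fun i : 'I_m => normal_prob 0 s (A i))); last first.
  by move=> i _; rewrite h.
move=> <-; congr (P _); apply/seteqP; split => w /= hw i im.
- by have := hw (m - i.+1)%N; rewrite h// ltn_subrL m0; exact.
- by have := hw (m - i.+1)%N; rewrite h// ltn_subrL m0; exact.
Qed.

(* With [t = j / m], the bridge [S j - t (S m)] is the convex combination of [S j] and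
   of minus the reversed walk [S m - S j], both of which rarely cross the lines [a + b t]. *)
Lemma bridge_prob (a b dl : R) : gauss_steps P m s Y -> 0 < dl -> 0 < a -> 0 <= b ->
  (P [set w | exists j, (j <= m)%N /\
      (a + b * (m%:R * s ^+ 2) / 2 <= `|S j w - j%:R / m%:R * S m w|)%R]
   <= (4 * expR (- (2 * b * (a - dl))))%:E)%E.
Proof.
move=> gY dl0 a0 b0; have gY' := gauss_rev gY.
have mY' i : measurable_fun setT (Y (m - i.+1)%N) by exact: mY.
have one1 : (1 : R) ^+ 2 = 1 by rewrite expr1n.
have oneN : (- 1 : R) ^+ 2 = 1 by rewrite sqrrN expr1n.
have c1 := @cross_prob R d T P m s Y s0 mY a b dl _ gY dl0 b0 one1.
have c2 := @cross_prob R d T P m s Y s0 mY a b dl _ gY dl0 b0 oneN.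
have c3 := @cross_prob R d T P m s _ s0 mY' a b dl _ gY' dl0 b0 one1.
have c4 := @cross_prob R d T P m s _ s0 mY' a b dl _ gY' dl0 b0 oneN.
have mE (Z : nat -> T -> R) sg : (forall i, measurable_fun setT (Z i)) ->
    measurable [set w | exists j, (0 < j <= m)%N /\ (a + b * (j%:R * s ^+ 2) <= sg * \sum_(i < j) Z i w)%R].
  move=> mZ; apply: measurable_exists_nat => j; apply: measurable_and_cond.
  apply: measurable_le_fun => //; apply: measurable_funM => //; exact: measurable_sum.
have mE1 := mE _ 1 mY; have mE2 := mE _ (-1) mY.
have mE3 := mE _ 1 mY'; have mE4 := mE _ (-1) mY'.
set E1 := [set w | _] in c1 mE1; set E2 := [set w | _] in c2 mE2.
set E3 := [set w | _] in c3 mE3; set E4 := [set w | _] in c4 mE4.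
have mS j : measurable_fun setT (S j) by exact: measurable_sum.
set F := [set w | _].
have mF : measurable F.
  apply: measurable_exists_nat => j; apply: measurable_and_cond.
  apply: measurable_le_fun => //; apply: measurableT_comp => //.
  by apply: measurable_funB => //; exact: measurable_funM.
have FE : F `<=` (E1 `|` E2) `|` (E3 `|` E4).
  move=> w [j [jm hj]]; apply: contrapT => nE.
  have n1 : ~ E1 w by move=> h; apply: nE; left; left.
  have n2 : ~ E2 w by move=> h; apply: nE; left; right.
  have n3 : ~ E3 w by move=> h; apply: nE; right; left.
  have n4 : ~ E4 w by move=> h; apply: nE; right; right.
  have mR : 0 < m%:R :> R by rewrite ltr0n.
  have s2 : 0 <= s ^+ 2 by exact: sqr_ge0.
  have hS k : (k <= m)%N -> `|S k w| < a + b * (k%:R * s ^+ 2).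
    move=> km; have [->|k0] := posnP k.
      by rewrite /S big_ord0 normr0 mul0r mulr0 addr0.
    rewrite ltr_norml; apply/andP; split; rewrite ltNge; apply/negP => h.
    - by apply: n2; exists k; rewrite k0 km; split => //; rewrite mulN1r -/(S k w); lra.
    - by apply: n1; exists k; rewrite k0 km; split => //; rewrite mul1r -/(S k w); lra.
  have hS' k : (k <= m)%N -> `|S m w - S (m - k) w| < a + b * (k%:R * s ^+ 2).
    move=> km; have [->|k0] := posnP k.
      by rewrite subn0 subrr normr0 mul0r mulr0 addr0.
    rewrite -rev_sum// ltr_norml; apply/andP; split; rewrite ltNge; apply/negP => h.
    - by apply: n4; exists k; rewrite k0 km; split => //; rewrite mulN1r; lra.
    - by apply: n3; exists k; rewrite k0 km; split => //; rewrite mul1r; lra.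
  have h1 := hS _ jm; have := hS' (m - j)%N (leq_subr _ _).
  rewrite subKn// natrB// => h2.
  have [t [t0 t1 tE]] : exists t : R, [/\ 0 <= t, t <= 1 & j%:R = t * m%:R].
    by exists (j%:R / m%:R); split; rewrite ?divr_ge0 ?ler_pdivrMr ?mul1r ?ler_nat ?divfK ?gt_eqF.
  move: hj; rewrite tE mulfK ?gt_eqF//; apply/negP; rewrite -ltNge.
  have -> : S j w - t * S m w = (1 - t) * S j w - t * (S m w - S j w) by ring.
  apply: le_lt_trans (ler_normB _ _) _; rewrite !normrM (ger0_norm t0) (@ger0_norm _ (1 - t)) ?subr_ge0//.
  rewrite tE in h1 h2.
  move: `|S j w| `|S m w - S j w| h1 h2 => x y h1 h2.
  set M := m%:R * s ^+ 2; have M0 : 0 <= M by rewrite mulr_ge0// ltW.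
  have {}h1 : x < a + b * (t * M) by rewrite /M [t * _]mulrA.
  have {}h2 : y < a + b * ((1 - t) * M) by move: h2; rewrite (_ : (m%:R - t * m%:R) * s ^+ 2 = (1 - t) * M)// /M; ring.
  have pos : 0 < (1 - t) * (a + b * (t * M) - x) + t * (a + b * ((1 - t) * M) - y).
    move: t0; rewrite le_eqVlt => /predU1P[t0|t0].
      by rewrite -t0 subr0 [0 * (_ - y)]mul0r addr0 mul1r subr_gt0; rewrite t0.
    apply: ltr_wpDl; first by rewrite mulr_ge0 ?subr_ge0// ltW.
    by rewrite mulr_gt0// subr_gt0.
  have bM : 0 <= b * M by rewrite mulr_ge0.
  (* The convex combination of the two lines is [a + 2 b M t (1 - t)], and
     [2 t (1 - t) = 1 / 2 - (1 - 2 t)^2 / 2]. *)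
  have q : 0 <= b * M * (1 - 2 * t) ^+ 2 by rewrite mulr_ge0// sqr_ge0.
  have -> : (1 - t) * x + t * y = a + b * M / 2 - b * M * (1 - 2 * t) ^+ 2 / 2 -
     ((1 - t) * (a + b * (t * M) - x) + t * (a + b * ((1 - t) * M) - y)) by field.
  rewrite ltrBlDr; apply: (@le_lt_trans _ _ (a + b * M / 2)); last by rewrite ltrDl.
  by rewrite gerBl divr_ge0.
have -> : (4 * expR (- (2 * b * (a - dl))))%:E =
  (((expR (- (2 * b * (a - dl))))%:E + (expR (- (2 * b * (a - dl))))%:E) +
  ((expR (- (2 * b * (a - dl))))%:E + (expR (- (2 * b * (a - dl))))%:E))%E.
  by rewrite -!EFinD; congr EFin; ring.
have m12 : measurable (E1 `|` E2) by exact: measurableU.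
have m34 : measurable (E3 `|` E4) by exact: measurableU.
apply: le_trans (_ : P ((E1 `|` E2) `|` (E3 `|` E4)) <= _)%E.
  by apply: le_measure; rewrite ?inE//; exact: measurableU.
apply: le_trans (measureU2 _ m12 m34) _; apply: leeD.
  by apply: le_trans (measureU2 _ mE1 mE2) _; exact: leeD.
by apply: le_trans (measureU2 _ mE3 mE4) _; exact: leeD.
Qed.

End bridge.

(** * The Wiener process *)

Section unit_points.
Context {R : realType}.

Lemma unit_pt_subproof (x : R) : Num.min 1 (Num.max 0 x) \in (`[0, 1]%classic : set R).
Proof. by rewrite inE/= in_itv/= le_min ler01 le_max lexx/= ge_min lexx. Qed.

(** Clamping makes evaluation of a path at a real time total and continuous. *)
Definition unit_pt (x : R) : unitI R :=
  exist (fun x => x \in (`[0, 1]%classic : set R)) _ (unit_pt_subproof x).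

Lemma set_val_unit_pt x : 0 <= x <= 1 -> set_val (unit_pt x) = x.
Proof. by move=> /andP[x0 x1]; rewrite set_valE /= max_r// min_r. Qed.

Lemma set_val_unit (t : unitI R) : 0 <= set_val t <= 1.
Proof. by have := valP t; rewrite inE/= in_itv/= -set_valE. Qed.

Lemma unit_pt_set_val (t : unitI R) : unit_pt (set_val t) = t.
Proof. by apply: val_inj; rewrite -!set_valE set_val_unit_pt ?set_val_unit. Qed.

Lemma continuous_unit_pt : continuous unit_pt.
Proof.
apply: continuous_comp_initial.
have h (x y : R) : Num.min 1 (Num.max 0 x) <= Num.min 1 (Num.max 0 y) + `|x - y|.
  have := ler_norm (x - y); have := normr_ge0 (x - y).
  by case: (leP 0 x) => ?; case: (leP 0 y) => ?; rewrite ?(min_r ler01);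
    try case: (leP 1 x) => ?; try case: (leP 1 y) => ?; lra.
apply: (@lipschitz_continuous _ 1) => x y; rewrite mul1r /= !set_valE /=.
by have := h x y; have := h y x; rewrite distrC ler_norml; lra.
Qed.

Lemma continuous_pt (x : C01 R) : continuous (fun t => x (unit_pt t)).
Proof. by move=> t; apply: continuous_comp; [exact: continuous_unit_pt|exact: cts_fun]. Qed.

Lemma unif_dist_le (x y : C01 R) r :
  (forall t, 0 <= t <= 1 -> `|x (unit_pt t) - y (unit_pt t)| <= r) -> unif_dist x y <= r.
Proof.
move=> h; apply: ge_sup; first by exists (`|x (unit_pt 0) - y (unit_pt 0)|); exists (unit_pt 0).
by move=> _ [t _ <-]; rewrite -(unit_pt_set_val t); apply: h; exact: set_val_unit.
Qed.

(** The extreme value theorem bounds the range; for an unbounded set [sup] would only be a default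
    value. *)
Lemma unif_dist_ge (x y : C01 R) t : `|x t - y t| <= unif_dist x y.
Proof.
apply: ub_le_sup; last by exists t.
have cg : {within `[0, 1], continuous (fun t : R => `|x (unit_pt t) - y (unit_pt t)|)}.
  apply: continuous_subspaceT => u; apply: cvg_norm; apply: cvgB; exact: continuous_pt.
have [c _ hc] := EVT_max ler01 cg.
exists (`|x (unit_pt c) - y (unit_pt c)|) => _ [u _ <-].
by rewrite -(unit_pt_set_val u); apply: hc; rewrite in_itv/= set_val_unit.
Qed.

Lemma unif_cont_unit (f : R -> R) (eta : R) : continuous f -> 0 < eta ->
  exists2 dl, 0 < dl & forall x y, 0 <= x <= 1 -> `|x - y| <= dl -> `|f x - f y| <= eta.
Proof.
move=> cf eta0.
have /compact_near_coveringP K := @segment_compact R 0 1.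
have h : \forall d \near 0^'+, `[0, 1]%classic `<=` (fun x => forall y, `|x - y| <= d -> `|f x - f y| <= eta).
  suff Kx (x : R) : \forall x' \near x & d \near 0^'+,
      forall y : R, `|x' - y| <= d -> `|f x' - f y| <= eta.
    by apply: K => x _; exact: Kx.
  have eta2 : 0 < eta / 2 by rewrite divr_gt0.
  have := @cvgr_dist_le _ _ _ (nbhs x) _ _ _ (cf x) _ eta2 => /(_ _).
  move=> /nbhs_ballP[r /= r0 hr].
  have r2 : 0 < r / 2 by rewrite divr_gt0.
  have hrr z : `|x - z| < r -> `|f x - f z| <= eta / 2 by move=> ?; apply: hr.
  near=> x' d => y /= hy.
  have h1 : `|x - x'| < r / 2.
    by near: x'; exact: (@cvgr_dist_lt _ _ _ (nbhs x) _ id x cvg_id).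
  have h2 : d < r / 2 by near: d; exact: nbhs_right_lt.
  have h3 : `|x - y| < r by have := ler_distD x' x y; lra.
  have h4 : `|x - x'| < r by lra.
  have := hrr _ h3; have := hrr _ h4; have := ler_distD (f x) (f x') (f y).
  rewrite [`|f x' - f x|]distrC; lra.
have [dl []] := filter_ex (filterI h (nbhs_right_gt (0 : R))).
move=> h1 dl0; exists dl => // x y x01; apply: h1; by rewrite /= in_itv.
Unshelve. all: by end_near. Qed.

Lemma le_of_dense (g : R -> R) (r t : R) : continuous g ->
  (forall d : R, 0 < d -> exists2 x : R, `|t - x| < d & g x <= r) -> g t <= r.
Proof.
move=> cg h; rewrite leNgt; apply/negP => rt.
have /nbhs_ballP[d /= d0 hd] : \forall z \near t, r < g z.
  by apply: (@cvgr_gt _ _ (nbhs t) _ g (g t) (cg t)).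
have [x tx gx] := h _ d0.
by have := hd x tx; rewrite /= ltNge gx.
Qed.

Lemma le_of_rat (g : R -> R) (r t : R) : continuous g -> 0 <= t <= 1 ->
  (forall q : rat, 0 <= (ratr q : R) <= 1 -> g (ratr q) <= r) -> g t <= r.
Proof.
move=> cg /andP[t0 t1] h; apply: le_of_dense => // d d0.
have lt : Num.max 0 (t - d) < Num.min 1 (t + d).
  by rewrite lt_min !gt_max; apply/andP; split; apply/andP; split; lra.
have [q] := rat_in_itvoo lt.
rewrite in_itv/= lt_min gt_max => /andP[/andP[q0 q1] /andP[q2 q3]].
exists (ratr q); first by rewrite ltr_norml; lra.
by apply: h; rewrite !ltW.
Qed.

Lemma measurable_exists_count d (T : measurableType d) (I : countType) (Q : I -> T -> Prop) :
  (forall j, measurable [set w | Q j w]) -> measurable [set w | exists j, Q j w].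
Proof.
move=> mQ; rewrite (_ : [set w | _] =
  \bigcup_k [set w | exists2 j, unpickle k = Some j & Q j w]).
  apply: bigcupT_measurable => k; case E : (unpickle k) => [j|].
    rewrite (_ : [set w | _] = [set w | Q j w])//; apply/seteqP; split => w /=.
      by move=> [_ [<-]].
    by exists j.
  by rewrite (_ : [set w | _] = set0)//; apply/seteqP; split => w // [].
apply/seteqP; split => w /= [j].
  by move=> h; exists (pickle j) => //; exists j; rewrite ?pickleK.
by move=> _ [i _ h]; exists i.
Qed.

Lemma measurable_forall_count d (T : measurableType d) (I : countType) (Q : I -> T -> Prop) :
  (forall j, measurable [set w | Q j w]) -> measurable [set w | forall j, Q j w].
Proof.
move=> mQ; rewrite (_ : [set w | _] = ~` [set w | exists j, ~ Q j w]).
  by apply: measurableC; apply: measurable_exists_count => j; exact: (measurableC (mQ j)).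
apply/seteqP; split => w /=; first by move=> h [j]; apply; exact: h.
by move=> h j; apply: contrapT => hj; apply: h; exists j.
Qed.

(* [D^eps] is open and [C[0,1]] is separable: it is a countable union of neighbourhoods of
   rational step functions. *)
Lemma measurable_enlarge d (T : measurableType d) (B : T -> C01 R) (D : set (C01 R)) (eps : R) :
  (forall t, measurable_fun setT (fun w => B w t)) -> measurable [set w | enlarge D eps (B w)].
Proof.
move=> mB.
pose step (c : seq rat) (t : R) : R := ratr (nth 0 c (Num.truncn (t * (size c).-1%:R))).
pose near_step (cr : seq rat * rat) (x : C01 R) := forall q : rat, 0 <= (ratr q : R) <= 1 ->
  `|x (unit_pt (ratr q)) - step cr.1 (ratr q)| <= ratr cr.2.
pose good cr := forall x, near_step cr x -> enlarge D eps x.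
rewrite (_ : [set w | _] = [set w | exists cr, good cr /\ near_step cr (B w)]).
  apply: measurable_exists_count => cr.
  have [g|g] := pselect (good cr); last first.
    by rewrite (_ : [set w | _] = set0)//; apply/seteqP; split => w // [].
  rewrite (_ : [set w | _] = [set w | near_step cr (B w)]); last first.
    by apply/seteqP; split => w // [].
  apply: measurable_forall_count => q.
  have [q01|q01] := boolP (0 <= (ratr q : R) <= 1); last first.
    by rewrite (_ : [set w | _] = setT)//; apply/seteqP; split => w //.
  rewrite (_ : [set w | _] = [set w |
     `|B w (unit_pt (ratr q)) - step cr.1 (ratr q)| <= ratr cr.2]); last first.
    by apply/seteqP; split => w //=; exact.
  apply: measurable_le_fun => //; apply: measurableT_comp => //.
  by apply: measurable_funB => //; exact: mB.
apply/seteqP; split => w /=; last by move=> [cr [g h]]; exact: g.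
move=> [y Dy xy]; set x := B w in xy *.
(* Oscillation and rational rounding cost [eta] each and the radius [r] is below [3 * eta], so every
   path near the step function is within [5 * eta] of [x], which is less than the gap. *)
pose eta := (eps - unif_dist x y) / 8.
have eta0 : 0 < eta by rewrite divr_gt0// subr_gt0.
have [dl dl0 hdl] := unif_cont_unit (@continuous_pt x) eta0.
pose m := (Num.truncn (dl^-1)).+1.
have mR : 0 < m%:R :> R by rewrite ltr0n.
have mdl : m%:R^-1 <= dl.
  by rewrite -[leRHS]invrK lef_pV2 ?posrE ?invr_gt0//; apply/ltW; exact: truncnS_gt.
have /choice[c hc] : forall i : nat, exists q : rat, `|x (unit_pt (i%:R / m%:R)) - ratr q| < eta.
  move=> i; set z := x _.
  have lt : z - eta < z + eta by lra.
  have [q] := rat_in_itvoo lt.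
  by rewrite in_itv/= => qz; exists q; rewrite ltr_distlC.
have lt : 2 * eta < 3 * eta by lra.
have [r] := rat_in_itvoo lt; rewrite in_itv/= => /andP[r1 r2].
have close t : 0 <= t <= 1 -> `|x (unit_pt t) - step (mkseq c m.+1) t| <= 2 * eta.
  move=> /andP[t0 t1]; rewrite /step size_mkseq/=.
  have tm0 : 0 <= t * m%:R by rewrite mulr_ge0.
  have /andP[i1 i2] := truncn_itv tm0.
  have im : (Num.truncn (t * m%:R) < m.+1)%N.
    by rewrite ltnS -(ler_nat R); apply: le_trans i1 _; rewrite ler_piMl.
  rewrite nth_mkseq//; move: (Num.truncn _) i1 i2 im => i i1 i2 im.
  have h1 : `|t - i%:R / m%:R| <= dl.
    apply: le_trans mdl.
    have -> : t - i%:R / m%:R = (t * m%:R - i%:R) / m%:R by field; rewrite gt_eqF.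
    rewrite normrM normfV (ger0_norm (ltW mR)) ler_pdivrMr// mulVf ?gt_eqF//.
    move: i2; rewrite -natr1 ler_norml; lra.
  have t01 : 0 <= t <= 1 by apply/andP.
  have := hdl t _ t01 h1; have := hc i; have := ler_distD (x (unit_pt (i%:R / m%:R))) (x (unit_pt t)) (ratr (c i)).
  lra.
exists (mkseq c m.+1, r); split; last first.
  by move=> q q01; apply: le_trans (close _ q01) _; exact: ltW.
move=> x' hx'; exists y => //.
have lt5 : unif_dist x y + 5 * eta < eps.
  have -> : eps = unif_dist x y + 8 * eta by rewrite /eta; field.
  by lra.
apply: le_lt_trans lt5; apply: unif_dist_le => t t01.
have : `|x' (unit_pt t) - x (unit_pt t)| <= 5 * eta.
  apply: (@le_of_rat (fun t => `|x' (unit_pt t) - x (unit_pt t)|)) => //.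
    by move=> u; apply: cvg_norm; apply: cvgB; exact: continuous_pt.
  move=> q q01; have := hx' q q01; have := close _ q01 => /= h1 h2.
  have := ler_distD (step (mkseq c m.+1) (ratr q)) (x' (unit_pt (ratr q))) (x (unit_pt (ratr q))).
  rewrite [`|step _ _ - x _|]distrC; lra.
have := ler_distD (x (unit_pt t)) (x' (unit_pt t)) (y (unit_pt t)).
have := unif_dist_ge x y (unit_pt t); lra.
Qed.

End unit_points.

(** * Deviation of the Wiener process from its broken line *)

Section wiener.
Context {R : realType} {d : measure_display} {T : measurableType d}.
Variables (P : probability T R) (B : T -> C01 R).
Hypothesis hB : standard_wiener P B.

Lemma wiener_gauss_steps m (tau : nat -> R) (dl : R) : 0 < dl ->
  (forall i, (i <= m)%N -> 0 <= tau i <= 1) -> (forall i, (i < m)%N -> tau i.+1 - tau i = dl) ->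
  gauss_steps P m (Num.sqrt dl) (fun i w => B w (unit_pt (tau i.+1)) - B w (unit_pt (tau i))).
Proof.
move=> dl0 t01 td A mA.
have mono i : (i < m)%N -> set_val (unit_pt (tau i)) < set_val (unit_pt (tau i.+1)).
  by move=> im; rewrite !set_val_unit_pt ?t01// 1?ltnW// -subr_gt0 td.
rewrite (wiener_indep hB (t := fun i => unit_pt (tau i)))//; last by move=> i im; rewrite ltW// mono.
apply: eq_bigr => i _; rewrite [LHS](wiener_gauss hB (mono _ (ltn_ord i)) (mA i)).
by rewrite !set_val_unit_pt ?t01 ?td// ltnW.
Qed.

Definition bridge_dev (n k : nat) (g : R -> R) (u : R) : R :=
  g (k%:R / n%:R + u / n%:R) - g (k%:R / n%:R) - u * (g (k.+1%:R / n%:R) - g (k%:R / n%:R)).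

(** Dyadic times make this a countable increasing union of events about discrete bridges, and by
    continuity of the paths they control all times. *)
Definition wide_bridge (n k : nat) (L : R) : set T :=
  [set w | exists q : nat, exists j : nat, (j <= 2 ^ q)%N /\
     L <= `|bridge_dev n k (fun t => B w (unit_pt t)) (j%:R / (2 ^ q)%:R)|].

(** For every mesh the [2 ^ q] steps have total variance [1 / n], so level and bound of the discrete
    bridges do not depend on [q]; the events increase with [q]. *)
Lemma wide_bridge_prob (n k : nat) (a b dl : R) : (k < n)%N -> 0 < dl -> 0 < a -> 0 <= b ->
  measurable (wide_bridge n k (a + b / n%:R / 2)) /\
  (P (wide_bridge n k (a + b / n%:R / 2)) <= (4 * expR (- (2 * b * (a - dl))))%:E)%E.
Proof.
move=> kn dl0 a0 b0; set L := a + _.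
have nR : 0 < n%:R :> R by rewrite ltr0n (leq_ltn_trans _ kn).
pose F q := [set w | exists j : nat, (j <= 2 ^ q)%N /\
     L <= `|bridge_dev n k (fun t => B w (unit_pt t)) (j%:R / (2 ^ q)%:R)|].
have mBt x : measurable_fun setT (fun w => B w (unit_pt x)) by exact: wiener_measurable hB _.
have mF q : measurable (F q).
  apply: measurable_exists_nat => j; apply: measurable_and_cond.
  apply: measurable_le_fun => //; apply: measurableT_comp => //.
  apply: measurable_funB; first exact: measurable_funB.
  by apply: measurable_funM => //; exact: measurable_funB.
have WE : wide_bridge n k L = \bigcup_q F q.
  by apply/seteqP; split => w; [move=> [q h]; exists q|move=> [q _ h]; exists q].
have mW : measurable (wide_bridge n k L) by rewrite WE; exact: bigcupT_measurable.
split => //; rewrite WE in mW *.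
have nd : nondecreasing_seq F.
  apply/nondecreasing_seqP => q; apply/subsetPset => w [j [jq h]]; exists (2 * j)%N; split.
    by rewrite expnS leq_mul2l.
  rewrite (_ : _ / _ = j%:R / (2 ^ q)%:R)// expnS !natrM -mulf_div divff ?mul1r//.
have c := nondecreasing_cvg_mu (mu := P) mF mW nd.
rewrite -(cvg_lim _ c)//; apply: lime_le; first by apply/cvg_ex; eexists; exact: c.
apply: nearW => q /=; set m := (2 ^ q)%N.
have m0 : (0 < m)%N by rewrite expn_gt0.
have mR : 0 < m%:R :> R by rewrite ltr0n.
pose tau (i : nat) : R := k%:R / n%:R + (i%:R / m%:R) / n%:R.
pose step := (n%:R * m%:R)^-1 : R.
have step0 : 0 < step by rewrite invr_gt0 mulr_gt0.
have t01 i : (i <= m)%N -> 0 <= tau i <= 1.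
  move=> im; have i1 : 0 <= (i%:R / m%:R : R) <= 1.
    by rewrite divr_ge0//= ler_pdivrMr// mul1r ler_nat.
  rewrite /tau -mulrDl divr_ge0 ?(ltW nR)//= ?ler_pdivrMr// ?mul1r.
    apply: (@le_trans _ _ (k%:R + 1)); first by rewrite lerD2l; case/andP: i1.
    by rewrite natr1 ler_nat.
have td i : (i < m)%N -> tau i.+1 - tau i = step.
  move=> im; rewrite /tau /step -natr1; move: (i%:R : R) => I.
  by field; rewrite !gt_eqF.
have gs := wiener_gauss_steps step0 t01 td.
have s0 : 0 < Num.sqrt step by rewrite sqrtr_gt0.
have mY i : measurable_fun setT (fun w => B w (unit_pt (tau i.+1)) - B w (unit_pt (tau i))).
  exact: measurable_funB.
have := bridge_prob s0 m0 mY gs dl0 a0 b0.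
rewrite sqr_sqrtr ?(ltW step0)//.
have -> : m%:R * step = n%:R^-1 by rewrite /step; field; rewrite !gt_eqF.
suff -> : F q = [set w | exists j : nat, (j <= m)%N /\
   (a + b / n%:R / 2 <= `|\sum_(i < j) (B w (unit_pt (tau i.+1)) - B w (unit_pt (tau i))) -
     j%:R / m%:R * \sum_(i < m) (B w (unit_pt (tau i.+1)) - B w (unit_pt (tau i)))|)%R] by [].
have tel w j : \sum_(i < j) (B w (unit_pt (tau i.+1)) - B w (unit_pt (tau i))) =
   B w (unit_pt (tau j)) - B w (unit_pt (k%:R / n%:R)).
  rewrite -(big_mkord xpredT (fun i => B w (unit_pt (tau i.+1)) - B w (unit_pt (tau i)))).
  by rewrite (telescope_sumr (fun i => B w (unit_pt (tau i))))// /tau !mul0r addr0.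
have taum : tau m = k.+1%:R / n%:R by rewrite /tau divff ?gt_eqF// -mulrDl natr1.
by apply/seteqP; split => w [j [jm h]]; exists j; split => //; move: h;
  rewrite !tel taum /bridge_dev.
Qed.

Lemma bridge_dev_le (n k : nat) (g : R -> R) (L u : R) : continuous g -> 0 <= u <= 1 ->
  (forall q j, (j <= 2 ^ q)%N -> `|bridge_dev n k g (j%:R / (2 ^ q)%:R)| <= L) ->
  `|bridge_dev n k g u| <= L.
Proof.
move=> cg /andP[u0 u1] h; apply: (@le_of_dense _ (fun u => `|bridge_dev n k g u|)).
  move=> x; apply: cvg_norm; apply: cvgB; last by apply: cvgM; [exact: cvg_id|exact: cvg_cst].
  apply: cvgB; last exact: cvg_cst.
  apply: (@continuous_comp R R R (fun u : R => k%:R / n%:R + u / n%:R) g x); last exact: cg.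
  by apply: cvgD; [exact: cvg_cst|apply: cvgM; [exact: cvg_id|exact: cvg_cst]].
move=> e e0; pose q := (Num.truncn e^-1).+1.
have mR : 0 < (2 ^ q)%:R :> R by rewrite ltr0n expn_gt0.
have qe : (2 ^ q)%:R^-1 < e.
  rewrite -[ltRHS]invrK ltf_pV2 ?posrE ?invr_gt0//; apply: lt_trans (truncnS_gt _) _.
  by rewrite ltr_nat ltn_expl.
have um0 : 0 <= u * (2 ^ q)%:R by rewrite mulr_ge0// ltW.
have /andP[i1 i2] := truncn_itv um0.
have im : (Num.truncn (u * (2 ^ q)%:R) <= 2 ^ q)%N.
  by rewrite -(ler_nat R); apply: le_trans i1 _; rewrite ler_piMl// ltW.
exists ((Num.truncn (u * (2 ^ q)%:R))%:R / (2 ^ q)%:R); last exact: h.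
move: (Num.truncn _) i1 i2 => j i1 i2; apply: le_lt_trans qe.
move: (((2 ^ q)%:R : R)) mR i1 i2 => M mR i1 i2.
have -> : u - j%:R / M = (u * M - j%:R) / M by field; rewrite gt_eqF.
rewrite normrM normfV (ger0_norm (ltW mR)) ler_pdivrMr// mulVf ?gt_eqF//.
move: i2; rewrite -natr1 ler_norml; lra.
Qed.

End wiener.

Section wiener_upper_bound.
Context {R : realType} {d : measure_display} {T : measurableType d}.
Variables (P : probability T R) (B : T -> C01 R).
Hypothesis hB : standard_wiener P B.

Definition node_paths (D : set (C01 R)) (n : nat) : set (nat -> R) :=
  [set y | exists2 z, D (broken_line n z) &
     forall j, y j = (Num.sqrt n%:R)^-1 * \sum_(i < j) z i].

Lemma broken_line_interp n (z : nat -> R) k (u : R) : (k < n)%N -> 0 <= u <= 1 ->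
  broken_line_fun n z (k%:R / n%:R + u / n%:R) = broken_line_fun n z (k%:R / n%:R) +
    u * (broken_line_fun n z (k.+1%:R / n%:R) - broken_line_fun n z (k%:R / n%:R)).
Proof.
move=> kn /andP[u0 u1]; have nR : 0 < n%:R :> R by rewrite ltr0n (leq_ltn_trans _ kn).
have nR' : 0 < n%:R^-1 :> R by rewrite invr_gt0.
rewrite (broken_line_linear z (t := k%:R / n%:R + u / n%:R) kn); last first.
  apply/andP; split; first by rewrite lerDl mulr_ge0 ?(ltW nR').
  by rewrite -mulrDl ler_pM2r// -natr1 lerD2l.
rewrite (broken_line_linear z (t := k.+1%:R / n%:R) kn); last first.
  by rewrite lexx andbT ler_pM2r// ler_nat.
congr (_ + _).
set c := broken_line_fun n z _; set r := (Num.sqrt _)^-1; rewrite -natr1.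
by move: (k%:R : R) (n%:R : R) nR => x N N0; field; rewrite gt_eqF.
Qed.

Lemma unit_decomp (n : nat) (t : R) : (0 < n)%N -> 0 <= t <= 1 ->
  exists k u, [/\ (k < n)%N, 0 <= u <= 1 & t = k%:R / n%:R + u / n%:R].
Proof.
move=> n0 /andP[t0 t1]; have nR : 0 < n%:R :> R by rewrite ltr0n.
have : t <= 1 by []; rewrite le_eqVlt => /predU1P[->|tlt].
  exists n.-1, 1; split; rewrite ?prednK ?ler01 ?lexx//.
  by rewrite -mulrDl natr1 prednK// divff ?gt_eqF.
have tn0 : 0 <= t * n%:R by rewrite mulr_ge0// ltW.
have /andP[i1 i2] := truncn_itv tn0.
exists (Num.truncn (t * n%:R)), (t * n%:R - (Num.truncn (t * n%:R))%:R); split.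
- by rewrite -(ltr_nat R); apply: le_lt_trans i1 _; rewrite -[ltRHS]mul1r ltr_pM2r.
- by rewrite subr_ge0 i1 lerBlDr addrC natr1 ltW.
- by rewrite -mulrDl addrC subrK mulfK ?gt_eqF.
Qed.

(** The Gaussian walk is realised by the increments of [B], shifted by [c 0]. Off the wide bridges
    and the null set where [B] does not start at [0], a positive target value puts [B] into the
    enlargement. *)
Lemma wexp_relaxed_le n (D : set (C01 R)) (eps : R) (c : nat -> R) : (0 < n)%N -> 0 < eps ->
  `|c 0%N| <= 33 / 100 * eps ->
  ((wexp (Num.sqrt n%:R)^-1 n
     (relaxed_indic (node_paths D n) (33 / 100 * eps) (1 / 400 * eps) n 0) n c)%:E <=
   P [set w | enlarge D eps (B w)] + (4 * n%:R * expR (- (n%:R * eps ^+ 2 / 9)))%:E)%E.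
Proof.
move=> n0 eps0 vle; have nR : 0 < n%:R :> R by rewrite ltr0n.
set e := 33 / 100 * eps in vle *; set dl := 1 / 400 * eps.
have e0 : 0 <= e by rewrite mulr_ge0 ?(ltW eps0)//; lra.
have dl0 : 0 < dl by rewrite /dl; move: eps0; lra.
have ed0 : 0 <= 2 * e + dl by apply: addr_ge0; [exact: mulr_ge0|exact: ltW].
(* The whole distance budget: [0.66] for shift and tolerance, [1 / 3] for the bridges and two slacks
   of [1 / 400] stay below [1]. *)
have tot : (1 / 3 + 1 / 400) * eps + (2 * e + dl) < eps by rewrite /e /dl; move: eps0; lra.
clearbody e dl.
have mBt x : measurable_fun setT (fun w => B w (unit_pt x)) by exact: wiener_measurable hB _.
pose tau (i : nat) : R := i%:R / n%:R.
pose Y i w := B w (unit_pt (tau i.+1)) - B w (unit_pt (tau i)).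
have mY i : measurable_fun setT (Y i) by exact: measurable_funB.
have ninv : 0 < n%:R^-1 :> R by rewrite invr_gt0.
have t01 i : (i <= n)%N -> 0 <= tau i <= 1.
  by move=> im; rewrite /tau divr_ge0//= ler_pdivrMr// mul1r ler_nat.
have gs : gauss_steps P n (Num.sqrt n%:R)^-1 Y.
  rewrite -sqrtrV ?(ltW nR)//; apply: (wiener_gauss_steps hB) => // i im.
  by rewrite /tau -mulrBl -natr1 addrC addKr mul1r.
have s0 : 0 < (Num.sqrt n%:R)^-1 :> R by rewrite invr_gt0 sqrtr_gt0.
set Psi := relaxed_indic _ _ _ _ _.
have PL : pathlip n dl^-1 Psi by exact: relaxed_indic_pathlip.
have PU c' : 0 <= Psi c' <= 1 by exact: relaxed_indic_unit.
rewrite -(expectation_walk mY c gs PL PU).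
(* Under [a + b / (2 n) = eps / 3] the exponent [2 b a] is largest for [a = eps / 6] and
   [b = n eps / 3], with value [n eps^2 / 9]; the additional terms absorb the width of the ramp. *)
pose a := eps / 6 + 1 / 800 * eps; pose b := n%:R * (eps / 3 + 1 / 400 * eps).
pose L := a + b / n%:R / 2.
have LE : L = (1 / 3 + 1 / 400) * eps by rewrite /L /a /b; field; rewrite gt_eqF.
pose Bad k := wide_bridge B n k L.
have a0 : 0 < a by rewrite /a; move: eps0; lra.
have b0 : 0 <= b by apply: mulr_ge0; [exact: ltW|move: eps0; lra].
have hBad k : (k < n)%N -> measurable (Bad k) /\
    (P (Bad k) <= (4 * expR (- (n%:R * eps ^+ 2 / 9)))%:E)%E.
  move=> kn; have dl'0 : 0 < 1 / 800 * eps by move: eps0; lra.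
  have [h1 h2] := wide_bridge_prob hB kn dl'0 a0 b0; split => //; apply: le_trans h2 _.
  rewrite lee_fin ler_pM2l// ler_expR lerN2 /a /b.
  have q : 0 <= n%:R * eps ^+ 2 by rewrite mulr_ge0 ?sqr_ge0// ltW.
  have -> : 2 * (n%:R * (eps / 3 + 1 / 400 * eps)) * (eps / 6 + 1 / 800 * eps - 1 / 800 * eps) =
    (1 / 3 + 1 / 400) / 3 * (n%:R * eps ^+ 2) by field.
  by lra.
have /(wiener_start hB)[N [mN PN0 hN]] : set_val (unit_pt (0 : R)) = 0.
  by rewrite set_val_unit_pt// lexx ler01.
set G := [set w | enlarge D eps (B w)].
have mG : measurable G by apply: measurable_enlarge; exact: wiener_measurable hB.
set U := \big[setU/set0]_(k < n) Bad k.
have mU : measurable U by apply: bigsetU_measurable => k _; exact: (hBad k (ltn_ord k)).1.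
have PU' : (P U <= (4 * n%:R * expR (- (n%:R * eps ^+ 2 / 9)))%:E)%E.
  apply: le_trans (Boole_inequality P (fun k kn => (hBad k kn).1)) _.
  apply: (@le_trans _ _ (\sum_(k < n) (4 * expR (- (n%:R * eps ^+ 2 / 9)))%:E)%E).
    by apply: lee_sum => k _; exact: (hBad k (ltn_ord k)).2.
  by rewrite sumEFin lee_fin sumr_const card_ord -[leLHS]mulr_natr [leRHS]mulrAC lexx.
have mA : measurable (G `|` (U `|` N)) by apply: measurableU => //; exact: measurableU.
apply: (@le_trans _ _ (P (G `|` (U `|` N)))); last first.
  apply: le_trans (measureU2 P mG (measurableU _ _ mU mN)) _; apply: leeD => //.
  apply: le_trans (measureU2 P mU mN) _; rewrite -[leRHS]adde0; apply: leeD => //.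
  by rewrite [leLHS]PN0.
have -> : P (G `|` (U `|` N)) = (\int[P]_w (\1_(G `|` (U `|` N)) w)%:E)%E.
  by rewrite integral_indic// setIT.
apply: ge0_le_integral => //.
- by move=> w _; have /andP[] := PU (walk_from n Y n c w); rewrite lee_fin.
- by apply/measurable_EFinP; apply: (measurable_Phi_walk mY PL).
- by apply/measurable_EFinP; exact: measurable_indic.
move=> w _; rewrite lee_fin indicE; case: (boolP (w \in _)) => [_|/negP nA].
  by have /andP[] := PU (walk_from n Y n c w).
rewrite leNgt; apply/negP => /(relaxed_indic_gt0 dl0)[y [z Dz yz] hy]; apply: nA.
rewrite inE.
have [hU|nU] := pselect (U w); first by right; left.
have [hNw|nN] := pselect (N w); first by right; right.
left; exists (broken_line n z) => //.
pose g t := B w (unit_pt t); pose bf := broken_line_fun n z.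
have g0 : g 0 = 0 by apply: contrapT => h; apply: nN; exact: hN.
have node j : (j <= n)%N -> `|g (tau j) - bf (tau j)| <= 2 * e + dl.
  move=> jn; rewrite /bf broken_line_node//.
  case: j jn => [|j] jn.
    by rewrite /tau mul0r g0 big_ord0 mulr0 subrr normr0.
  have := hy j jn; rewrite walk_fromE// subnn/= big_mkord yz.
  have -> : \sum_(i < j.+1) Y i w = g (tau j.+1).
    rewrite -(big_mkord xpredT (fun i => Y i w)).
    by rewrite (telescope_sumr (fun i => g (tau i)))// /tau mul0r g0 subr0.
  move: vle; set x := g _; set x' := _ * _; rewrite ler_norml ltr_norml ler_norml => /andP[? ?] /andP[? ?].
  by apply/andP; split; lra.
apply: (@le_lt_trans _ _ (L + (2 * e + dl))); last by rewrite LE.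
apply: unif_dist_le => t t01'.
have -> : broken_line n z (unit_pt t) = bf t by rewrite /bf -{2}(set_val_unit_pt t01').
rewrite -/(g t); have [k [u [kn u01 ->]]] := unit_decomp n0 t01'.
rewrite /bf broken_line_interp// -/bf.
have hdev : `|bridge_dev n k g u| <= L.
  apply: bridge_dev_le => //; first exact: (@continuous_pt _ (B w)).
  move=> q j jq; rewrite leNgt; apply/negP => h; apply: nU; rewrite /U -bigcup_mkord.
  by exists k => //; exists q, j; split => //; exact: ltW.
have h1 := node k (ltnW kn); have h2 := node k.+1 kn.
rewrite /tau in h1 h2; move: h1 h2 hdev; rewrite /bridge_dev.
move: (g (_ + _)) (g (k%:R / _)) (g (k.+1%:R / _)) (bf (k%:R / _)) (bf (k.+1%:R / _)).
move=> x0 x1 x2 y1 y2 h1 h2 h3.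
have -> : x0 - (y1 + u * (y2 - y1)) =
  (x0 - x1 - u * (x2 - x1)) + ((1 - u) * (x1 - y1) + u * (x2 - y2)) by ring.
apply: le_trans (ler_normD _ _) _; apply: lerD => //.
apply: le_trans (ler_normD _ _) _; have /andP[u0 u1] := u01.
rewrite !normrM (ger0_norm u0) (@ger0_norm _ (1 - u)) ?subr_ge0//.
have -> : 2 * e + dl = (1 - u) * (2 * e + dl) + u * (2 * e + dl) by ring.
by apply: lerD; rewrite ler_wpM2l// subr_ge0.
Qed.

End wiener_upper_bound.

(** * Sublinear expectations *)

Section sublinear_facts.
Context {R : realType} {Omega : Type}.
Variables (H : set (Omega -> R)) (E : (Omega -> R) -> R).
Hypothesis hE : sublinear_expectation H E.
Implicit Types (Y Z : Omega -> R).

Lemma sle_oppH Y : H Y -> H (fun w => - Y w).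
Proof.
move=> hY; rewrite (_ : (fun w => - Y w) = (fun w => -1 * Y w)); first exact: sle_scaleH hE _ _ hY.
by apply/funext => w; rewrite mulN1r.
Qed.

Lemma sle_addcH Y c : H Y -> H (fun w => Y w + c).
Proof. by move=> hY; apply: (sle_addH hE) => //; exact: sle_cstH hE c. Qed.

Lemma sle_addc Y c : H Y -> E (fun w => Y w + c) = E Y + c.
Proof.
move=> hY; apply/eqP; rewrite eq_le; apply/andP; split.
  by have := sle_subadd hE hY (sle_cstH hE c); rewrite (sle_cst hE).
have := sle_subadd hE (sle_addcH c hY) (sle_cstH hE (- c)).
rewrite (sle_cst hE) (_ : (fun w => Y w + c + - c) = Y); last by apply/funext => w; rewrite addrK.
lra.
Qed.

Lemma sle_lower_le Y : H Y -> lower_exp E Y <= E Y.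
Proof.
move=> hY; have := sle_subadd hE hY (sle_oppH hY).
rewrite (_ : (fun w => Y w + - Y w) = (fun=> 0)); last by apply/funext => w; rewrite subrr.
rewrite (sle_cst hE) /lower_exp; lra.
Qed.

Lemma sle_scale_ge0 (a : R) Y : 0 <= a -> H Y -> E (fun w => a * Y w) = a * E Y.
Proof. by move=> a0 hY; exact: (sle_pos_homo hE). Qed.

Lemma sle_scale_le0 (a : R) Y : a <= 0 -> H Y -> E (fun w => a * Y w) = a * lower_exp E Y.
Proof.
move=> a0 hY; rewrite (_ : (fun w => a * Y w) = (fun w => (- a) * (- Y w))); last first.
  by apply/funext => w; rewrite mulrNN.
by rewrite (sle_pos_homo hE) ?oppr_ge0//; [rewrite /lower_exp mulrN mulNr|exact: sle_oppH].
Qed.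

Lemma ext_exp_le Y Z : H Z -> (forall w, Y w <= Z w) -> (ext_exp H E Y <= (E Z)%:E)%E.
Proof. by move=> hZ YZ; apply: ereal_inf_lbound; exists Z. Qed.

Lemma ext_exp_ge Y r : (forall Z, H Z -> (forall w, Y w <= Z w) -> r <= E Z) ->
  (r%:E <= ext_exp H E Y)%E.
Proof. by move=> h; apply: le_ereal_inf_tmp => _ [Z [hZ YZ] <-]; rewrite lee_fin; exact: h. Qed.

Variable X0 : Omega -> R.
Hypotheses (hX0 : H X0) (hX0sq : H (fun w => X0 w ^+ 2)).

(** Subadditivity gives a Lipschitz bound from the upper and lower means of [X0]. The variances of
    [X0 - m] reduce to this case up to a polynomial in [m]. *)
Let quad_lip Z : H Z ->
  continuous (fun m : R => E (fun w => Z w + m * X0 w)).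
Proof.
move=> hZ; set K := `|E X0| + `|lower_exp E X0|.
have hc m : H (fun w => Z w + m * X0 w) by apply: (sle_addH hE) => //; exact: sle_scaleH hE _ _ hX0.
have le m m' : E (fun w => Z w + m * X0 w) <= E (fun w => Z w + m' * X0 w) + K * `|m - m'|.
  have := sle_subadd hE (hc m') (sle_scaleH hE (m - m') hX0).
  rewrite (_ : (fun w => Z w + m' * X0 w + (m - m') * X0 w) = (fun w => Z w + m * X0 w)); last first.
    by apply/funext => w; ring.
  move=> h; apply: le_trans h _; rewrite lerD2l.
  have n1 := ler_norm (E X0); have n2 := ler_norm (- lower_exp E X0); rewrite normrN in n2.
  have n3 := normr_ge0 (E X0); have n4 := normr_ge0 (lower_exp E X0).
  have [h|h] := leP 0 (m - m').
    rewrite sle_scale_ge0// ger0_norm// mulrC ler_wpM2r// /K; lra.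
  rewrite sle_scale_le0 ?(ltW h)// ltr0_norm// -[leLHS]mulrNN mulrC ler_wpM2r ?oppr_ge0 ?(ltW h)// /K; lra.
apply: (@lipschitz_continuous _ K) => m m'.
have h1 := le m m'; have := le m' m; rewrite distrC; rewrite ler_norml; lra.
Qed.

Lemma sqdevH m : H (fun w => (X0 w - m) ^+ 2).
Proof.
rewrite (_ : (fun w => _) = (fun w => (X0 w ^+ 2 + (- (2 * m)) * X0 w) + m ^+ 2)).
  by apply: sle_addcH; apply: (sle_addH hE) => //; exact: sle_scaleH hE _ _ hX0.
by apply/funext => w; ring.
Qed.

Lemma devH m : H (fun w => X0 w - m).
Proof. exact: sle_addcH. Qed.

Lemma mu_lo_le_hi : mu_lo E X0 <= mu_hi E X0.
Proof. exact: sle_lower_le. Qed.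

Lemma lower_dev m : lower_exp E (fun w => X0 w - m) = mu_lo E X0 - m.
Proof.
rewrite /lower_exp (_ : (fun w => - _) = (fun w => - X0 w + m)); last by apply/funext => w; ring.
by rewrite sle_addc; [rewrite /mu_lo /lower_exp; ring|exact: sle_oppH].
Qed.

Lemma sigma_hi_sqr m : sigma_hi E X0 m ^+ 2 = E (fun w => (X0 w - m) ^+ 2).
Proof.
rewrite sqr_sqrtr// -(sle_cst hE 0); apply: (sle_mono hE); first exact: sle_cstH hE 0.
  exact: sqdevH.
by move=> w; exact: sqr_ge0.
Qed.

Lemma sigma_lo_sqr m : sigma_lo E X0 m ^+ 2 = lower_exp E (fun w => (X0 w - m) ^+ 2).
Proof.
rewrite sqr_sqrtr// /lower_exp oppr_ge0 -(sle_cst hE 0); apply: (sle_mono hE).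
- by apply: sle_oppH; exact: sqdevH.
- exact: sle_cstH hE 0.
- by move=> w; rewrite oppr_le0 sqr_ge0.
Qed.

Lemma sigma_lo_le_hi m : sigma_lo E X0 m <= sigma_hi E X0 m.
Proof. by rewrite ler_wsqrtr// sle_lower_le//; exact: sqdevH. Qed.

Lemma continuous_sigma_hi : continuous (sigma_hi E X0).
Proof.
move=> m; apply: (@continuous_comp R R R (fun m => E (fun w => (X0 w - m) ^+ 2)) Num.sqrt m);
  last exact: sqrt_continuous.
rewrite (_ : (fun m => _) = (fun m : R => E (fun w => X0 w ^+ 2 + (-2 * m) * X0 w) + m ^+ 2)).
  apply: cvgD; last exact: exprn_continuous.
  apply: (@continuous_comp R R R (fun m => -2 * m) (fun m => E (fun w => X0 w ^+ 2 + m * X0 w)) m).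
    by apply: cvgM; [exact: cvg_cst|exact: cvg_id].
  exact: quad_lip.
apply/funext => x; rewrite -sle_addc; last by apply: (sle_addH hE) => //; exact: sle_scaleH hE _ _ hX0.
by congr E; apply/funext => w; ring.
Qed.

Lemma continuous_sigma_lo : continuous (sigma_lo E X0).
Proof.
move=> m; apply: (@continuous_comp R R R (fun m => lower_exp E (fun w => (X0 w - m) ^+ 2)) Num.sqrt m);
  last exact: sqrt_continuous.
rewrite (_ : (fun m => _) = (fun m : R => - (E (fun w => - X0 w ^+ 2 + (2 * m) * X0 w) - m ^+ 2))).
  apply: cvgN; apply: cvgB; last exact: exprn_continuous.
  apply: (@continuous_comp R R R (fun m => 2 * m) (fun m => E (fun w => - X0 w ^+ 2 + m * X0 w)) m).
    by apply: cvgM; [exact: cvg_cst|exact: cvg_id].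
  by apply: quad_lip; exact: sle_oppH.
apply/funext => x; rewrite /lower_exp -sle_addc; last first.
  by apply: (sle_addH hE); [exact: sle_oppH|exact: sle_scaleH hE _ _ hX0].
by congr (- E _); apply/funext => w; ring.
Qed.

(** The Taylor majorant lies in [H] even if [phi (X0)] is not known to; subadditivity then treats
    its linear, quadratic and remainder terms separately. *)
Lemma ext_exp_taylor (m sg s c0 c1 c2 kap e1 e2 : R) (phi : R -> R) Y : H Y -> 0 < sg -> 0 <= kap ->
  (forall y w, X0 w = y ->
     phi y <= c0 + c1 * (s * ((y - m) / sg)) + c2 * ((s * ((y - m) / sg)) ^+ 2 / 2) + kap * Y w) ->
  E (fun w => (s / sg * c1) * (X0 w - m)) <= e1 ->
  E (fun w => (s ^+ 2 / 2 * c2 / sg ^+ 2) * (X0 w - m) ^+ 2) <= e2 ->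
  (ext_exp H E (fun w => phi (X0 w)) <= (c0 + e1 + e2 + kap * E Y)%:E)%E.
Proof.
move=> hY sg0 k0 h h1 h2.
set A := (fun w => _) in h1; set B := (fun w => _) in h2.
have hA : H A by exact: sle_scaleH hE _ _ (devH m).
have hB : H B by exact: sle_scaleH hE _ _ (sqdevH m).
have hkY : H (fun w => kap * Y w) by exact: sle_scaleH hE _ _ hY.
have hBk := sle_addH hE hB hkY; have hABk := sle_addH hE hA hBk.
apply: le_trans (ext_exp_le (sle_addcH c0 hABk) _) _.
  move=> w; apply: le_trans (h _ w erefl) _; rewrite le_eqVlt; apply/orP; left; apply/eqP.
  by rewrite /A /B; field; rewrite gt_eqF.
rewrite lee_fin (sle_addc _ hABk).
have := sle_subadd hE hA hBk; have := sle_subadd hE hB hkY; rewrite sle_scale_ge0//.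
lra.
Qed.

(** The Heaviside function made continuous on [[- dl / 2, dl / 2]], since the choices must depend
    continuously on the past. *)
Definition slide (dl x : R) : R := ramp dl (x - dl / 2).

Lemma slide_unit dl x : 0 <= slide dl x <= 1.
Proof. exact: ramp_unit. Qed.

Lemma slide1 dl x : 0 < dl -> dl / 2 <= x -> slide dl x = 1.
Proof.
move=> dl0 hx; rewrite /slide /ramp min_l// le_max; apply/orP; right.
by rewrite lerDl divr_ge0 ?(ltW dl0)// subr_ge0.
Qed.

Lemma slide0 dl x : 0 < dl -> x <= - (dl / 2) -> slide dl x = 0.
Proof.
move=> dl0 hx; rewrite /slide /ramp max_l ?min_r//.
have -> : 1 + (x - dl / 2) / dl = (x + dl / 2) / dl by field; rewrite gt_eqF.
by rewrite pmulr_lle0 ?invr_gt0//; lra.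
Qed.

Lemma continuous_slide dl : 0 < dl -> continuous (slide dl).
Proof.
move=> dl0; apply: (@lipschitz_continuous _ dl^-1) => x y.
by apply: le_trans (ramp_lip dl0 _ _) _; rewrite opprB addrA subrK.
Qed.

Definition mean_choice (dl x : R) : R :=
  mu_lo E X0 + (mu_hi E X0 - mu_lo E X0) * slide dl x.

Definition dev_choice (dl m x : R) : R :=
  sigma_lo E X0 m + (sigma_hi E X0 m - sigma_lo E X0 m) * slide dl x.

Lemma mean_choice_itv dl x : mu_lo E X0 <= mean_choice dl x <= mu_hi E X0.
Proof.
have /andP[h0 h1] := slide_unit dl x; have h := mu_lo_le_hi.
have h2 : 0 <= mu_hi E X0 - mu_lo E X0 by rewrite subr_ge0.
have := ler_wpM2l h2 h1; have := mulr_ge0 h2 h0; rewrite /mean_choice mulr1; lra.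
Qed.

Lemma dev_choice_itv dl m x :
  sigma_lo E X0 m <= dev_choice dl m x <= sigma_hi E X0 m.
Proof.
have /andP[h0 h1] := slide_unit dl x; have h := sigma_lo_le_hi m.
have h2 : 0 <= sigma_hi E X0 m - sigma_lo E X0 m by rewrite subr_ge0.
have := ler_wpM2l h2 h1; have := mulr_ge0 h2 h0; rewrite /dev_choice mulr1; lra.
Qed.

(** Outside the transition zone the term vanishes: a positive coefficient meets
    [E (X0 - mu_hi) = 0], a negative one the lower expectation of [X0 - mu_lo]. Inside, the
    coefficient itself is small. *)
Lemma mean_choice_le (dl r x : R) : 0 < dl -> 0 <= r ->
  E (fun w => (r * x) * (X0 w - mean_choice dl x)) <= r * dl * (mu_hi E X0 - mu_lo E X0).
Proof.
move=> dl0 r0; set m := mean_choice dl x; have h := mu_lo_le_hi.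
have /andP[m0 m1] : mu_lo E X0 <= m <= mu_hi E X0 by exact: mean_choice_itv.
have D0 : 0 <= mu_hi E X0 - mu_lo E X0 by rewrite subr_ge0.
have rd : 0 <= r * dl * (mu_hi E X0 - mu_lo E X0) by rewrite !mulr_ge0// ltW.
have [x0|x0] := leP 0 x.
  rewrite sle_scale_ge0 ?mulr_ge0//; last exact: devH.
  rewrite sle_addc// -/(mu_hi E X0).
  have [hx|hx] := leP (dl / 2) x; first by rewrite /m /mean_choice slide1// mulr1 subrKC subrr mulr0.
  by rewrite -!mulrA ler_wpM2l// ler_pM//; lra.
rewrite sle_scale_le0 ?mulr_ge0_le0 ?(ltW x0)//; last exact: devH.
rewrite lower_dev.
have [hx|hx] := leP x (- (dl / 2)); first by rewrite /m /mean_choice slide0// mulr0 addr0 subrr mulr0.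
rewrite -!mulrA ler_wpM2l// -mulrNN ler_pM//; lra.
Qed.

(** Outside the transition zone the normalised second moment is exactly one: the upper moment goes
    with [sigma_hi], the lower one with [sigma_lo]. Inside, [x] is small and a ratio of deviations
    is at most [sh / sl]. *)
Lemma dev_choice_le (dl r x m sl sh : R) : 0 < dl -> 0 <= r -> 0 < sl -> sl <= sigma_lo E X0 m ->
  sigma_hi E X0 m <= sh ->
  E (fun w => (r * x / dev_choice dl m x ^+ 2) * (X0 w - m) ^+ 2) <=
  r * x + r * dl * (1 + (sh / sl) ^+ 2).
Proof.
move=> dl0 r0 sl0 hl hh; have /andP[d0 d1] := dev_choice_itv dl m x.
set sg := dev_choice dl m x in d0 d1 *.
have sg0 : 0 < sg by lra.
have lo0 : 0 < sigma_lo E X0 m by lra.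
have hi0 : 0 < sigma_hi E X0 m by lra.
have sg2 : 0 < sg ^+ 2 by rewrite exprn_gt0.
have Q0 : 0 <= (sh / sl) ^+ 2 by exact: sqr_ge0.
have rd : 0 <= r * dl by rewrite mulr_ge0// ltW.
have rdQ : 0 <= r * dl * (sh / sl) ^+ 2 by rewrite mulr_ge0.
have [x0|x0] := leP 0 x.
  rewrite sle_scale_ge0; last exact: sqdevH.
    rewrite -sigma_hi_sqr.
    have [hx|hx] := leP (dl / 2) x.
      by rewrite /sg /dev_choice slide1// mulr1 subrKC divfK ?gt_eqF ?exprn_gt0//; lra.
    have rx : 0 <= r * x by rewrite mulr_ge0.
    apply: (@le_trans _ _ (r * dl * (sh / sl) ^+ 2)); last by lra.
    rewrite -[X in X <= _]mulrA [X in _ * X]mulrC -expr_div_n; apply: ler_pM => //.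
    - exact: sqr_ge0.
    - by rewrite ler_wpM2l//; lra.
    - rewrite ler_sqr ?nnegrE ?divr_ge0//; try lra.
      by rewrite ler_pM ?invr_ge0 ?lef_pV2 ?posrE//; lra.
  by rewrite divr_ge0 ?mulr_ge0// ltW.
rewrite sle_scale_le0; last exact: sqdevH.
  rewrite -sigma_lo_sqr.
  have [hx|hx] := leP x (- (dl / 2)).
    by rewrite /sg /dev_choice slide0// mulr0 addr0 divfK ?gt_eqF ?exprn_gt0//; lra.
  apply: (@le_trans _ _ 0).
    rewrite mulr_le0_ge0 ?sqr_ge0// mulr_le0_ge0 ?invr_ge0 ?(ltW sg2)//.
    by rewrite mulr_ge0_le0// ltW.
  have : 0 <= r * (x + dl) by rewrite mulr_ge0//; lra.
  lra.
rewrite mulr_le0_ge0 ?invr_ge0 ?(ltW sg2)//.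
by rewrite mulr_ge0_le0// ltW.
Qed.

End sublinear_facts.

(** * The normalizing strategy *)

Section joint_lipschitz.
Context {R : realType}.
Variable n : nat.
Implicit Types (c : nat -> R) (K : (nat -> R) -> R -> R).

(** The free argument [v] is the position being averaged while the recorded path [c] stays fixed;
    the joint bound survives averaging in [v] and the later substitution [v = c k]. *)
Definition jointlip (L : R) K := forall c c' v v',
  `|K c v - K c' v'| <= L * (pathdist n c c' + `|v - v'|).

Lemma pathdist_refl c : pathdist n c c = 0.
Proof. by rewrite /pathdist big1// => i _; rewrite subrr normr0. Qed.

Lemma jointlip_lip L K c x y : jointlip L K -> `|K c x - K c y| <= L * `|x - y|.
Proof. by move=> /(_ c c x y); rewrite pathdist_refl add0r. Qed.

Lemma jointlip_ge0 L K : jointlip L K -> 0 <= L.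
Proof.
move=> /(_ (fun=> 0) (fun=> 0) 1 0); rewrite pathdist_refl add0r subr0 normr1 mulr1.
exact: le_trans.
Qed.

Lemma jointlip_continuous L K c : jointlip L K -> continuous (K c).
Proof. by move=> hK; apply: lipschitz_continuous => x y; exact: jointlip_lip hK. Qed.

Lemma jointlip_window L K a : 0 < a -> jointlip L K ->
  jointlip L (fun c v => window_avg a (K c) v).
Proof.
move=> a0 hK c c' v v'.
have [t _ ->] := window_avg_sub v v' a0 (@jointlip_continuous L K c hK) (@jointlip_continuous L K c' hK).
by apply: le_trans (hK _ _ _ _) _; rewrite opprD addrACA subrr addr0.
Qed.

Lemma jointlip_gmean L K s : jointlip L K -> (forall c v, 0 <= K c v <= 1) ->
  jointlip L (fun c v => gmean s (fun z => K c (v + z))).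
Proof.
move=> hK K01 c c' v v'.
have int c1 x : gauss_integrable s (fun z => K c1 (x + z)).
  by apply: (@integrable_gauss_shift _ s (K c1) L) => // y z; exact: jointlip_lip hK.
apply: gmean_dist => // z; apply: le_trans (hK _ _ _ _) _.
by rewrite opprD addrACA subrr addr0.
Qed.

Lemma jointlip_lincomb L1 L2 K1 K2 (p q x y : R) : jointlip L1 K1 -> jointlip L2 K2 ->
  jointlip (`|p| * L1 + `|q| * L2) (fun c v => p * K1 c (v + x) + q * K2 c (v + y)).
Proof.
move=> h1 h2 c c' v v'.
have -> : p * K1 c (v + x) + q * K2 c (v + y) - (p * K1 c' (v' + x) + q * K2 c' (v' + y)) =
  p * (K1 c (v + x) - K1 c' (v' + x)) + q * (K2 c (v + y) - K2 c' (v' + y)) by ring.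
apply: le_trans (ler_normD _ _) _; rewrite !normrM mulrDl -!mulrA; apply: lerD; rewrite ler_wpM2l//.
  by apply: le_trans (h1 _ _ _ _) _; rewrite opprD addrACA subrr addr0.
by apply: le_trans (h2 _ _ _ _) _; rewrite opprD addrACA subrr addr0.
Qed.

Lemma jointlip_diag L K k : jointlip L K -> (k <= n)%N -> pathlip n (L * 2) (fun c => K c (c k)).
Proof.
move=> hK kn c c'; apply: le_trans (hK _ _ _ _) _; rewrite -mulrA ler_wpM2l ?(jointlip_ge0 hK)//.
have := pathdist_coord c c' kn; lra.
Qed.

End joint_lipschitz.

Section stages.
Context {R : realType}.
Variables (D : set (nat -> R)) (a dl s : R) (n : nat).
Hypotheses (a0 : 0 < a) (dl0 : 0 < dl) (s0 : 0 < s).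
Implicit Types (c : nat -> R).

(** Step [k + 1] has led to [v], Gaussian steps follow, and the tolerance is open from node [k + 1]
    on. Its triple average is the smooth function whose Taylor expansion compares the two kinds of
    steps. *)
Definition tail_mean (k : nat) c (v : R) : R :=
  wexp s n (relaxed_indic D (3 * a) dl n k) (n - k.+1) (upd c k.+1 v).

(* The value of the target after [k] steps of the game, when all remaining steps are Gaussian. *)
Definition stage (k : nat) c : R :=
  if (k < n)%N then smooth3 a (fun v => gmean s (fun z => tail_mean k c (v + z))) (c k)
  else relaxed_indic D (3 * a) dl n n c.

Let e0 : 0 <= 3 * a. Proof. by rewrite mulr_ge0// ltW. Qed.

Let PL k := @relaxed_indic_pathlip R D (3 * a) dl n dl0 k.
Let PU k := @relaxed_indic_unit R D (3 * a) dl n dl0 k.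

Let WL k := wexp_pathlip_unit s (PL k) (PU k) (leq_subr k.+1 n).

Lemma tail_mean_unit k c v : 0 <= tail_mean k c v <= 1.
Proof. exact: (WL k).2. Qed.

Lemma tail_mean_jointlip k : exists L, jointlip n L (tail_mean k).
Proof.
exists (2 ^+ (n - k.+1) * dl^-1) => c c' v v'; apply: le_trans ((WL k).1 _ _) _.
rewrite ler_wpM2l ?pathdist_upd// mulr_ge0 ?exprn_ge0// invr_ge0 ltW//.
Qed.

Lemma tail_mean_lip k c : exists L, forall x y, `|tail_mean k c x - tail_mean k c y| <= L * `|x - y|.
Proof. by have [L hL] := tail_mean_jointlip k; exists L => x y; exact: jointlip_lip hL. Qed.

Lemma tail_mean_upd k c x : tail_mean k (upd c k.+1 x) = tail_mean k c.
Proof.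
apply/funext => v; congr wexp; apply/funext => i; rewrite /upd.
by case: (i == k.+1).
Qed.

Let gtail_jointlip k : exists L, jointlip n L (fun c v => gmean s (fun z => tail_mean k c (v + z))).
Proof.
by have [L hL] := tail_mean_jointlip k; exists L; apply: jointlip_gmean => // c v; exact: tail_mean_unit.
Qed.

Let gtail_unit k c v : 0 <= gmean s (fun z => tail_mean k c (v + z)) <= 1.
Proof.
apply: gmean_unit => [|z]; last exact: tail_mean_unit.
have [L hL] := tail_mean_lip k c; apply: (@lipschitz_continuous _ L) => x y.
by apply: le_trans (hL _ _) _; rewrite opprD addrACA subrr add0r.
Qed.

Let jointlip_smooth3 L K : jointlip n L K -> jointlip n L (fun c v => smooth3 a (K c) v).
Proof. by move=> hK; do 3 apply: jointlip_window => //. Qed.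

Lemma stage_unit k c : 0 <= stage k c <= 1.
Proof.
rewrite /stage; case: ifP => _; last exact: PU.
have [L hL] := gtail_jointlip k.
by apply: (@smooth3_unit _ a L) => // x y; exact: jointlip_lip hL.
Qed.

Lemma stage_pathlip k : (k <= n)%N -> exists L, pathlip n L (stage k).
Proof.
move=> kn; have -> : stage k = if (k < n)%N then
    (fun c => smooth3 a (fun v => gmean s (fun z => tail_mean k c (v + z))) (c k))
  else relaxed_indic D (3 * a) dl n n by apply/funext => c; rewrite /stage; case: ifP.
case: ifP => _; last by exists dl^-1; exact: PL.
have [L hL] := gtail_jointlip k; exists (L * 2).
exact: (jointlip_diag (jointlip_smooth3 hL) kn).
Qed.

Lemma stage_d1_pathlip k : (k <= n)%N ->
  exists L, pathlip n L (fun c => smooth3_d1 a (tail_mean k c) (c k)).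
Proof.
move=> kn; have [L hL] := tail_mean_jointlip k.
have h2 := jointlip_window a0 (jointlip_window a0 hL).
have := jointlip_lincomb (2 * a)^-1 (- (2 * a)^-1) a (- a) h2 h2.
set L' := (X in jointlip n X _) => h; exists (L' * 2).
have := jointlip_diag h kn; congr (pathlip _ _ _); apply/funext => c.
by rewrite /smooth3_d1 mulNr -mulrBr mulrC.
Qed.

Lemma stage_d2_pathlip k : (k <= n)%N ->
  exists L, pathlip n L (fun c => smooth3_d2 a (tail_mean k c) (c k)).
Proof.
move=> kn; have [L hL] := tail_mean_jointlip k.
have h1 := jointlip_window a0 hL.
have h := jointlip_lincomb ((2 * a) ^+ 2)^-1 (-2 / (2 * a) ^+ 2) (2 * a) 0 h1 h1.
have := jointlip_lincomb 1 ((2 * a) ^+ 2)^-1 0 (- (2 * a)) h h1.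
set L' := (X in jointlip n X _) => h'; exists (L' * 2).
have := jointlip_diag h' kn; congr (pathlip _ _ _); apply/funext => c.
rewrite /smooth3_d2 !addr0; field; by rewrite gt_eqF.
Qed.

(** On the left, averaging shifts the point from which the walk continues but not the recorded node
    [k + 1]; on the right both are shifted. The tolerance at this node, open only on the right, pays
    for the difference. *)
Lemma stage_succ_le k c : (k < n)%N -> stage k.+1 c <= smooth3 a (tail_mean k c) (c k.+1).
Proof.
move=> kn; have [L hL] := tail_mean_lip k c.
rewrite /stage; have [k1n|nk] := ltnP k.+1 n; last first.
  have [t ht ->] := smooth3_between a0 hL (c k.+1).
  have nE : n = k.+1 by apply/eqP; rewrite eqn_leq nk.
  rewrite /tail_mean (congr1 (relaxed_indic D (3 * a) dl n) nE) (_ : (n - k.+1)%N = 0%N) /=; last first.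
    by apply/eqP; rewrite subn_eq0.
  apply: relaxed_indic_upd => //.
  by rewrite addrAC subrr add0r.
have [L1 hL1] := gtail_jointlip k.+1.
have c1 := @jointlip_continuous _ _ _ _ c hL1; have c2 := lipschitz_continuous hL.
have [t ht E] := smooth3_sub a0 c1 c2 (c k.+1) (c k.+1).
rewrite -subr_le0 E subr_le0; set v := c k.+1 + t.
have rE : (n - k.+1)%N = (n - k.+2).+1 by rewrite subnSK.
have nr : (n - (n - k.+2).+1)%N = k.+1 by rewrite -rE subKn.
have rn : (n - k.+2 <= n)%N by exact: leq_subr.
rewrite [leRHS]/tail_mean rE wexpS nr upd_same -[leRHS]addr0.
have int j c' : gauss_integrable s
    (fun z => wexp s n (relaxed_indic D (3 * a) dl n j) (n - k.+2) (upd c' k.+2 (v + z))).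
  have [wL w01] := wexp_pathlip_unit s (PL j) (PU j) rn.
  exact: integrable_step wL w01.
rewrite /tail_mean; apply: gmean_le_add => // z; rewrite addr0 updC; last by rewrite neq_ltn ltnSn.
apply: (@wexp_le_upd _ s n _ _ _ _ k.+1 (3 * a) (n - k.+2) (PL k.+1) (PL k) (PU k.+1) (PU k)) => //.
- by move=> c' v' hv; exact: relaxed_indic_upd.
- by rewrite subKn.
- by rewrite upd_other ?neq_ltn ?ltnSn// /v addrAC subrr add0r.
Qed.

(** Since smoothing commutes with the Gaussian mean, the stage value is the Gaussian mean of the
    smooth function that the actual step evaluates too. *)
Lemma stage_lower k c : (k < n)%N ->
  smooth3 a (tail_mean k c) (c k) + smooth3_d2 a (tail_mean k c) (c k) * s ^+ 2 / 2 -
  Num.min ((2 * a ^+ 3)^-1 * (321 / 200 * s ^+ 3) / 6) (a ^- 2 * s ^+ 2 / 2) <= stage k c.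
Proof.
move=> kn; have [L hL] := tail_mean_lip k c; have h01 := tail_mean_unit k c.
rewrite /stage kn (smooth3_gmean a0 hL h01).
apply: (@gmean_taylor _ s _ 1 _ (smooth3_d1 a (tail_mean k c) (c k))) => //.
- apply: (@lipschitz_continuous _ L) => x y.
  by apply: le_trans (smooth3_lipschitz a0 hL _ _) _; rewrite opprD addrACA subrr add0r.
- by move=> x; apply: norm_unit_le1; exact: smooth3_unit.
- by rewrite invr_ge0 mulr_ge0// exprn_ge0// ltW.
- by move=> u; exact: smooth3_taylor.
Qed.

(** The first average displaces the start by at most [3 * a]. The target does not test node [0], so
    the displaced start can be recorded without using any tolerance. *)
Lemma stage0_le : (0 < n)%N -> exists c, `|c 0%N| <= 3 * a /\
  stage 0 (fun=> 0) <= wexp s n (relaxed_indic D (3 * a) dl n 0) n c.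
Proof.
move=> n0; rewrite /stage n0.
have [L1 hL1] := gtail_jointlip 0.
have hL1' x y := jointlip_lip (fun=> 0) x y hL1.
have [t ht ->] := smooth3_between a0 hL1' 0.
exists (upd (fun=> 0) 0 t); rewrite upd_same; split => //.
rewrite -[X in _ <= wexp _ _ _ X _](prednK n0) wexpS prednK// subnn upd_same add0r -[leRHS]addr0.
have rn : (n.-1 <= n)%N by exact: leq_pred.
have [wL w01] := wexp_pathlip_unit s (PL 0) (PU 0) rn.
have int c' := integrable_step s c' 1 t wL w01.
rewrite /tail_mean subn1; apply: gmean_le_add => // z; rewrite addr0 updC//.
apply: (@wexp_le_upd _ s n _ _ _ _ 0%N `|t| n.-1 (PL 0) (PL 0) (PU 0) (PU 0)) => //.
- by rewrite -subn1 subKn.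
- by rewrite upd_other// subr0.
Qed.

End stages.

(** * Paths generated by a strategy *)

Section game_paths.
Context {R : realType}.
Variables (M S : nat -> (nat -> R) -> R) (s : R).
Implicit Types (x y c : nat -> R).

Fixpoint game_path x (k : nat) : nat -> R :=
  if k is k'.+1 then
    upd (game_path x k') k (game_path x k' k' +
      s * ((x k' - M k' (game_path x k')) / S k' (game_path x k')))
  else fun=> 0.

Lemma game_path_ext x y k : (forall j, (j < k)%N -> x j = y j) -> game_path x k = game_path y k.
Proof.
elim: k => [//|k IH] xy /=; rewrite IH ?xy// => j jk.
by apply: xy; exact: ltnW.
Qed.

Lemma game_path_sum x k j : (j <= k)%N ->
  game_path x k j = s * \sum_(i < j) ((x i - M i (game_path x i)) / S i (game_path x i)).
Proof.
elim: k j => [|k IH] j; first by rewrite leqn0 => /eqP ->; rewrite big_ord0 mulr0.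
rewrite leq_eqVlt => /predU1P[->|jk] /=.
  by rewrite upd_same IH// big_ord_recr/= mulrDr.
by rewrite upd_other ?ltn_eqF// IH.
Qed.

Lemma game_path_upd x k v : game_path (upd x k v) k.+1 =
  upd (game_path x k) k.+1 (game_path x k k +
    s * ((v - M k (game_path x k)) / S k (game_path x k))).
Proof.
rewrite /= upd_same (@game_path_ext (upd x k v) x)// => j jk.
by rewrite upd_other// ltn_eqF.
Qed.

(** Continuity is tested along families of paths over arbitrary spaces, which avoids a topology on
    sequences and applies directly to row vectors. *)
Definition path_continuous (F : (nat -> R) -> R) := forall (T : topologicalType) (p : T -> nat -> R),
  (forall j, continuous (fun t => p t j)) -> continuous (fun t => F (p t)).

Definition prefix_continuous (k : nat) (F : (nat -> R) -> R) :=
  forall (T : topologicalType) (p : T -> nat -> R),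
  (forall j, (j < k)%N -> continuous (fun t => p t j)) -> continuous (fun t => F (p t)).

Lemma pathlip_path_continuous n L F : pathlip n L F -> path_continuous F.
Proof. by move=> hF T p cp; apply: (pathlip_continuous hF) => j _; exact: cp. Qed.

Lemma path_continuous_comp (g : R -> R) F : continuous g -> path_continuous F ->
  path_continuous (fun c => g (F c)).
Proof.
by move=> cg cF T p cp t; apply: continuous_comp; [exact: (cF T p cp)|exact: cg].
Qed.

Lemma game_path_continuous k : (forall i, (i < k)%N -> path_continuous (M i)) ->
  (forall i, (i < k)%N -> path_continuous (S i)) -> (forall i c, (i < k)%N -> S i c != 0) ->
  forall j, prefix_continuous k (fun x => game_path x k j).
Proof.
move=> cM cS S0 j T p cp.
elim: k j cM cS S0 cp => [|k IH] j cM cS S0 cp; first exact: cst_continuous.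
have {}IH j' : continuous (fun t => game_path (p t) k j').
  by apply: IH => [i ik|i ik|i c ik|i ik]; [apply: cM|apply: cS|apply: S0|apply: cp]; exact: ltnW.
rewrite /= /upd; have [_|_] := eqVneq j k.+1; last exact: IH.
move=> t; apply: cvgD; first exact: IH.
apply: cvgM; first exact: cvg_cst.
apply: cvgM; first by apply: cvgB; [exact: cp|exact: (cM k _ T _ IH)].
by apply: cvgV; [exact: S0|exact: (cS k _ T _ IH)].
Qed.

Lemma path_prefix_continuous k F : (forall i, (i < k)%N -> path_continuous (M i)) ->
  (forall i, (i < k)%N -> path_continuous (S i)) -> (forall i c, (i < k)%N -> S i c != 0) ->
  path_continuous F -> prefix_continuous k (fun x => F (game_path x k)).
Proof.
by move=> cM cS S0 cF T p cp; apply: cF => j; exact: (game_path_continuous cM cS S0).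
Qed.

Definition row_path (k : nat) (r : 'rV[R]_k) (j : nat) : R :=
  if insub j is Some i then r 0 i else 0.

Lemma row_path_continuous k j : continuous (fun r : 'rV[R]_k => row_path r j).
Proof.
rewrite /row_path; case: insubP => [i _ _|_]; last exact: cst_continuous.
exact: coord_continuous.
Qed.

Lemma row_path_ord k (r : 'rV[R]_k) (i : 'I_k) : row_path r i = r 0 i.
Proof. by rewrite /row_path valK. Qed.

End game_paths.

(** * One backward step along an i.i.d. sequence *)

Section iid_sequences.
Context {R : realType} {Omega : Type}.
Variables (H : set (Omega -> R)) (E : (Omega -> R) -> R).
Hypothesis hE : sublinear_expectation H E.
Variable X : nat -> Omega -> R.
Hypothesis hiid : iid_with0 H E X.
Implicit Types (F : (nat -> R) -> R).

Definition sample (w : Omega) (j : nat) : R := X j.+1 w.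

Lemma row_path_first_vars k w j : (j < k)%N -> row_path (first_vars X k w) j = sample w j.
Proof. by move=> jk; rewrite -[j]/(val (Ordinal jk)) row_path_ord mxE. Qed.

Definition prefix_only (k : nat) F := forall x y, (forall j, (j < k)%N -> x j = y j) -> F x = F y.

Let row_mx_sample k w w' j : (j < k.+1)%N ->
  row_path (row_mx (first_vars X k w) (\row_(_ < 1) X k.+1 w')) j = upd (sample w) k (X k.+1 w') j.
Proof.
move=> jk; rewrite /upd; have [->|jnk] := eqVneq j k.
  have := row_path_ord (row_mx (first_vars X k w) (\row_(_ < 1) X k.+1 w')) (rshift k ord0).
  by rewrite row_mxEr mxE /= addn0.
have jk' : (j < k)%N by rewrite ltn_neqAle jnk.
have := row_path_ord (row_mx (first_vars X k w) (\row_(_ < 1) X k.+1 w')) (lshift 1 (Ordinal jk')).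
by rewrite row_mxEl mxE.
Qed.

Let bounded_unit (T : Type) (f : T -> R) : (forall x, 0 <= f x <= 1) -> bounded_fun f.
Proof.
move=> h; exists 1; split; first exact: num_real.
by move=> M M1 x _ /=; apply: le_trans (norm_unit_le1 (h x)) _; exact: ltW.
Qed.

Let indep_psi k F : prefix_continuous k.+1 F -> (forall x, 0 <= F x <= 1) ->
  let psi := (fun v : 'rV[R]_(k + 1) => F (row_path v)) in continuous psi /\ bounded_fun psi.
Proof.
move=> cF F01 /=; split; last exact: bounded_unit.
by apply: cF => j _; exact: row_path_continuous.
Qed.

(** Membership in [H] is part of the independence clause, so for positive [k] the function is read
    as one that ignores the next variable, whose clause then applies. *)
Lemma sampleH k F : prefix_continuous k F -> prefix_only k F -> (forall x, 0 <= F x <= 1) ->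
  H (fun w => F (sample w)).
Proof.
case: k => [|k] cF oF F01.
  rewrite (_ : (fun w => _) = (fun=> F (fun=> 0))); first exact: sle_cstH hE _.
  by apply/funext => w; exact: oF.
have cF' : prefix_continuous k.+2 F.
  by move=> T p cp; apply: cF => j jk; apply: cp; exact: leqW.
have [c b] := indep_psi cF' F01.
have [+ _] := hiid.1 k.+2 isT _ c b.
congr (H _); apply/funext => w; apply: oF => j jk.
by rewrite row_mx_sample ?upd_other ?ltn_eqF// ltnW.
Qed.

Lemma sample_indep k F : (0 < k)%N -> prefix_continuous k.+1 F -> prefix_only k.+1 F ->
  (forall x, 0 <= F x <= 1) ->
  (E (fun w => F (sample w)))%:E =
  ext_exp H E (fun w => E (fun w' => F (upd (sample w) k (X k.+1 w')))).
Proof.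
move=> k0 cF oF F01; have [c b] := indep_psi cF F01.
have [_ +] := hiid.1 k.+1 k0 _ c b.
rewrite (_ : (fun w => F (row_path _)) = (fun w => F (sample w))); last first.
  apply/funext => w; apply: oF => j jk; rewrite row_mx_sample// /upd.
  by have [->|//] := eqVneq j k.
move=> ->; congr ext_exp; apply/funext => w; congr E; apply/funext => w'.
by apply: oF => j jk; rewrite row_mx_sample.
Qed.

Lemma sample_iid k F x : prefix_continuous k.+1 F -> (forall x, 0 <= F x <= 1) ->
  (E (fun w => F (upd x k (X k.+1 w))))%:E = ext_exp H E (fun w => F (upd x k (X 0%N w))).
Proof.
move=> cF F01; apply: (hiid.2 k.+1 isT (fun v => F (upd x k v))); last exact: bounded_unit.
apply: cF => j _; rewrite /upd; have [_|_] := eqVneq j k; last exact: cst_continuous.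
exact: (fun v : R => cvg_id).
Qed.

(** A dynamic programming step: the common law replaces the fresh variable by [X 0], and
    independence turns the pointwise bound into one for the expectation. The first variable has no
    past, and the case [k = 0] uses its law alone. *)
Lemma sample_step k F G (b : R) : prefix_continuous k.+1 F -> prefix_only k.+1 F ->
  (forall x, 0 <= F x <= 1) ->
  prefix_continuous k G -> prefix_only k G -> (forall x, 0 <= G x <= 1) ->
  (forall x r, r%:E = ext_exp H E (fun w => F (upd x k (X 0%N w))) -> r <= G x + b) ->
  E (fun w => F (sample w)) <= E (fun w => G (sample w)) + b.
Proof.
move=> cF oF F01 cG oG G01 h.
have hG := sampleH cG oG G01.
have step x : E (fun w => F (upd x k (X k.+1 w))) <= G x + b.
  by apply: h; exact: sample_iid.
have [k0|k0] := posnP k; last first.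
  rewrite -lee_fin (sample_indep k0 cF oF F01) -(sle_addc hE b hG).
  by apply: ext_exp_le; [exact: (sle_addcH hE b hG)|move=> w; exact: step].
rewrite (_ : (fun w => F _) = (fun w => F (upd (fun=> 0) k (X k.+1 w)))); last first.
  apply/funext => w; apply: oF => j; rewrite k0 ltnS leqn0 => /eqP ->.
  by rewrite upd_same.
rewrite (_ : (fun w => G _) = (fun=> G (fun=> 0))); last first.
  by apply/funext => w; apply: oG => j; rewrite k0.
by rewrite (sle_cst hE).
Qed.

End iid_sequences.

(** The majorant [Y0] is left abstract because it depends on [p], whereas the strategy must not. *)
Definition dominates_remainder {R : realType} {Omega : Type} (E : (Omega -> R) -> R)
    (X0 : Omega -> R) (a s kap : R) (Y0 : R -> Omega -> R) :=
  forall m sg w, mu_lo E X0 <= m <= mu_hi E X0 -> sigma_lo E X0 m <= sg ->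
    Num.min ((2 * a ^+ 3)^-1 * `|s * ((X0 w - m) / sg)| ^+ 3 / 6)
            (a ^- 2 * (s * ((X0 w - m) / sg)) ^+ 2 / 2) <= kap * Y0 m w.

Section game.
Context {R : realType} {Omega : Type}.
Variables (H : set (Omega -> R)) (E : (Omega -> R) -> R) (X : nat -> Omega -> R).
Local Notation X0 := (X 0%N).
Hypotheses (hE : sublinear_expectation H E) (hiid : iid_with0 H E X)
  (hX0 : H X0) (hX0sq : H (fun w => X0 w ^+ 2)).
Variables (D : set (nat -> R)) (a dl s wd sl sh : R) (n : nat).
Hypotheses (a0 : 0 < a) (dl0 : 0 < dl) (s0 : 0 < s) (wd0 : 0 < wd) (sl0 : 0 < sl)
  (hs : forall m, mu_lo E X0 <= m <= mu_hi E X0 ->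
    sl <= sigma_lo E X0 m /\ sigma_hi E X0 m <= sh).
Implicit Types (x c : nat -> R).

Let d1 k c := smooth3_d1 a (tail_mean D a dl s n k c) (c k).
Let d2 k c := smooth3_d2 a (tail_mean D a dl s n k c) (c k).

(* Up to the continuous transition of width [wd], the means follow the sign of the first
   derivative and the deviations the sign of the second derivative. *)
Definition game_mean (k : nat) c : R := mean_choice E X0 wd (d1 k c).
Definition game_dev (k : nat) c : R := dev_choice E X0 wd (game_mean k c) (d2 k c).

Lemma game_mean_itv k c : mu_lo E X0 <= game_mean k c <= mu_hi E X0.
Proof. exact: (mean_choice_itv hE). Qed.

Lemma game_dev_itv k c :
  sigma_lo E X0 (game_mean k c) <= game_dev k c <= sigma_hi E X0 (game_mean k c).
Proof. exact: (dev_choice_itv hE). Qed.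

Let game_dev_ge k c : sl <= game_dev k c.
Proof.
have [h _] := hs (game_mean_itv k c); apply: le_trans h _.
by have /andP[] := game_dev_itv k c.
Qed.

Let game_dev_gt0 k c : 0 < game_dev k c.
Proof. exact: lt_le_trans (game_dev_ge k c). Qed.

Lemma game_mean_continuous k : (k <= n)%N -> path_continuous (game_mean k).
Proof.
move=> kn; have [L hL] := stage_d1_pathlip D s a0 dl0 kn.
apply: (path_continuous_comp _ (pathlip_path_continuous hL)) => x.
apply: cvgD; first exact: cvg_cst.
by apply: cvgM; [exact: cvg_cst|exact: continuous_slide].
Qed.

Lemma game_dev_continuous k : (k <= n)%N -> path_continuous (game_dev k).
Proof.
move=> kn T p cp t; have [L hL] := stage_d2_pathlip D s a0 dl0 kn.
have c1 := path_continuous_comp (continuous_sigma_lo hE hX0 hX0sq) (game_mean_continuous kn) cp.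
have c2 := path_continuous_comp (continuous_sigma_hi hE hX0 hX0sq) (game_mean_continuous kn) cp.
have c3 := path_continuous_comp (continuous_slide wd0) (pathlip_path_continuous hL) cp.
apply: cvgD; first exact: c1.
by apply: cvgM; [apply: cvgB; [exact: c2|exact: c1]|exact: c3].
Qed.

Definition game_value (k : nat) x : R :=
  stage D a dl s n k (game_path game_mean game_dev s x k).

Lemma game_value_unit k x : 0 <= game_value k x <= 1.
Proof. exact: stage_unit. Qed.

Lemma game_value_prefix_only k : prefix_only k (game_value k).
Proof. by move=> x y xy; rewrite /game_value (game_path_ext _ _ _ xy). Qed.

Lemma game_value_continuous k : (k <= n)%N -> prefix_continuous k (game_value k).
Proof.
move=> kn; have [L hL] := stage_pathlip D s a0 dl0 kn.
apply: path_prefix_continuous; last exact: pathlip_path_continuous hL.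
- by move=> i ik; apply: game_mean_continuous; apply: leq_trans kn; exact: ltnW.
- by move=> i ik; apply: game_dev_continuous; apply: leq_trans kn; exact: ltnW.
- by move=> i c _; rewrite gt_eqF.
Qed.

Definition gauss_remainder : R :=
  Num.min ((2 * a ^+ 3)^-1 * (321 / 200 * s ^+ 3) / 6) (a ^- 2 * s ^+ 2 / 2).

Definition transition_cost : R :=
  s / sl * wd * (mu_hi E X0 - mu_lo E X0) + s ^+ 2 / 2 * wd * (1 + (sh / sl) ^+ 2).

Variables (Y0 : R -> Omega -> R) (kap g : R).
Hypotheses (kap0 : 0 < kap)
  (hY0 : dominates_remainder E X0 a s kap Y0)
  (hg : forall m, mu_lo E X0 <= m <= mu_hi E X0 -> (ext_exp H E (Y0 m) <= g%:E)%E).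

(** The actual step is expanded from above and the Gaussian step from below by [stage_lower], around
    the same smooth function. The terms of orders zero and two agree, leaving two remainders and the
    transition cost. *)
Lemma game_value_step k x r : (k < n)%N ->
  r%:E = ext_exp H E (fun w => game_value k.+1 (upd x k (X0 w))) ->
  r <= game_value k x + (kap * g + gauss_remainder + transition_cost).
Proof.
move=> kn hr; set c := game_path game_mean game_dev s x k.
set m := game_mean k c; set sg := game_dev k c.
have sg0 : 0 < sg by exact: game_dev_gt0.
have [sl1 sh1] := hs (game_mean_itv k c).
have mi := game_mean_itv k c.
have /andP[sg1 sg2] := game_dev_itv k c.
set F0 := smooth3 a (tail_mean D a dl s n k c) (c k).
set e1 := s / sg * wd * (mu_hi E X0 - mu_lo E X0).
set e2 := s ^+ 2 / 2 * d2 k c + s ^+ 2 / 2 * wd * (1 + (sh / sl) ^+ 2).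
have h1 : E (fun w => (s / sg * d1 k c) * (X0 w - m)) <= e1.
  by apply: (mean_choice_le hE) => //; rewrite divr_ge0// ltW.
have h2 : E (fun w => (s ^+ 2 / 2 * d2 k c / sg ^+ 2) * (X0 w - m) ^+ 2) <= e2.
  by apply: (dev_choice_le hE) => //; rewrite divr_ge0// sqr_ge0.
have [L hL] := tail_mean_lip D a s n dl0 k c.
have h01 := tail_mean_unit D a s n dl0 k c.
(* The moment is an infimum over majorants in [H]: the bound is proved for each majorant and then
   solved for [E Z], as [kap > 0]. *)
have bound Z : H Z -> (forall w, Y0 m w <= Z w) -> r <= F0 + e1 + e2 + kap * E Z.
  move=> hZ YZ; rewrite -lee_fin hr.
  apply: (@ext_exp_taylor _ _ _ _ hE _ hX0 hX0sq m sg s F0 (d1 k c) (d2 k c) kap e1 e2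
    (fun y => game_value k.+1 (upd x k y)) Z) => //; first exact: ltW.
  move=> y w <-; rewrite /game_value game_path_upd -/c -/m -/sg.
  set u := s * _.
  apply: le_trans (stage_succ_le _ _ a0 dl0 _ kn) _.
  rewrite tail_mean_upd upd_same.
  have := smooth3_taylor a0 hL h01 (c k) u; rewrite -/F0 -/(d1 k c) -/(d2 k c).
  have := hY0 w mi sg1; rewrite -/m -/u.
  have := ler_wpM2l (ltW kap0) (YZ w).
  move: (Num.min _ _) (d2 k c * _) (d1 k c * _) => mn t2 t1 i1 i2.
  rewrite ler_norml => /andP[_ i3]; lra.
have : (((r - F0 - e1 - e2) / kap)%:E <= ext_exp H E (Y0 m))%E.
  apply: ext_exp_ge => Z hZ YZ; rewrite ler_pdivrMr// mulrC.
  by have := bound Z hZ YZ; lra.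
move=> /le_trans/(_ (hg mi)); rewrite lee_fin ler_pdivrMr// => hrg.
have he1 : e1 <= s / sl * wd * (mu_hi E X0 - mu_lo E X0).
  have mu0 := mu_lo_le_hi hE hX0.
  rewrite /e1 ler_wpM2r ?subr_ge0// ler_wpM2r ?(ltW wd0)// ler_wpM2l ?(ltW s0)//.
  by rewrite lef_pV2// game_dev_ge.
have := stage_lower D a0 dl0 s0 c kn; rewrite -/F0 -/(d2 k c) -/gauss_remainder -/(game_value k x).
rewrite /transition_cost; move: hrg he1; rewrite /e2 [g * kap]mulrC.
move: (d2 k c) (gauss_remainder) (game_value k x) => t2 gr gv.
set t := s ^+ 2 / 2 * wd * _; set t' := s / sl * wd * _.
have -> : s ^+ 2 / 2 * t2 = t2 * s ^+ 2 / 2 by rewrite mulrC mulrA.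
lra.
Qed.

Lemma game_value_le : E (fun w => game_value n (sample X w)) <=
  stage D a dl s n 0 (fun=> 0) + n%:R * (kap * g + gauss_remainder + transition_cost).
Proof.
suff h k : (k <= n)%N -> E (fun w => game_value k (sample X w)) <=
    stage D a dl s n 0 (fun=> 0) + k%:R * (kap * g + gauss_remainder + transition_cost).
  exact: h.
elim: k => [_|k IH kn].
  have e : E (fun w => game_value 0 (sample X w)) = stage D a dl s n 0 (fun=> 0).
    exact: (sle_cst hE (stage D a dl s n 0 (fun=> 0))).
  by rewrite e mul0r addr0.
have {}IH := IH (ltnW kn); set b := kap * g + _ + _ in IH *.
apply: (@le_trans _ _ (E (fun w => game_value k (sample X w)) + b)).
  2: by rewrite -natr1 mulrDl mul1r [_ + (_ * b + b)]addrA lerD2r.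
apply: (sample_step hE hiid (k := k)).
- exact: game_value_continuous.
- exact: game_value_prefix_only.
- exact: game_value_unit.
- by apply: game_value_continuous; exact: ltnW.
- exact: game_value_prefix_only.
- exact: game_value_unit.
- by move=> x r; exact: game_value_step.
Qed.

End game.

Section normalizing_sequence.
Context {R : realType} {Omega : Type}.
Variables (H : set (Omega -> R)) (E : (Omega -> R) -> R) (X : nat -> Omega -> R).
Local Notation X0 := (X 0%N).
Hypotheses (hE : sublinear_expectation H E) (hiid : iid_with0 H E X)
  (hX0 : H X0) (hX0sq : H (fun w => X0 w ^+ 2)).
Hypothesis hsigma : (0 < sigma_inf E X0)%E /\
  (sigma_inf E X0 <= sigma_sup E X0)%E /\ (sigma_sup E X0 < +oo)%E.

Lemma sigma_bounds : exists sl sh : R, 0 < sl /\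
  forall m, mu_lo E X0 <= m <= mu_hi E X0 ->
    sl <= sigma_lo E X0 m /\ sigma_hi E X0 m <= sh.
Proof.
have [h1 [h2 h3]] := hsigma.
have lo m : mu_lo E X0 <= m <= mu_hi E X0 ->
    (sigma_inf E X0 <= (sigma_lo E X0 m)%:E)%E.
  by move=> mi; apply: ereal_inf_lbound; exists m => //; rewrite /= in_itv.
have hi m : mu_lo E X0 <= m <= mu_hi E X0 ->
    ((sigma_hi E X0 m)%:E <= sigma_sup E X0)%E.
  by move=> mi; apply: ereal_sup_ubound; exists m => //; rewrite /= in_itv.
case: (sigma_inf _ _) h1 h2 lo => [sl| |]//; case: (sigma_sup _ _) h3 hi => [sh| |]//.
move=> _ hi h1 _ lo; exists sl, sh; split => // m mi; split; first by rewrite -lee_fin lo.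
by rewrite -lee_fin hi.
Qed.

Lemma upper_prob_le1 n (S : Omega -> C01 R) D : (upper_prob H E X n S D <= 1)%E.
Proof.
rewrite -[1%E]/(1%:E) -(sle_cst hE 1); apply: ereal_inf_lbound.
exists (fun=> 1) => //; split; first exact: sle_cstH hE 1.
by move=> w; rewrite indicE; case: (_ \in _).
Qed.

(** The strategy is produced before the Wiener process, [Y0], [kap] and [g] are quantified, so that
    one choice serves all [p]. *)
Lemma exists_normalization (n : nat) (D : set (C01 R)) (eps eta : R) :
  (0 < n)%N -> 0 < eps -> 0 < eta ->
  let s : R := (Num.sqrt n%:R)^-1 in
  let a : R := 11 / 100 * eps in
  exists mu sigma : forall i : nat, 'rV[R]_i -> R, normalization E X0 n mu sigma /\
  forall (d : measure_display) (T : measurableType d) (P : probability T R) (B : T -> C01 R),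
  standard_wiener P B ->
  forall (Y0 : R -> Omega -> R) (kap g : R), 0 < kap ->
  dominates_remainder E X0 a s kap Y0 ->
  (forall m, mu_lo E X0 <= m <= mu_hi E X0 -> (ext_exp H E (Y0 m) <= g%:E)%E) ->
  (upper_prob H E X n (S_line X n mu sigma) D <= P [set w | enlarge D eps (B w)] +
     (4 * n%:R * expR (- (n%:R * eps ^+ 2 / 9)) +
      n%:R * (kap * g + gauss_remainder a s + eta))%:E)%E.
Proof.
move=> n0 eps0 eta0 s a.
have nR : 0 < n%:R :> R by rewrite ltr0n.
have s0 : 0 < s by rewrite invr_gt0 sqrtr_gt0.
have a0 : 0 < a by rewrite mulr_gt0//; lra.
have a3 : 3 * a = 33 / 100 * eps by rewrite /a; field.
pose dl := 1 / 400 * eps.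
have dl0 : 0 < dl by rewrite /dl; lra.
have [sl [sh [sl0 hs]]] := sigma_bounds.
pose K := s / sl * (mu_hi E X0 - mu_lo E X0) + s ^+ 2 / 2 * (1 + (sh / sl) ^+ 2).
have K0 : 0 <= K.
  apply: addr_ge0; first by rewrite mulr_ge0 ?subr_ge0 ?(mu_lo_le_hi hE)// divr_ge0// ltW.
  by apply: mulr_ge0; [apply: divr_ge0 => //; exact: sqr_ge0|apply: addr_ge0 => //; exact: sqr_ge0].
(* The transition cost is [K * wd], hence at most [eta]. *)
pose wd := eta / (K + 1).
have K1 : 0 < K + 1 by lra.
have wd0 : 0 < wd by rewrite divr_gt0.
have cost : transition_cost E X s wd sl sh <= eta.
  have -> : transition_cost E X s wd sl sh = K * wd by rewrite /transition_cost /K; ring.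
  rewrite /wd mulrCA -[leRHS]mulr1 ler_pM2l// ler_pdivrMr// mul1r; lra.
pose D' := node_paths D n.
pose M := game_mean E X D' a dl s wd n; pose S := game_dev E X D' a dl s wd n.
pose mu (i : nat) (r : 'rV[R]_i) := M i (game_path M S s (row_path r) i).
pose sigma (i : nat) (r : 'rV[R]_i) := S i (game_path M S s (row_path r) i).
have Mc i : (i < n)%N -> path_continuous (M i) by move=> /ltnW; exact: game_mean_continuous.
have Sc i : (i < n)%N -> path_continuous (S i).
  by move=> /ltnW; exact: (game_dev_continuous hE hX0 hX0sq).
have Mi i c : mu_lo E X0 <= M i c <= mu_hi E X0 by exact: (game_mean_itv hE).
have Si i c : sigma_lo E X0 (M i c) <= S i c <= sigma_hi E X0 (M i c).
  exact: (game_dev_itv hE).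
have S0 i c : S i c != 0.
  have [h _] := hs _ (Mi i c); have /andP[h' _] := Si i c.
  by rewrite gt_eqF// (lt_le_trans sl0)// (le_trans h).
exists mu, sigma; split.
  move=> i iN; have ltni j : (j < i)%N -> (j < n)%N by move=> /ltn_trans; apply.
  have cM j : (j < i)%N -> path_continuous (M j) by move=> /ltni; exact: Mc.
  have cS j : (j < i)%N -> path_continuous (S j) by move=> /ltni; exact: Sc.
  have c0 j c : (j < i)%N -> S j c != 0 by [].
  split.
  - apply: (path_prefix_continuous (s := s) cM cS c0 (Mc i iN)) => j _; exact: row_path_continuous.
  - apply: (path_prefix_continuous (s := s) cM cS c0 (Sc i iN)) => j _; exact: row_path_continuous.
  move=> r; rewrite /mu /sigma; set c := game_path _ _ _ _ _.
  have mi := Mi i c; have /andP[d0 d1] := Si i c; split => //; split => //.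
    by apply: ereal_inf_lbound; exists (M i c) => //; rewrite /= in_itv.
  by apply: ereal_sup_ubound; exists (M i c) => //; rewrite /= in_itv.
move=> d T P B hB Y0 kap g kap0 hY0 hg.
pose V := game_value E X D' a dl s wd n n.
have Vo : prefix_only n V by exact: game_value_prefix_only.
have V01 x : 0 <= V x <= 1 by exact: game_value_unit.
have VE : (fun w => V (row_path (first_vars X n w))) = (fun w => V (sample X w)).
  by apply/funext => w; apply: Vo => j jn; exact: row_path_first_vars.
have VH : H (fun w => V (sample X w)).
  by apply: (sampleH hE hiid _ Vo V01); exact: (game_value_continuous hE hX0 hX0sq a0 dl0 wd0 sl0 hs).
apply: (@le_trans _ _ (E (fun w => V (sample X w)))%:E).
  (* The final game value is itself an admissible majorant: if the broken line is in [D], the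
     recorded path is one of its node paths and the target is [1]. *)
  apply: ereal_inf_lbound; exists (fun r => V (row_path r)); last by rewrite VE.
  split; first by rewrite VE.
  move=> w; rewrite (Vo _ (sample X w)); last by move=> j jn; exact: row_path_first_vars.
  rewrite indicE; case: (boolP (_ \in D)) => [|_]; last by have /andP[] := V01 (sample X w).
  rewrite inE => hD; rewrite /V /game_value /stage ltnn.
  rewrite -/M -/S.
  pose z (i : nat) := (X i.+1 w - mu i (first_vars X i w)) / sigma i (first_vars X i w).
  apply: (@relaxed_indic_ge1 _ _ _ _ _ _ _ _ _ (fun j => s * \sum_(i < j) z i)) => //.
  - by rewrite mulr_ge0// ltW.
  - by exists z.
  move=> j jn; rewrite game_path_sum//; congr (_ * _); apply: eq_bigr => i _.
  rewrite /z /mu /sigma (@game_path_ext _ M S s (row_path (first_vars X i w)) (sample X w) i)//.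
  by move=> j' ji; exact: row_path_first_vars.
have [c [hc st]] := stage0_le D' s a0 dl0 n0.
rewrite a3 in hc; have := wexp_relaxed_le hB D n0 eps0 hc.
rewrite -/D' -/dl -/s -a3 => hw.
have := game_value_le hE hiid hX0 hX0sq D' n a0 dl0 s0 wd0 sl0 hs kap0 hY0 hg.
rewrite -/V => hV.
rewrite EFinD addeA; apply: le_trans (leeD hw (lexx _)).
rewrite -EFinD lee_fin; apply: le_trans hV _; apply: lerD => //.
by rewrite ler_pM2l// lerD2l.
Qed.

End normalizing_sequence.

(** * Numerical bounds *)

Section numerical_bounds.
Context {R : realType}.
Implicit Types (x y t q p C : R).

(** Bernoulli's inequality for [x^-1] bounds the inverse [w] of the power by [m], and
    [(2 - m) w <= (2 - w) w <= 1]. *)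
Lemma powR_ge_lin x q : 1 <= x -> 0 <= q <= 1 -> 1 + q * (1 - x^-1) <= x `^ q.
Proof.
move=> x1 q01; have x0 : 0 < x by exact: lt_le_trans x1.
have xi0 : 0 < x^-1 by rewrite invr_gt0.
have := powR_le1D xi0 q01; set m := 1 + q * _ => hm.
have w0 : 0 < x^-1 `^ q by exact: powR_gt0.
have -> : x `^ q = (x^-1 `^ q)^-1.
  have : x `^ q * x^-1 `^ q = 1 by rewrite -powRM ?divff ?gt_eqF ?powR1// ltW.
  by move=> h; apply: (mulIf (lt0r_neq0 w0)); rewrite h mulVf// gt_eqF.
move: (x^-1 `^ q) w0 hm => w w0 hm; rewrite -[leRHS]mul1r ler_pdivlMr//.
have -> : q * (1 - x^-1) = 1 - m by rewrite /m; ring.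
have : 0 <= (1 + (1 - m) + (w - 1)) ^+ 2 by exact: sqr_ge0.
have : 0 <= (w - 1) ^+ 2 by exact: sqr_ge0.
have : w * w <= m * w by rewrite ler_pM2r.
rewrite !expr2; lra.
Qed.

Lemma powR_nat3 x : 0 <= x -> x `^ 3 = x ^+ 3.
Proof. by move=> x0; rewrite -powR_mulrn. Qed.

Lemma powR_add t p q : 0 < t -> t `^ (p + q) = t `^ p * t `^ q.
Proof. by move=> t0; rewrite powRD// (gt_eqF t0) implybT. Qed.

Lemma powR_2D t q : 0 < t -> t `^ (2 + q) = t ^+ 2 * t `^ q.
Proof. by move=> t0; rewrite powR_add// -[t `^ 2]/(t `^ 2%:R) powR_mulrn// ltW. Qed.

(** The interpolation inequality times [t^2]; [B <= A] makes the mixed coefficient at least [B], as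
    the quadratic branch needs. *)
Lemma min_cubic_le A B t q : 0 < B -> B <= A -> 0 <= t -> 0 <= q <= 1 ->
  Num.min (A * t ^+ 3) (B * t ^+ 2) <= (q * A + (1 - q) * B) * Num.min (t `^ (2 + q)) (t ^+ 2).
Proof.
move=> B0 BA; rewrite le_eqVlt => /predU1P[<-|t0] q01.
  have /andP[q0 _] := q01.
  by rewrite powR0 ?gt_eqF// ?expr0n//=; [rewrite !mulr0 minxx mulr0|lra].
have t2 : 0 < t ^+ 2 by exact: exprn_gt0.
have /andP[q0 q1] := q01.
have KB : B <= q * A + (1 - q) * B.
  have := ler_wpM2l q0 BA; lra.
have K0 : 0 < q * A + (1 - q) * B by exact: lt_le_trans KB.
rewrite powR_2D// minr_pMr ?(ltW K0)// le_min; apply/andP; split; last first.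
  by rewrite ge_min ler_pM2r// KB orbT.
have := min_le_interpolate (lt_le_trans B0 BA) B0 t0 q01.
rewrite -(ler_pM2l t2) minr_pMr ?(ltW t2)// => h.
have e1 : A * t ^+ 3 = t ^+ 2 * (A * t) by ring.
by rewrite e1 [B * _]mulrC; apply: le_trans h _; rewrite mulrCA.
Qed.

Lemma C2_ge p : 2 <= p <= 3 -> 90 <= C2 p.
Proof.
move=> /andP[p2 p3]; rewrite /C2 le_min; apply/andP; split; first by lra.
apply: (@le_trans _ _ ((47 / 10) `^ 3)); last by rewrite ler_powR//; lra.
rewrite powR_nat3; last by lra.
lra.
Qed.

(** The two end values bound the sum of all costs: [2 * 41.33 + 20.82 <= 103.5] at [q = 0] and
    [2.605 * 62.61 + 20.82 <= 183.95] at [q = 1], where [2.605] adds the Gaussian third moment to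
    one. *)
Lemma C2_ge_mix q : 0 <= q <= 1 -> q * (184 - 1 / 20) + (1 - q) * (207 / 2) <= C2 (2 + q).
Proof.
move=> /andP[q0 q1]; rewrite /C2 le_min; apply/andP; split; first by lra.
have c0 : 0 < 47 / 10 :> R by lra.
have -> : 2 + q + 1 = 3 + q by ring.
rewrite powR_add// powR_nat3; last by lra.
have c1 : 1 <= 47 / 10 :> R by lra.
have q01 : 0 <= q <= 1 by apply/andP.
have := powR_ge_lin c1 q01.
have -> : 1 - (47 / 10)^-1 = 37 / 47 :> R by field.
move: (_ `^ q) => w hw.
have c3 : 1038 / 10 <= (47 / 10) ^+ 3 :> R by lra.
apply: le_trans (_ : (1038 / 10) * w <= _); last by rewrite ler_wpM2r//; lra.
lra.
Qed.

(* [142 / 25] is just below the cube root of [184]. *)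
Lemma ge142_25 p C : 2 <= p <= 3 -> 0 < C -> C2 p <= C `^ p -> 142 / 25 <= C.
Proof.
move=> /andP[p2 p3] C0 h; rewrite leNgt; apply/negP => Clt.
have p0 : 0 < p by lra.
have c0 : 0 < 142 / 25 :> R by lra.
have : C `^ p < (142 / 25) `^ p.
  by rewrite gt0_ltr_powR// ?nnegrE ltW.
apply/negP; rewrite -leNgt; apply: le_trans h; rewrite /C2 le_min; apply/andP; split.
  apply: (@le_trans _ _ ((142 / 25) `^ 3)); first by rewrite ler_powR//; lra.
  rewrite powR_nat3; [lra|exact: ltW].
have c1 : 0 < 47 / 10 :> R by lra.
have -> : 142 / 25 = (47 / 10) * (284 / 235) :> R by field.
rewrite powRM; [|lra|lra].
rewrite powR_add// ler_pM2l ?powR_gt0// powRr1 ?(ltW c1)//.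
apply: (@le_trans _ _ ((284 / 235) `^ 3)); first by rewrite ler_powR//; lra.
rewrite powR_nat3; lra.
Qed.

Lemma min_trunc_scale (C y q : R) : 0 < C -> 0 <= q ->
  Num.min (`|y| `^ (2 + q)) (C `^ q * y ^+ 2) =
  C `^ (2 + q) * Num.min ((`|y| / C) `^ (2 + q)) ((`|y| / C) ^+ 2).
Proof.
move=> C0 q0; have Cp : 0 < C `^ (2 + q) by exact: powR_gt0.
rewrite minr_pMr ?(ltW Cp)//; congr Num.min.
  rewrite -powRM ?(ltW C0) ?divr_ge0 ?(ltW C0)//; congr (_ `^ _).
  by rewrite mulrC divfK ?gt_eqF.
rewrite powR_2D// exprMn exprVn -[y ^+ 2]real_normK ?num_real//.
by field; rewrite gt_eqF.
Qed.

(** [4 / 27] is the maximum of [t^2 - t^3] on [[0, 1]], attained at [2 / 3]. *)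
Lemma sqr_sub_le_min t q : 0 <= t -> 0 <= q <= 1 ->
  t ^+ 2 - 4 / 27 <= Num.min (t `^ (2 + q)) (t ^+ 2).
Proof.
move=> t0 /andP[q0 q1]; rewrite le_min; apply/andP; split; last by lra.
have [t1|t1] := leP t 1; last first.
  have : t `^ 2 <= t `^ (2 + q) by rewrite ler_powR//; lra.
  rewrite -[t `^ 2]/(t `^ 2%:R) powR_mulrn//; lra.
move: t0; rewrite le_eqVlt => /predU1P[<-|t0].
  by rewrite powR0 ?gt_eqF// ?expr0n/=; lra.
apply: (@le_trans _ _ (t `^ 3)).
  rewrite powR_nat3; last exact: ltW.
  have : 0 <= (t + 1 / 3) * (t - 2 / 3) ^+ 2 by rewrite mulr_ge0 ?sqr_ge0//; lra.
  rewrite !exprS expr0; lra.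
by apply: ger_powR; [rewrite t0 t1|lra].
Qed.

(** The left-hand side is the tangent at [y^2 = 1] of [(y^2)^(1 + q / 2)], with value one there; for
    such [C] the factor [C^q] is at least its slope. *)
Lemma one_le_min_trunc (C y q : R) : 5 / 2 <= C -> 0 <= q <= 1 ->
  (1 + q / 2) * y ^+ 2 + (- (q / 2)) <= Num.min (`|y| `^ (2 + q)) (C `^ q * y ^+ 2).
Proof.
move=> hC q01; have /andP[q0 q1] := q01; have y2 := sqr_ge0 y.
have C1 : 1 <= C by lra.
rewrite le_min; apply/andP; split.
  have r1 : 1 <= 1 + q / 2 by lra.
  have := powR_ge1D y2 r1.
  have -> : (y ^+ 2) `^ (1 + q / 2) = `|y| `^ (2 + q).
    rewrite -[y ^+ 2]real_normK ?num_real// -powR_mulrn// -powRrM; congr (_ `^ _).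
    by field.
  lra.
have Ci : C^-1 <= 1 / 2.
  by rewrite div1r lef_pV2 ?posrE; lra.
have := powR_ge_lin C1 q01 => h.
have h' : 1 + q / 2 <= C `^ q.
  have : 0 <= q * (1 / 2 - C^-1) by rewrite mulr_ge0// subr_ge0.
  lra.
have := ler_wpM2r y2 h'; lra.
Qed.

End numerical_bounds.

Section truncated_moments.
Context {R : realType} {Omega : Type}.
Variables (H : set (Omega -> R)) (E : (Omega -> R) -> R) (X0 : Omega -> R).
Hypotheses (hE : sublinear_expectation H E) (hX0 : H X0) (hX0sq : H (fun w => X0 w ^+ 2)).
Hypothesis sigma_gt0 : 0 < sigma_lo E X0 (mu_lo E X0).

(** At [mu_lo] the upper second moment of [xi0] is the square of [sigma_hi / sigma_lo], hence at
    least one, so a quadratic minorant of the truncated power bounds the moment from below. *)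
Lemma gamma_trunc_ge (p C al be : R) : 0 <= al ->
  (forall y, al * y ^+ 2 + be <= Num.min (`|y| `^ p) (C `^ (p - 2) * y ^+ 2)) ->
  ((al + be)%:E <= gamma_trunc H E X0 p C)%E.
Proof.
move=> al0 h; have sg0 := sigma_gt0; set m := mu_lo E X0 in sg0 *.
apply: (@le_trans _ _ (ext_exp H E (fun w =>
    Num.min (`|xi0 E X0 m w| `^ p) (C `^ (p - 2) * xi0 E X0 m w ^+ 2)))); last first.
  by apply: ereal_sup_ubound; exists m => //; rewrite /= in_itv/= lexx (mu_lo_le_hi hE).
apply: ext_exp_ge => Z hZ YZ.
have k0 : 0 <= al / sigma_lo E X0 m ^+ 2 by rewrite divr_ge0// sqr_ge0.
have hW := sle_scaleH hE (al / sigma_lo E X0 m ^+ 2) (sqdevH hE hX0 hX0sq m).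
apply: (@le_trans _ _ (E (fun w => al / sigma_lo E X0 m ^+ 2 * (X0 w - m) ^+ 2 + be))); last first.
  apply: (sle_mono hE) => //; first exact: (sle_addcH hE be hW).
  move=> w; apply: le_trans (YZ w); apply: le_trans (h _); rewrite /xi0 le_eqVlt; apply/orP; left.
  by apply/eqP; field; rewrite gt_eqF.
rewrite (sle_addc hE be hW) (sle_pos_homo hE k0 (sqdevH hE hX0 hX0sq m)) lerD2r.
rewrite -(sigma_hi_sqr hE hX0 hX0sq) mulrAC ler_pdivlMr ?exprn_gt0// ler_wpM2l//.
by rewrite ler_sqr ?nnegrE ?(sigma_lo_le_hi hE hX0 hX0sq) ?sqrtr_ge0.
Qed.

Lemma gamma_trunc_le_gamma (p C : R) : (gamma_trunc H E X0 p C <= gamma H E X0 p)%E.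
Proof.
apply: ge_ereal_sup => _ [m mi <-]; apply: le_trans (ereal_sup_ubound _); last by exists m.
apply: le_ereal_inf_tmp => _ [Z [hZ YZ] <-]; apply: ext_exp_le => // w.
by apply: le_trans (YZ w); rewrite ge_min lexx.
Qed.

End truncated_moments.

(** * Adding up the costs *)

Section final_estimate.
Context {R : realType}.

(* The constants of the cubic and quadratic Taylor remainders for windows of half-width
   [11 / 100 * eps]. *)
Let A3 : R := (2 * (11 / 100) ^+ 3)^-1 / 6.
Let B2 : R := (11 / 100) ^- 2 / 2.

Let A3_le : A3 <= 62 + 61 / 100.
Proof.
have x0 : 0 < 12 * (11 / 100) ^+ 3 :> R by rewrite mulr_gt0// exprn_gt0//; lra.
rewrite -(ler_pM2r x0); have -> : A3 * (12 * (11 / 100) ^+ 3) = 1 by rewrite /A3; field.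
lra.
Qed.

Let B2_le : B2 <= 41 + 33 / 100.
Proof.
have x0 : 0 < 2 * (11 / 100) ^+ 2 :> R by rewrite mulr_gt0// exprn_gt0//; lra.
rewrite -(ler_pM2r x0); have -> : B2 * (2 * (11 / 100) ^+ 2) = 1 by rewrite /B2; field.
lra.
Qed.

Let B2_gt0 : 0 < B2.
Proof. by rewrite divr_gt0// invr_gt0 exprn_gt0//; lra. Qed.

Let B2_le_A3 : B2 <= A3.
Proof.
have -> : A3 = B2 * (100 / 66) by rewrite /A3 /B2; field.
by rewrite ler_peMr ?(ltW B2_gt0)//; lra.
Qed.

Definition step_const (q : R) : R := q * A3 + (1 - q) * B2.

Lemma step_const_gt0 q : 0 <= q <= 1 -> 0 < step_const q.
Proof.
move=> /andP[q0 q1]; apply: lt_le_trans B2_gt0 _.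
by have := ler_wpM2l q0 B2_le_A3; rewrite /step_const; lra.
Qed.

Lemma taylor_remainder_le (eps C q y u : R) : 0 < eps -> 0 < C -> 0 <= q <= 1 ->
  `|u| <= eps / C * `|y| ->
  Num.min ((2 * (11 / 100 * eps) ^+ 3)^-1 * `|u| ^+ 3 / 6) ((11 / 100 * eps) ^- 2 * u ^+ 2 / 2) <=
  step_const q / C `^ (2 + q) * Num.min (`|y| `^ (2 + q)) (C `^ q * y ^+ 2).
Proof.
move=> eps0 C0 q01 hu; have /andP[q0 _] := q01.
have Cp : 0 < C `^ (2 + q) by exact: powR_gt0.
rewrite min_trunc_scale// mulrA divfK ?gt_eqF//.
set t := `|y| / C; have t0 : 0 <= t by rewrite divr_ge0// ltW.
have ut : `|u| <= eps * t by apply: le_trans hu _; rewrite /t mulrAC -mulrA.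
apply: le_trans (min_cubic_le B2_gt0 B2_le_A3 t0 q01).
have et0 : 0 <= eps * t by rewrite mulr_ge0// ltW.
have a0 : 0 < 11 / 100 * eps by rewrite mulr_gt0//; lra.
rewrite le_min; apply/andP; split; rewrite ge_min; apply/orP; [left|right].
- have -> : A3 * t ^+ 3 = (2 * (11 / 100 * eps) ^+ 3)^-1 * (eps * t) ^+ 3 / 6.
    by rewrite /A3; field; rewrite gt_eqF.
  by rewrite ler_pM2r ?invr_gt0// ler_wpM2l ?lerXn2r ?nnegrE// invr_ge0 mulr_ge0// exprn_ge0// ltW.
- have -> : B2 * t ^+ 2 = (11 / 100 * eps) ^- 2 * (eps * t) ^+ 2 / 2.
    by rewrite /B2; field; rewrite gt_eqF.
  rewrite ler_pM2r ?invr_gt0// ler_wpM2l ?invr_ge0 ?exprn_ge0 ?(ltW a0)//.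
  by rewrite -[u ^+ 2]real_normK ?num_real// lerXn2r ?nnegrE.
Qed.

Lemma gauss_remainder_le (eps C q : R) : 0 < eps -> 0 < C -> 0 <= q <= 1 ->
  gauss_remainder (11 / 100 * eps) (eps / C) * C `^ (2 + q) <=
  q * (321 / 200 * A3) + (1 - q) * B2.
Proof.
move=> eps0 C0 q01; have Cp : 0 < C `^ (2 + q) by exact: powR_gt0.
have Ci : 0 < C^-1 by rewrite invr_gt0.
have BA : B2 <= 321 / 200 * A3 by move: B2_le_A3 B2_gt0; lra.
have K0 : 0 <= q * (321 / 200 * A3) + (1 - q) * B2.
  have /andP[q0 q1] := q01; have := ler_wpM2l q0 BA; move: B2_gt0; lra.
rewrite -ler_pdivlMr//.
have -> : gauss_remainder (11 / 100 * eps) (eps / C) =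
    Num.min (321 / 200 * A3 * C^-1 ^+ 3) (B2 * C^-1 ^+ 2).
  rewrite /gauss_remainder; congr Num.min; rewrite /A3 /B2; field; by rewrite !gt_eqF.
apply: le_trans (min_cubic_le B2_gt0 BA (ltW Ci) q01) _; rewrite ler_wpM2l//.
have -> : (C `^ (2 + q))^-1 = C^-1 `^ (2 + q).
  apply: (mulIf (lt0r_neq0 Cp)); rewrite mulVf ?gt_eqF// -powRM ?(ltW C0) ?(ltW Ci)//.
  by rewrite mulVf ?gt_eqF// powR1.
by rewrite ge_min lexx.
Qed.

(** After multiplication by the power of [C], the Wiener error is at most [20.8] and the slack at
    most [1 / 50]; all terms free of [g] are charged to [g >= 1]. *)
Lemma total_cost_le (eps C q g eta : R) : 0 < eps -> 142 / 25 <= C -> 0 <= q <= 1 -> 1 <= g ->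
  eta * C `^ (2 + q) <= 1 / 50 ->
  4 * expR (- (C ^+ 2 / 9)) +
    (step_const q / C `^ (2 + q) * g + gauss_remainder (11 / 100 * eps) (eps / C) + eta) <=
  C2 (2 + q) * g / C `^ (2 + q).
Proof.
move=> eps0 hC q01 g1 heta; have C0 : 0 < C by lra.
have C1 : 1 <= C by lra.
have Cp : 0 < C `^ (2 + q) by exact: powR_gt0.
have /andP[q0 q1] := q01.
have hG := gauss_remainder_le eps0 C0 q01.
have hexp : 4 * expR (- (C ^+ 2 / 9)) * C `^ (2 + q) <= 208 / 10.
  apply: le_trans (cube_gauss_tail_le hC); rewrite ler_pM2l ?mulr_gt0 ?expR_gt0//.
  by rewrite -powR_nat3 ?(ltW C0)// ler_powR//; lra.
rewrite ler_pdivlMr//.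
have -> : (4 * expR (- (C ^+ 2 / 9)) + (step_const q / C `^ (2 + q) * g +
    gauss_remainder (11 / 100 * eps) (eps / C) + eta)) * C `^ (2 + q) =
  4 * expR (- (C ^+ 2 / 9)) * C `^ (2 + q) + step_const q * g +
    gauss_remainder (11 / 100 * eps) (eps / C) * C `^ (2 + q) + eta * C `^ (2 + q).
  by field; rewrite gt_eqF.
move: (4 * _ * _) (gauss_remainder _ _ * _) (eta * _) hexp hG heta => x1 x2 x3 h1 h2 h3.
have hC2 := C2_ge_mix q01.
pose W := 208 / 10 + (q * (321 / 200 * A3) + (1 - q) * B2) + 1 / 50.
have W0 : 0 <= W.
  have := mulr_ge0 q0 (ltW (lt_le_trans B2_gt0 B2_le_A3)).
  have : 0 <= (1 - q) * B2 by rewrite mulr_ge0 ?subr_ge0// ltW.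
  rewrite /W; lra.
have hW : step_const q + W <= C2 (2 + q).
  have := ler_wpM2l q0 A3_le; have := @ler_wpM2l _ (1 - q) _ _ _ B2_le.
  rewrite subr_ge0 => /(_ q1); rewrite /step_const /W; lra.
have g0 : 0 <= g by lra.
have := ler_wpM2r g0 hW; have : W <= W * g by rewrite ler_peMr.
rewrite /W; lra.
Qed.

Lemma slack_le (C q : R) : 1 <= C -> 0 <= q <= 1 ->
  1 / 50 / (1 + C) ^+ 3 * C `^ (2 + q) <= 1 / 50.
Proof.
move=> C1 /andP[q0 q1]; have C0 : 0 <= C by lra.
have c3 : 0 < (1 + C) ^+ 3 by rewrite exprn_gt0//; lra.
rewrite mulrAC ler_pdivrMr// ler_pM2l; last by lra.
apply: (@le_trans _ _ (C `^ 3)); first by rewrite ler_powR//; lra.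
by rewrite powR_nat3// lerXn2r ?nnegrE//; lra.
Qed.

(** For [C < 5 / 2] the bracket is at least [4 / 25 - 4 / 27 = 8 / 675], and [90 * 8 / 675 > 1]: the
    claimed bound exceeds every probability. *)
Lemma bound_ge1_of_small (C w g k x : R) : 0 < C -> C < 5 / 2 -> 0 < w -> 90 <= k -> 1 <= x ->
  w * (C^-1 ^+ 2 - 4 / 27) <= g -> 1 <= k * g * (x / w).
Proof.
move=> C0 C52 w0 hk hx hg.
have hC : 2 / 5 <= C^-1 by rewrite -[leLHS]invrK lef_pV2 ?posrE ?invr_gt0//; lra.
have hC2 : 4 / 25 <= C^-1 ^+ 2 by rewrite expr2; have := ler_pM _ _ hC hC => /(_ _ _); lra.
have : 4 / 25 - 4 / 27 <= g / w.
  by rewrite ler_pdivlMr// mulrC; apply: le_trans hg; rewrite ler_pM2l//; lra.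
have -> : k * g * (x / w) = k * x * (g / w) by ring.
move: (g / w) => z hz.
have h90 : 90 <= k * x by rewrite -[90]mulr1; apply: ler_pM => //; lra.
have z0 : 0 <= z by lra.
have := ler_wpM2r z0 h90; lra.
Qed.

(** The normalising factor is that of [n] exchanges, each costing the inverse [p]-th power of
    [eps * Num.sqrt n%:R]. *)
Lemma normalization_power (n : nat) (eps q : R) : (0 < n)%N -> 0 < eps ->
  (n%:R `^ ((2 + q - 2) / 2) * eps `^ (2 + q))^-1 = n%:R / (eps * Num.sqrt n%:R) `^ (2 + q).
Proof.
move=> n0 eps0; have nR : 0 < n%:R :> R by rewrite ltr0n.
rewrite powRM ?sqrtr_ge0 ?(ltW eps0)// -powR12_sqrt ?(ltW nR)// -powRrM.
have -> : 2^-1 * (2 + q) = 1 + (2 + q - 2) / 2 by field.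
rewrite (@powR_add _ n%:R 1 ((2 + q - 2) / 2) nR) powRr1 ?(ltW nR)//.
have e1 : 0 < eps `^ (2 + q) by exact: powR_gt0.
have e2 : 0 < n%:R `^ ((2 + q - 2) / 2) by exact: powR_gt0.
move: e1 e2; move: (eps `^ (2 + q)) (n%:R `^ ((2 + q - 2) / 2)) => x y x0 y0.
by field; rewrite !gt_eqF.
Qed.

End final_estimate.

Theorem theorem1 (R : realType) (Omega : Type)
    (H : set (Omega -> R)) (E : (Omega -> R) -> R)
    (hE : sublinear_expectation H E)
    (X : nat -> Omega -> R)
    (hiid : iid_with0 H E X)
    (hX0 : H (X 0%N)) (hX0sq : H (fun w => X 0%N w ^+ 2))
    (hsigma : (0 < sigma_inf E (X 0%N))%E /\
              (sigma_inf E (X 0%N) <= sigma_sup E (X 0%N))%E /\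
              (sigma_sup E (X 0%N) < +oo)%E)
    (n : nat) (hn : (1 <= n)%N)
    (D : set (C01 R)) (eps : R) (heps : 0 < eps) :
  exists mu sigma : forall i : nat, 'rV[R]_i -> R,
    normalization E (X 0%N) n mu sigma /\
    forall (d : measure_display) (T : measurableType d) (P : probability T R)
      (B : T -> C01 R), standard_wiener P B ->
    forall p : R, 2 <= p <= 3 ->
      (upper_prob H E X n (S_line X n mu sigma) D
         - P [set w | enlarge D eps (B w)]
       <= (C2 p)%:E * gamma_trunc H E (X 0%N) p (eps * Num.sqrt n%:R)
            * ((n%:R `^ ((p - 2) / 2) * eps `^ p)^-1)%:E)%E /\
      ((C2 p)%:E * gamma_trunc H E (X 0%N) p (eps * Num.sqrt n%:R)
            * ((n%:R `^ ((p - 2) / 2) * eps `^ p)^-1)%:E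
       <= (C2 p)%:E * gamma H E (X 0%N) p
            * ((n%:R `^ ((p - 2) / 2) * eps `^ p)^-1)%:E)%E.

Proof.
have [sl [sh [sl0 hs]]] := sigma_bounds hsigma.
have mu0 := mu_lo_le_hi hE hX0.
have lo_gt0 m : mu_lo E (X 0%N) <= m <= mu_hi E (X 0%N) -> 0 < sigma_lo E (X 0%N) m.
  by move=> /hs[h _]; exact: lt_le_trans h.
have nR : 0 < n%:R :> R by rewrite ltr0n.
have sn0 : 0 < Num.sqrt n%:R :> R by rewrite sqrtr_gt0.
set C := eps * Num.sqrt n%:R; have C0 : 0 < C by rewrite mulr_gt0.
(* The cube covers all [p <= 3] at once, as [eta] enters the strategy before [p] is given. *)
pose eta : R := 1 / 50 / (1 + C) ^+ 3.
have eta0 : 0 < eta by rewrite divr_gt0 ?divr_gt0// exprn_gt0// addr_gt0.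
have [mu [sigma [hnorm hup]]] := exists_normalization hE hiid hX0 hX0sq hsigma D hn heps eta0.
exists mu, sigma; split => // d T P B hB p hp.
have [q [q01 pq]] : exists q : R, 0 <= q <= 1 /\ p = 2 + q.
  by exists (p - 2); split; [move: hp; lra|ring].
have /andP[q0 q1] := q01.
have Cp : 0 < C `^ p by exact: powR_gt0.
have C290 := C2_ge hp; have C2pos : 0 < C2 p by lra.
have rrE : (n%:R `^ ((p - 2) / 2) * eps `^ p)^-1 = n%:R / C `^ p.
  by rewrite pq normalization_power.
rewrite rrE.
have rr0 : 0 < n%:R / C `^ p by exact: divr_gt0.
split; last first.
  rewrite lee_wpmul2r ?lee_fin ?(ltW rr0)// lee_wpmul2l ?lee_fin ?(ltW C2pos)//.
  exact: gamma_trunc_le_gamma.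
have mG : measurable [set w | enlarge D eps (B w)].
  by apply: measurable_enlarge; exact: wiener_measurable hB.
rewrite leeBlDr ?fin_num_measure//.
have mulo : mu_lo E (X 0%N) <= mu_lo E (X 0%N) <= mu_hi E (X 0%N) by rewrite lexx.
have gge := gamma_trunc_ge hE hX0 hX0sq (lo_gt0 _ mulo).
have P0 : (0 <= P [set w | enlarge D eps (B w)])%E by [].
(* An infinite moment makes the bound trivial, and [-oo] is excluded by the zero minorant. *)
case EG : (gamma_trunc H E (X 0%N) p C) => [g| |]; last first.
- have : (0%:E <= gamma_trunc H E (X 0%N) p C)%E.
    rewrite -[0]addr0; apply: gge => // y.
    by rewrite mul0r addr0 le_min powR_ge0 mulr_ge0 ?powR_ge0 ?sqr_ge0.
  by rewrite EG.
- by rewrite gt0_muley ?lte_fin// gt0_mulye ?lte_fin// addye ?leey// gt_eqF// (lt_le_trans _ P0).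
have gge' (al be : R) : 0 <= al ->
    (forall y : R, al * y ^+ 2 + be <= Num.min (`|y| `^ p) (C `^ (p - 2) * y ^+ 2)) -> al + be <= g.
  by move=> al0 h; have := gge p C al be al0 h; rewrite EG lee_fin.
rewrite -!EFinM.
have triv : 1 <= C2 p * g * (n%:R / C `^ p) ->
    (upper_prob H E X n (S_line X n mu sigma) D <=
     (C2 p * g * (n%:R / C `^ p))%:E + P [set w | enlarge D eps (B w)])%E.
  move=> h1; apply: le_trans (upper_prob_le1 X hE n _ D) _.
  by rewrite -[1%E]adde0; apply: leeD.
have n1 : 1 <= n%:R :> R by rewrite ler1n.
have qE : p - 2 = q by rewrite pq; ring.
have [C52|C52] := ltP C (5 / 2).
  apply: triv.
  have hg : C `^ p * (C^-1 ^+ 2 - 4 / 27) <= g.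
    rewrite mulrBr; apply: gge'; first by rewrite mulr_ge0 ?sqr_ge0// ltW.
    move=> y; rewrite qE pq min_trunc_scale// -mulrA -mulrBr ler_pM2l -?pq//.
    have t0 : 0 <= `|y| / C by rewrite divr_ge0// ltW.
    have := sqr_sub_le_min t0 q01.
    by rewrite exprMn real_normK ?num_real// [C^-1 ^+ 2 * _]mulrC pq.
  exact: bound_ge1_of_small C290 n1 hg.
have g1 : 1 <= g.
  have -> : 1 = (1 + q / 2) + (- (q / 2)) :> R by ring.
  apply: gge'; first by lra.
  by move=> y; rewrite qE pq; exact: one_le_min_trunc.
(* In the first case [g >= 1] makes the bound at least one; in the second the power of [C] exceeds
   [C2 p], which forces [C >= 142 / 25]. *)
have [hCn|hCn] := leP (C `^ p) (C2 p * n%:R).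
  apply: triv; have -> : C2 p * g * (n%:R / C `^ p) = g * (C2 p * n%:R / C `^ p) by ring.
  by rewrite -[leLHS]mulr1; apply: ler_pM => //; rewrite ler_pdivlMr// mul1r.
have hC : 142 / 25 <= C.
  apply: (ge142_25 hp C0); apply: le_trans (ltW hCn).
  by rewrite ler_peMr// ltW.
have sE : (Num.sqrt n%:R)^-1 = eps / C.
  by rewrite /C invfM mulrA divff ?gt_eqF// mul1r.
have K0 := step_const_gt0 q01.
have kap0 : 0 < step_const q / C `^ p by exact: divr_gt0.
pose Y0 m w : R := Num.min (`|xi0 E (X 0%N) m w| `^ p) (C `^ (p - 2) * xi0 E (X 0%N) m w ^+ 2).
(* Dividing by [sg] instead of the smaller [sigma_lo] only shrinks the step, so [xi0] controls the
   remainder for every admissible deviation. *)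
have h1 : dominates_remainder E (X 0%N) (11 / 100 * eps) (Num.sqrt n%:R)^-1
    (step_const q / C `^ p) Y0.
  move=> m sg w mi hsg; have l0 := lo_gt0 m mi; have sg0 : 0 < sg by exact: lt_le_trans hsg.
  have ec : 0 <= eps / C by rewrite divr_ge0 ?ltW.
  rewrite /Y0 qE pq sE; apply: taylor_remainder_le => //.
  rewrite normrM (ger0_norm ec) ler_wpM2l// /xi0 !normrM !normfV ler_wpM2l//.
  by rewrite lef_pV2 ?posrE ?normr_gt0 ?gt_eqF// (gtr0_norm l0) (gtr0_norm sg0).
have h2 m : mu_lo E (X 0%N) <= m <= mu_hi E (X 0%N) -> (ext_exp H E (Y0 m) <= g%:E)%E.
  by move=> mi; rewrite -EG; apply: ereal_sup_ubound; exists m => //; rewrite /= in_itv.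
apply: le_trans (hup d T P B hB Y0 _ g kap0 h1 h2) _; rewrite addeC sE; apply: leeD => //.
rewrite lee_fin.
have nC : n%:R * eps ^+ 2 = C ^+ 2 by rewrite /C exprMn sqr_sqrtr ?(ltW nR)// mulrC.
rewrite nC.
have C1 : 1 <= C by apply: le_trans hC; lra.
have heta : eta * C `^ (2 + q) <= 1 / 50 := slack_le C1 q01.
have := total_cost_le heps hC q01 g1 heta; rewrite -pq => htot.
have := ler_wpM2l (ltW nR) htot; congr (_ <= _); ring.
Qed.
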